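(* Let $\alpha>-1/2$, $\beta\in\mathbb{R}$, and for $\varepsilon>0$ let $(q^0_t,p^0_t)$ be the solution of $$\mathrm{d} q_t^0 = p_t^0\,\mathrm{d} t,\qquad \varepsilon^{\beta}\,\mathrm{d} p_t^0 = -p_t^0\,\mathrm{d} t + \frac{1}{\varepsilon}(t q_t^0+\varepsilon)\,\mathrm{d} t + \varepsilon^{\alpha}\,\mathrm{d} W_t .$$ If $\alpha>1/4$ then $$\lim_{\varepsilon\downarrow 0}\liminf_{s\to-\infty}\mathbb{P}^{s}\Big\{\lim_{t\to\infty}q^0_t=+\infty\Big\}=1,$$ while if $\alpha<1/4$ then $$\lim_{\varepsilon\downarrow 0}\liminf_{s\to-\infty}\mathbb{P}^{s}\Big\{\lim_{t\to\infty}q^0_t=+\infty\Big\}=\lim_{\varepsilon\downarrow 0}\liminf_{s\to-\infty}\mathbb{P}^{s}\Big\{\lim_{t\to\infty}q^0_t=-\infty\Big\}=\frac12 .$$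
   Context: $W$ is a standard one-dimensional Brownian motion. For $s<0$, $\mathbb{P}^s$ denotes the law of the solution started at time $s$ with vanishing initial condition, i.e. $q^0_s=p^0_s=0$. *)

(* Defs.v *)
From mathcomp Require Import all_boot all_order all_algebra.
From mathcomp Require Import all_classical all_reals all_analysis.

Set Implicit Arguments.
Unset Strict Implicit.
Unset Printing Implicit Defensive.

Import Order.TTheory GRing.Theory Num.Theory.
Import numFieldNormedType.Exports.

Local Open Scope classical_set_scope.
Local Open Scope ring_scope.

(* The product rule is stated for the whole family only: taking A i = setT
   gives it for every subfamily. *)
Definition mutually_independent (R : realType) (d : measure_display)
    (T : measurableType d) (P : probability T R) (I : finType)
    (X : I -> T -> R) : Prop :=
  forall A : I -> set R, (forall i, measurable (A i)) ->
    P (\bigcap_i X i @^-1` A i) = (\prod_i P (X i @^-1` A i))%E.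

(* Only the values B u with 0 <= u matter.  The second parameter of
   normal_prob is the standard deviation, so B v - B u has variance v - u. *)
Definition standard_brownian_motion (R : realType) (d : measure_display)
    (T : measurableType d) (P : probability T R) (B : R -> T -> R) : Prop :=
  [/\ forall u : R, 0 <= u -> measurable_fun setT (B u),
      {ae P, forall w, B 0 w = 0},
      forall (n : nat) (u : nat -> R), 0 <= u 0%N ->
        {homo u : i j / (i <= j)%N >-> i <= j} ->
        mutually_independent P
          (fun (i : 'I_n) w => B (u i.+1) w - B (u i) w),
      forall u v : R, 0 <= u -> u < v -> forall A : set R, measurable A ->
        P ((fun w => B v w - B u w) @^-1` A)
          = normal_prob 0 (Num.sqrt (v - u)) A
    & {ae P, forall w, {within `[0, +oo[, continuous (B ^~ w)}} ].

(* (q, p) is a continuous process on [s, +oo[ solving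
     dq = p dt,
     eps^beta dp = - p dt + eps^-1 (t q + eps) dt + eps^alpha dW,
     q_s = p_s = 0,
   where the increments (W_(s+u) - W_s)_(u >= 0) form a standard Brownian
   motion.  The noise coefficient eps^alpha is constant, so its stochastic
   integral over [s, t] is eps^alpha (W_t - W_s), and the integral form of the
   equation only involves ordinary integrals of continuous paths. *)
Definition sde_solution (R : realType) (d : measure_display)
    (T : measurableType d) (P : probability T R) (alpha beta eps s : R)
    (W q p : R -> T -> R) : Prop :=
  [/\ standard_brownian_motion P (fun u w => W (s + u) w - W s w),
      forall t, s <= t ->
        measurable_fun setT (q t) /\ measurable_fun setT (p t),
      forall w, {within `[s, +oo[, continuous (q ^~ w)} /\
                {within `[s, +oo[, continuous (p ^~ w)},
      {ae P, forall w, q s w = 0 /\ p s w = 0}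
    & {ae P, forall w, forall t, s <= t ->
        q t w - q s w = \int[lebesgue_measure]_(u in `[s, t]) p u w /\
        eps `^ beta * (p t w - p s w) =
          \int[lebesgue_measure]_(u in `[s, t])
             (- p u w + eps^-1 * (u * q u w + eps))
          + eps `^ alpha * (W t w - W s w)} ].

(* Main.v *)
(* Put a = eps^beta, c = eps^alpha, and let psi be the recessive solution of the
   adjoint equation a psi'' = psi' + (t / eps) psi, an Airy function times an
   exponential.  Pairing the equation with psi gives a linear functional Y of
   (q, p - (c / a) W) whose drift is deterministic,
     Y(t) = \int_s^t psi + c J(t),   J(t) = - \int_s^t psi' W,
   and q diverges to +oo or -oo according to the sign of the limit of Y.  The
   limit of J is centred Gaussian with variance \int_s^oo psi^2 (Riemann sums
   of J are linear combinations of Brownian increments), so both escape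
   probabilities are known exactly for every s.  As s -> -oo they tend to
   Phi(+-m / (c sqrt S)) with m = \int psi and S = \int psi^2.  The correlation
   F(h) = \int psi(t) psi(t + h) dt satisfies F' = - (h / (2 eps)) F, whence
   m^2 = \int F = 2 sqrt(pi eps) S, and m / (c sqrt S) is a constant times
   eps^(1/4 - alpha). *)
Require Import Defs.
From mathcomp Require Import all_boot all_order all_algebra.
From mathcomp Require Import all_classical all_reals all_analysis.
From mathcomp Require Import measurable_realfun ring lra.

Set Implicit Arguments.
Unset Strict Implicit.
Unset Printing Implicit Defensive.

Import Order.TTheory GRing.Theory Num.Theory.
Import numFieldNormedType.Exports.

Local Open Scope classical_set_scope.
Local Open Scope ring_scope.

(** Only lower bounds on probabilities are ever proved. For each sign the escape event is shown to
    have probability at least the predicted value of [normal_cdf]; the two events are disjoint and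
    the two values add up to one, so both bounds are equalities, and the event where the limit of
    [Y] vanishes never has to be discussed. This is why the passage to the limit reduces to the
    one-sided [tail_limit]. No stochastic integral is built: [J] is read off from the solution at a
    single time, is differentiable in time path by path, and is Gaussian as a limit of finite sums
    of increments. Passing from the sign of the limit of [Y] to the divergence of [q] needs control
    of the noise at infinity. Since [psi] decays faster than any exponential, an almost sure bound
    on the integral of [expR (- t)] times the absolute noise suffices, and first moments with
    Fatou's lemma provide it. The sign of [total psi] is not evident, as [psi] is known to be
    positive only for [0 <= t]. It comes from the Laplace transform of [psi], which solves a linear
    first-order equation and therefore keeps its sign. *)

(** * Derivation rules and mean value inequalities *)

Section pointwise_derivation_rules.
Context {R : realType}.
Implicit Types (f g : R -> R) (a b c x : R).

(* Hides the class is_derive, so that applying der_eq does not trigger instance search. *)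
Definition has_derive f x a : Prop := is_derive x 1 f a.

Lemma der_eq f x a b : has_derive f x a -> a = b -> is_derive x 1 f b.
Proof. by rewrite /has_derive => ? <-. Qed.

Lemma der_id x : is_derive x 1 (fun t : R => t) 1.
Proof. exact: is_derive_id. Qed.

Lemma der_cst x c : is_derive x 1 (fun _ : R => c) 0.
Proof. exact: is_derive_cst. Qed.

Lemma derD f g x a b : is_derive x 1 f a -> is_derive x 1 g b ->
  is_derive x 1 (fun t => f t + g t) (a + b).
Proof. exact: is_deriveD. Qed.

Lemma derN f x a : is_derive x 1 f a -> is_derive x 1 (fun t => - f t) (- a).
Proof. exact: is_deriveN. Qed.

Lemma derM f g x a b : is_derive x 1 f a -> is_derive x 1 g b ->
  is_derive x 1 (fun t => f t * g t) (a * g x + f x * b).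
Proof.
move=> fa gb; apply: (der_eq (is_deriveM fa gb)).
by rewrite addrC -![_ *: _]/(_ * _) mulrC.
Qed.

Lemma derX f x a n : is_derive x 1 f a ->
  is_derive x 1 (fun t => f t ^+ n.+1) (n.+1%:R * f x ^+ n * a).
Proof.
move=> fa; have -> : (fun t => f t ^+ n.+1) = f ^+ n.+1 by apply/funext => t; rewrite fctE.
exact: is_deriveX.
Qed.

Lemma derV f x a : f x != 0 -> is_derive x 1 f a ->
  is_derive x 1 (fun t => (f t)^-1) (- a / f x ^+ 2).
Proof.
move=> f0 fa; apply: (der_eq (is_deriveV f0 fa)).
by rewrite -[_ *: _]/(_ * _) mulrC mulNr mulrN.
Qed.

Lemma der_comp f g x a b : is_derive x 1 f a -> is_derive (f x) 1 g b ->
  is_derive x 1 (fun t => g (f t)) (b * a).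
Proof. by move=> fa gb; exact: is_derive1_comp. Qed.

Lemma der_exp f x a : is_derive x 1 f a ->
  is_derive x 1 (fun t => expR (f t)) (expR (f x) * a).
Proof. by move=> fa; apply: der_comp; exact: is_derive_expR. Qed.

End pointwise_derivation_rules.

(** The rules fill in the derivative as an existential variable, and [der_auto] leaves only the
    equation between it and the claimed value. Hypotheses are tried before the structural rules, so
    that an assumed derivative of a compound function takes precedence. *)
Ltac der := repeat first
  [ match goal with
    | H : forall _, is_derive _ _ _ _ |- _ => simple apply H
    | H : is_derive _ _ _ _ |- _ => simple apply H
    end
  | notypeclasses refine (der_cst _ _) | notypeclasses refine (der_id _)
  | assumption | notypeclasses refine (der_exp _) | notypeclasses refine (derX _ _)
  | notypeclasses refine (derV _ _) | notypeclasses refine (derN _)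
  | notypeclasses refine (derM _ _) | notypeclasses refine (derD _ _) ].

Ltac der_auto := eapply der_eq; [unfold has_derive; der | cbv beta].

Section mean_value.
Context {R : realType}.
Implicit Types (f df : R -> R) (a b x K : R).

Lemma is_derive_continuous f x l : is_derive x 1 f l -> {for x, continuous f}.
Proof. by move=> fl; apply/differentiable_continuous/derivable1_diffP. Qed.

Lemma is_derive_within f df a b : (forall x, a <= x <= b -> has_derive f x (df x)) ->
  {within `[a, b], continuous f}.
Proof.
move=> fd; apply: continuous_in_subspaceT => x; rewrite inE/= in_itv/= => xab.
exact: is_derive_continuous (fd x xab).
Qed.

(** The degenerate interval is a separate disjunct, so that callers only need [a <= b]. The
    derivative is asked on the open interval because integrals started at [s] are differentiable
    only after [s]. *)
Lemma mvt f df a b : a <= b ->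
  (forall x, a < x < b -> has_derive f x (df x)) ->
  {within `[a, b], continuous f} ->
  a = b \/ exists2 c, a < c < b & f b - f a = df c * (b - a).
Proof.
rewrite le_eqVlt => /predU1P[->|ab fd cf]; first by left.
have fd' : forall x, x \in `]a, b[ -> is_derive x 1 f (df x).
  by move=> x; rewrite in_itv/=; exact: fd.
by right; have [c] := MVT ab fd' cf; rewrite in_itv/=; exists c.
Qed.

Lemma mvt_le f df a b : a <= b ->
  (forall x, a < x < b -> has_derive f x (df x)) ->
  {within `[a, b], continuous f} ->
  (forall x, a < x < b -> 0 <= df x) -> f a <= f b.
Proof.
move=> ab fd cf df0; have [->//|[c cab E]] := mvt ab fd cf.
by rewrite -subr_ge0 E mulr_ge0 ?df0// subr_ge0.
Qed.

Lemma mvt_dist f df a b K : a <= b ->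
  (forall x, a < x < b -> has_derive f x (df x)) ->
  {within `[a, b], continuous f} ->
  (forall x, a < x < b -> `|df x| <= K) -> `|f b - f a| <= K * (b - a).
Proof.
move=> ab fd cf df0; have [->|[c cab ->]] := mvt ab fd cf.
  by rewrite !subrr normr0 mulr0.
by rewrite normrM (@ger0_norm _ (b - a)) ?subr_ge0// ler_wpM2r ?subr_ge0// df0.
Qed.

Lemma derive_ge0_le f df a b : a <= b ->
  (forall x, a <= x <= b -> has_derive f x (df x)) ->
  (forall x, a <= x <= b -> 0 <= df x) -> f a <= f b.
Proof.
move=> ab fd df0; apply: (mvt_le ab (df := df)).
- by move=> x /andP[? ?]; apply: fd; rewrite !ltW.
- exact: is_derive_within fd.
- by move=> x /andP[? ?]; apply: df0; rewrite !ltW.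
Qed.

Lemma derive_gt0_lt f df a b : a < b ->
  (forall x, a <= x <= b -> has_derive f x (df x)) ->
  (forall x, a <= x <= b -> 0 < df x) -> f a < f b.
Proof.
move=> ab fd df0.
have [||E|[c cab E]] := @mvt f df _ _ (ltW ab).
- by move=> x /andP[? ?]; apply: fd; rewrite !ltW.
- exact: is_derive_within fd.
- by rewrite E ltxx in ab.
by rewrite -subr_gt0 E mulr_gt0 ?subr_gt0// df0//; case/andP: cab => *; rewrite !ltW.
Qed.

Lemma derive0_const f : (forall x, has_derive f x 0) -> forall x y, f x = f y.
Proof.
move=> fd; suff H x y : x <= y -> f x = f y.
  by move=> x y; case: (leP x y) => [/H//|/ltW/H].
move=> xy; have [|->//|[c _]] := @mvt f (fun=> 0) _ _ xy (fun z _ => fd z).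
  by apply: (is_derive_within (df := fun=> 0)) => *; exact: fd.
by move/eqP; rewrite mul0r subr_eq0 => /eqP.
Qed.

End mean_value.

(** * Entire power series and the hypergeometric function 0F1 *)

Section entire_series.
Context {R : realType}.
Implicit Types (c : R^nat) (x y k nu : R).

(** Unlike convergence on the whole line, this bound passes directly to the derived series, and
    differentiating term by term needs it for the first two of them. *)
Definition factorial_decay c :=
  exists K M : R, 0 <= M /\ forall n, `|c n| <= K * (M ^+ n / n`!%:R).

Definition entire_sum c y : R := limn (pseries c y).

Lemma factorial_decay_cvg c y : factorial_decay c -> cvgn (pseries c y).
Proof.
move=> [K [M [M0 cM]]]; apply: normed_cvg.
have : cvgn (K *: series (exp_coeff (M * `|y|))).
  by apply: is_cvgZr; exact: is_cvg_series_exp_coeff.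
rewrite -[K *: _]/(fun n => K *: series (exp_coeff (M * `|y|)) n).
under eq_fun do rewrite seriesEnat/= scaler_sumr.
move=> H; apply: series_le_cvg H => n.
- exact: normr_ge0.
- rewrite mulr_ge0//; last by rewrite exp_coeff_ge0// mulr_ge0.
  by have := le_trans (normr_ge0 _) (cM 0%N); rewrite expr0 fact0 divr1 mulr1.
rewrite /= normrM normrX /exp_coeff/= exprMn.
have -> : K *: (M ^+ n * `|y| ^+ n / n`!%:R) = K * (M ^+ n / n`!%:R) * `|y| ^+ n.
  by rewrite -[_ *: _]/(_ * _) mulrAC !mulrA.
by rewrite ler_wpM2r// exprn_ge0.
Qed.

Lemma factorial_decay_diffs c : factorial_decay c -> factorial_decay (pseries_diffs c).
Proof.
move=> [K [M [M0 cM]]]; exists (K * M), M; split=> // n.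
rewrite /pseries_diffs normrM ger0_norm// (le_trans (ler_wpM2l _ (cM n.+1)))//.
rewrite factS natrM invfM exprS le_eqVlt; apply/orP; left; apply/eqP.
have n0 : (n.+1%:R : R) != 0 by rewrite pnatr_eq0.
have f0 : (n`!%:R : R) != 0 by rewrite pnatr_eq0 -lt0n fact_gt0.
by field; rewrite f0 nat1r.
Qed.

Lemma is_derive_entire_sum c y : factorial_decay c ->
  is_derive y 1 (entire_sum c) (entire_sum (pseries_diffs c) y).
Proof.
move=> fc; apply: (@pseries_snd_diffs _ _ (`|y| + 1)).
- exact: factorial_decay_cvg.
- by apply: factorial_decay_cvg; exact: factorial_decay_diffs.
- by apply: factorial_decay_cvg; do 2 apply: factorial_decay_diffs.
- by rewrite [ltRHS]ger0_norm ?ltrDl ?ltr01 ?addr_ge0 ?normr_ge0.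
Qed.

Lemma entire_sum_ge0 c y : factorial_decay c -> (forall n, 0 <= c n) -> 0 <= y ->
  0 <= entire_sum c y.
Proof.
move=> fc c0 y0; apply: limr_ge; first exact: factorial_decay_cvg.
by apply: nearW => n; apply: sumr_ge0 => i _; rewrite mulr_ge0// exprn_ge0.
Qed.

Lemma entire_sum0 c : entire_sum c 0 = c 0%N.
Proof.
apply: lim_near_cst => //; near=> n.
have n0 : (0 < n)%N by near: n; exact: nbhs_infty_gt.
rewrite /pseries seriesEnat/= big_ltn// expr0 mulr1 big1_seq ?addr0// => i.
by rewrite mem_index_iota => /andP[_ /andP[i0 _]]; rewrite expr0n gtn_eqF// mulr0.
Unshelve. all: end_near. Qed.

(* The coefficients of 0F1(; nu; k y), whose sum F solves y F'' + nu F' = k F. *)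
Fixpoint hypgeo_coeff nu k (n : nat) : R :=
  if n is m.+1 then hypgeo_coeff nu k m * (k / (m.+1%:R * (m%:R + nu))) else 1.

Lemma hypgeo_coeff_ge0 nu k n : 0 < nu -> 0 <= k -> 0 <= hypgeo_coeff nu k n.
Proof.
move=> nu0 k0; elim: n => [|n IH]//=.
by rewrite mulr_ge0// divr_ge0// mulr_ge0// addr_ge0// ltW.
Qed.

Lemma hypgeo_coeff_decay nu k : 0 < nu -> 0 <= k -> factorial_decay (hypgeo_coeff nu k).
Proof.
move=> nu0 k0; exists 1, (k / nu); split; first by rewrite divr_ge0// ltW.
move=> n; rewrite mul1r ger0_norm ?hypgeo_coeff_ge0//.
elim: n => [|n IH]; first by rewrite /= expr0 fact0 divr1.
have n0 : (n.+1%:R : R) != 0 by rewrite pnatr_eq0.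
have f0 : (n`!%:R : R) != 0 by rewrite pnatr_eq0 -lt0n fact_gt0.
apply: (@le_trans _ _ (((k / nu) ^+ n / n`!%:R) * (k / (n.+1%:R * nu)))).
  rewrite /= ler_pM ?hypgeo_coeff_ge0//.
    by rewrite divr_ge0// mulr_ge0// addr_ge0// ltW.
  rewrite ler_wpM2l// lef_pV2 ?posrE ?mulr_gt0 ?ltr_wpDl//.
  by rewrite ler_wpM2l// lerDr.
rewrite exprS factS natrM le_eqVlt; apply/orP; left; apply/eqP.
by field; rewrite f0 nat1r n0 gt_eqF.
Qed.

(** By the recursion on the coefficients, the partial sums satisfy the equation up to the single
    term [n%:R * (n%:R + 1) * c n.+1 * y ^+ n]. Shifted by one, this is [y] times the general term
    of the second derived series, so it tends to 0. *)
Lemma hypgeo_ode nu k y : 0 < nu -> 0 <= k ->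
  let c := hypgeo_coeff nu k in
  y * entire_sum (pseries_diffs (pseries_diffs c)) y
    + nu * entire_sum (pseries_diffs c) y = k * entire_sum c y.
Proof.
move=> nu0 k0 c; have dc : factorial_decay c by exact: hypgeo_coeff_decay.
have dc1 := factorial_decay_diffs dc; have dc2 := factorial_decay_diffs dc1.
pose c2 := pseries_diffs (pseries_diffs c).
have cv := @factorial_decay_cvg _ y dc; have cv1 := @factorial_decay_cvg _ y dc1.
have cv2 := @factorial_decay_cvg _ y dc2.
have H : y * pseries c2 y n + nu * pseries (pseries_diffs c) y n - k * pseries c y n
    @[n --> \oo] --> y * entire_sum c2 y + nu * entire_sum (pseries_diffs c) y
       - k * entire_sum c y.
  by apply: cvgB; [apply: cvgD|]; apply: cvgMl_tmp.
apply/eqP; rewrite -subr_eq0; apply/eqP.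
have /cvg_series_cvg_0 t0 : cvgn (pseries c2 y) by [].
have E n : y * pseries c2 y n + nu * pseries (pseries_diffs c) y n - k * pseries c y n
   = n%:R * (n%:R + 1) * c n.+1 * y ^+ n.
  rewrite /pseries !seriesEnat/=; elim: n => [|n IH].
    by rewrite !big_geq// !mulr0 !mul0r; ring.
  rewrite !big_nat_recr// !mulrDr.
  rewrite (_ : _ - _ = n%:R * (n%:R + 1) * c n.+1 * y ^+ n +
    (y * (c2 n * y ^+ n) + nu * (pseries_diffs c n * y ^+ n) - k * (c n * y ^+ n)));
    last by rewrite -IH; ring.
  have -> : k * (c n * y ^+ n) = n.+1%:R * (n%:R + nu) * c n.+1 * y ^+ n.
    rewrite /c /=; field.
    by rewrite nat1r pnatr_eq0 gt_eqF ?ltr_wpDl//.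
  by rewrite /c2 /pseries_diffs -[n.+2%:R]natr1 -[n.+1%:R]natr1 exprS; ring.
have H0 : n%:R * (n%:R + 1) * c n.+1 * y ^+ n @[n --> \oo] --> (0 : R).
  rewrite -(cvg_shiftS (fun n => n%:R * (n%:R + 1) * c n.+1 * y ^+ n)) /=.
  have L : y * (c2 n * y ^+ n) @[n --> \oo] --> y * 0 by exact: cvgMl_tmp t0.
  rewrite mulr0 in L; apply: cvg_trans L; apply: near_eq_cvg; apply: nearW => n /=.
  by rewrite /c2 /pseries_diffs -[n.+2%:R]natr1 -[n.+1%:R]natr1 exprS; ring.
by move: H; under eq_fun do rewrite E; move=> H; exact: cvg_unique H H0.
Qed.

End entire_series.

(** * The Airy equation: the recessive solution and its bounds *)

Section airy.
Context {R : realType}.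
Variable k : R.
Hypothesis k_gt0 : 0 < k.

Definition airy_system (y y1 : R -> R) :=
  forall x : R, is_derive x 1 y (y1 x) /\ is_derive x 1 y1 (k * x * y x).

(** The substitution of [x ^+ 3] turns the Airy equation into that of 0F1: [F (x ^+ 3)] corresponds
    to parameter 2/3 and [x * G (x ^+ 3)] to 4/3, and the chain rule produces the factor 9 that
    divides [k]. *)
Lemma airy_fundamental : exists f f1 g g1 : R -> R,
  [/\ airy_system f f1, airy_system g g1,
      [/\ f 0 = 1, f1 0 = 0, g 0 = 0 & g1 0 = 1] & forall x, 0 <= x -> 0 <= g x].
Proof.
pose kk := k / 9.
have kk0 : 0 <= kk by rewrite divr_ge0// ltW.
pose c := hypgeo_coeff (2 / 3) kk; pose e := hypgeo_coeff (4 / 3) kk.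
have p23 : 0 < 2 / 3 :> R by lra.
have p43 : 0 < 4 / 3 :> R by lra.
have dc : factorial_decay c by exact: hypgeo_coeff_decay.
have de : factorial_decay e by exact: hypgeo_coeff_decay.
have dc1 := factorial_decay_diffs dc; have de1 := factorial_decay_diffs de.
pose F := entire_sum c; pose F1 := entire_sum (pseries_diffs c).
pose F2 := entire_sum (pseries_diffs (pseries_diffs c)).
pose G := entire_sum e; pose G1 := entire_sum (pseries_diffs e).
pose G2 := entire_sum (pseries_diffs (pseries_diffs e)).
have cube (H H1 : R -> R) (Hd : forall y : R, is_derive y 1 H (H1 y)) (x : R) :
    is_derive x 1 (fun t => H (t ^+ 3)) (3 * x ^+ 2 * H1 (x ^+ 3)).
  have d3 : is_derive x 1 (fun t : R => t ^+ 3) (3 * x ^+ 2) by der_auto; ring.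
  by apply: (der_eq (der_comp d3 (Hd _))); ring.
have dF := cube F F1 (fun y => is_derive_entire_sum y dc).
have dF1 := cube F1 F2 (fun y => is_derive_entire_sum y dc1).
have dG := cube G G1 (fun y => is_derive_entire_sum y de).
have dG1 := cube G1 G2 (fun y => is_derive_entire_sum y de1).
have odeF y : y * F2 y + (2 / 3) * F1 y = kk * F y by exact: hypgeo_ode.
have odeG y : y * G2 y + (4 / 3) * G1 y = kk * G y by exact: hypgeo_ode.
exists (fun t => F (t ^+ 3)), (fun t => 3 * t ^+ 2 * F1 (t ^+ 3)),
  (fun t => t * G (t ^+ 3)), (fun t => G (t ^+ 3) + 3 * t ^+ 3 * G1 (t ^+ 3)); split.
- move=> x; split; first exact: dF.
  der_auto.
  have -> : k * x * F (x ^+ 3) = 9 * x * (kk * F (x ^+ 3)) by rewrite /kk; field.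
  by rewrite -odeF; field.
- move=> x; split; first by der_auto; ring.
  der_auto.
  have -> : k * x * (x * G (x ^+ 3)) = 9 * x ^+ 2 * (kk * G (x ^+ 3)) by rewrite /kk; field.
  by rewrite -odeG; field.
- have e0 : (0 : R) ^+ 3 = 0 by rewrite expr0n.
  by split; rewrite ?e0 ?expr0n /= ?mulr0 ?mul0r ?addr0 // /F /G entire_sum0.
- move=> x x0; rewrite mulr_ge0// entire_sum_ge0//; last by rewrite exprn_ge0.
  by move=> n; apply: hypgeo_coeff_ge0.
Qed.
End airy.

Section airy_recessive_solution.
Context {R : realType}.
Variable k : R.
Hypothesis k_gt0 : 0 < k.

(* A = f - c g, where c is the limit of the decreasing quotient f/g.  Since
   f/g - 1/(g g') is nondecreasing, it stays below c, so 0 < A <= 1/g' on the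
   positive axis. *)
Lemma airy_recessive : exists A A1 : R -> R,
  airy_system k A A1 /\ forall x, 0 <= x -> 0 < A x <= 1.
Proof.
have [f [f1 [g [g1 [sf sg [f0 f10 g0 g10] g_ge0]]]]] := airy_fundamental k_gt0.
have df x := (sf x).1; have df1 x := (sf x).2.
have dg x := (sg x).1; have dg1 x := (sg x).2.
have wr x : f1 x * g x - f x * g1 x = -1.
  rewrite (@derive0_const _ (fun x => f1 x * g x - f x * g1 x) _ x 0).
    by rewrite f0 f10 g0 g10; ring.
  by move=> y; der_auto; ring.
have g1_ge1 x : 0 <= x -> 1 <= g1 x.
  move=> x0; rewrite -g10; apply: (derive_ge0_le x0 (fun y _ => dg1 y)).
  by move=> y /andP[y0 _]; rewrite !mulr_ge0 ?g_ge0// ltW.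
have g1_gt0 x : 0 <= x -> 0 < g1 x by move=> /g1_ge1; exact: lt_le_trans.
have g_gt0 x : 0 < x -> 0 < g x.
  move=> x0; apply: (lt_le_trans x0); rewrite -subr_ge0.
  suff : g 0 - 0 <= g x - x by rewrite g0 subr0.
  apply: (@derive_ge0_le _ (fun t => g t - t) (fun t => g1 t - 1)); first exact: ltW.
    by move=> y _; der_auto; ring.
  by move=> y /andP[y0 _]; rewrite subr_ge0 g1_ge1.
pose r x := f x / g x; pose h x := f x / g x - (g x * g1 x)^-1.
have rlt x y : 0 < x -> x < y -> r y < r x.
  move=> x0 xy; rewrite -ltrN2.
  apply: (@derive_gt0_lt _ (fun t => - r t) (fun t => (g t ^+ 2)^-1)) => // t /andP[xt _].
    have gt0 := g_gt0 t (lt_le_trans x0 xt).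
    have gn : g t != 0 by rewrite gt_eqF.
    rewrite /r; der_auto.
    by transitivity (- (f1 t * g t - f t * g1 t) / g t ^+ 2); [field|rewrite wr; field].
  by rewrite invr_gt0 exprn_gt0// g_gt0// (lt_le_trans x0).
have hle x y : 0 < x -> x <= y -> h x <= h y.
  move=> x0 xy.
  apply: (@derive_ge0_le _ h (fun t => k * t / (g1 t ^+ 2))) => // t /andP[xt _];
    have t0 := lt_le_trans x0 xt.
    have gn : g t != 0 by rewrite gt_eqF// g_gt0.
    have g1n : g1 t != 0 by rewrite gt_eqF// g1_gt0// ltW.
    have ggn : g t * g1 t != 0 by rewrite mulf_neq0.
    rewrite /h; der_auto.
    have E : f1 t / g t - f t * g1 t / g t ^+ 2 = - (g t ^+ 2)^-1.
      by transitivity ((f1 t * g t - f t * g1 t) / g t ^+ 2); [field|rewrite wr; field].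
    rewrite (_ : _ - _ = f1 t / g t - f t * g1 t / g t ^+ 2
      + (g t ^+ 2)^-1 + k * t / g1 t ^+ 2); first by rewrite E; ring.
    by field; rewrite gn g1n.
  by rewrite divr_ge0 ?exprn_ge0 ?mulr_ge0// ?ltW// g1_gt0 ?ltW.
have hr x : 0 < x -> h x <= r x.
  by move=> x0; rewrite gerBl invr_ge0 mulr_ge0// ltW ?g_gt0 ?g1_gt0 ?ltW.
have hlb x y : 0 < x -> 0 < y -> h x <= r y.
  move=> x0 y0; case: (leP x y) => xy; first by rewrite (le_trans (hle _ _ x0 xy))// hr.
  by rewrite (le_trans (hr _ x0))// ltW// rlt.
pose c := inf [set r x | x in [set x : R | 0 < x]].
have ch x : 0 < x -> h x <= c.
  move=> x0; apply: lb_le_inf; first by exists (r 1), 1 => //=.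
  by move=> _ [y /= y0 <-]; exact: hlb.
have cr x : 0 < x -> c < r x.
  move=> x0; apply: (@le_lt_trans _ _ (r (x + 1))); last by rewrite rlt// ltrDl.
  apply: ge_inf; last by exists (x + 1) => //=; rewrite addr_gt0.
  by exists (h 1) => _ [y /= y0 <-]; exact: hlb.
exists (fun x => f x - c * g x), (fun x => f1 x - c * g1 x); split.
  by move=> x; split; der_auto; ring.
move=> x; rewrite le_eqVlt => /predU1P[<-|x0].
  by rewrite f0 g0 mulr0 subr0 ltr01 lexx.
have gx := g_gt0 x x0; have g1x := g1_ge1 x (ltW x0).
have g1x0 := g1_gt0 x (ltW x0).
have fE : f x = r x * g x by rewrite /r divfK// gt_eqF.
have hE : h x * g x = f x - (g1 x)^-1 by rewrite /h; field; rewrite !gt_eqF.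
apply/andP; split; first by rewrite fE -mulrBl mulr_gt0// subr_gt0 cr.
have : h x * g x <= c * g x by rewrite ler_pM2r// ch.
rewrite hE; have : (g1 x)^-1 <= 1 by rewrite invf_le1.
by lra.
Qed.

End airy_recessive_solution.

Section airy_decay.
Context {R : realType}.
Implicit Types x y t L : R.
Variables (k : R) (A A1 : R -> R).
Hypothesis k_gt0 : 0 < k.
Hypothesis airyA : airy_system k A A1.
Hypothesis A_range : forall x, 0 <= x -> 0 < A x <= 1.

Let dA x := (airyA x).1.
Let dA1 x := (airyA x).2.
Let A_gt0 x : 0 <= x -> 0 < A x. Proof. by move=> /A_range/andP[]. Qed.
Let A_le1 x : 0 <= x -> A x <= 1. Proof. by move=> /A_range/andP[]. Qed.

(* Otherwise w = A' + L A grows like exp (L x) and A would be unbounded. *)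
Lemma airy_log_derive_le L x : 0 < L -> 0 <= x -> L ^+ 2 <= k * x -> A1 x <= - (L * A x).
Proof.
move=> L0 x0 Lx; rewrite leNgt; apply/negP => w0.
pose w y := A1 y + L * A y.
have wx : 0 < w x by rewrite /w; lra.
pose E y := expR (L * (y - x)).
have dE (y : R) : is_derive y 1 E (L * E y) by rewrite /E; der_auto; ring.
have E0 y : 0 < E y by exact: expR_gt0.
have Ex : E x = 1 by rewrite /E subrr mulr0 expR0.
have Lxy y : x <= y -> L ^+ 2 <= k * y.
  by move=> xy; rewrite (le_trans Lx)// ler_wpM2l// ltW.
have wE y : x <= y -> w x * E y <= w y.
  move=> xy; rewrite -ler_pdivlMr//.
  suff : w x / E x <= w y / E y by rewrite Ex divr1.
  apply: (@derive_ge0_le _ (fun t => w t / E t) (fun t => (k * t - L ^+ 2) * A t / E t)) => // t /andP[xt _].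
    have En : E t != 0 by rewrite gt_eqF.
    by rewrite /w; der_auto; field.
  by rewrite divr_ge0 ?mulr_ge0 ?subr_ge0 ?Lxy ?(ltW (A_gt0 _)) ?(ltW (E0 _)) ?(le_trans x0).
(* The derivative of [A * E] is [w * E], which is at least [w x * E ^+ 2] by [wE]; integrating from
   [x] gives the bound. *)
have AE y : x <= y -> w x * (E y ^+ 2 - 1) / (2 * L) < A y * E y.
  move=> xy; rewrite -subr_gt0.
  have H : A x * E x - w x * (E x ^+ 2 - 1) / (2 * L) <= A y * E y - w x * (E y ^+ 2 - 1) / (2 * L).
    apply: (@derive_ge0_le _ (fun t => A t * E t - w x * (E t ^+ 2 - 1) / (2 * L))
      (fun t => (w t - w x * E t) * E t)) => // t /andP[xt _].
      by der_auto; rewrite /w; field; rewrite gt_eqF.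
    by rewrite mulr_ge0 ?subr_ge0 ?wE ?(ltW (E0 _)).
  by apply: lt_le_trans H; rewrite Ex expr1n subrr mulr0 mul0r subr0 mulr1 A_gt0.
(* Far enough for a contradiction: the lower bound on [A y * E y] exceeds [3 / 2 * E y], while
   [A y <= 1]. *)
pose y := x + 3 / w x.
have xy : x <= y by rewrite lerDl divr_ge0// ltW.
have := AE y xy; rewrite ltr_pdivrMr ?mulr_gt0// => H.
have E1 : 1 + L * (y - x) <= E y by exact: expR_ge1Dx.
have yxE : L * (y - x) * w x = 3 * L by rewrite /y; field; rewrite gt_eqF.
have Ay := A_le1 (le_trans x0 xy).
have : A y * E y * (2 * L) <= E y * (2 * L).
  by rewrite ler_wpM2r ?mulr_ge0 ?(ltW L0)// ler_piMl// ltW.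
have : w x * (L * (y - x)) * E y <= w x * (E y ^+ 2 - 1).
  have e1 : 1 <= E y.
    by apply: le_trans E1; rewrite lerDl mulr_ge0 ?(ltW L0)// subr_ge0.
  rewrite -mulrA ler_pM2l// (@le_trans _ _ ((E y - 1) * E y))//.
    by rewrite ler_pM2r//; lra.
  by rewrite expr2; lra.
have : 0 < L * E y by rewrite mulr_gt0.
rewrite [w x * _]mulrC yxE; lra.
Qed.

(** [A] is convex on the positive axis, so [A1 x] is at most [A1] at [x + k^-1], a point where
    [airy_log_derive_le] applies with [L = 1]. *)
Lemma airy_derive_le0 x : 0 <= x -> A1 x <= 0.
Proof.
move=> x0; pose y := x + k^-1.
have y0 : 0 <= y by rewrite addr_ge0// invr_ge0 ltW.
have xy : x <= y by rewrite lerDl invr_ge0 ltW.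
apply: (@le_trans _ _ (A1 y)).
  apply: (derive_ge0_le xy (fun t _ => dA1 t)) => t /andP[xt _].
  by have t0 := le_trans x0 xt; rewrite !mulr_ge0 ?(ltW k_gt0) ?(ltW (A_gt0 t0)).
have := @airy_log_derive_le 1 y ltr01 y0.
rewrite expr1n mulrDr divff ?gt_eqF// lerDr mulr_ge0 ?(ltW k_gt0)// mul1r => /(_ isT).
by have := A_gt0 y0; lra.
Qed.

(** Beyond [L ^+ 2 / k] the product [A x * expR (L * x)] is nonincreasing. The freedom in [L] later
    absorbs the growing exponential that multiplies [A] in the kernel. *)
Lemma airy_right_decay L : 0 < L -> exists C, forall x, 0 <= x ->
  `|A x| <= C * expR (- (L * x)) /\ `|A1 x| <= C * expR (- (L * x)).
Proof.
move=> L0; pose X := L ^+ 2 / k.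
have X0 : 0 <= X by rewrite divr_ge0 ?sqr_ge0// ltW.
have Ab x : 0 <= x -> A x <= expR (L * X) * expR (- (L * x)).
  move=> x0; case: (leP x X) => xX.
    rewrite -expRD (le_trans (A_le1 x0))// -expR0 ler_expR -mulrN -mulrDr.
    by rewrite mulr_ge0 ?(ltW L0)// subr_ge0.
  rewrite expRN ler_pdivlMr ?expR_gt0//.
  apply: (@le_trans _ _ (A X * expR (L * X))); last by rewrite ler_piMl ?expR_ge0// A_le1.
  rewrite -lerN2.
  apply: (@derive_ge0_le _ (fun t => - (A t * expR (L * t)))
     (fun t => (- (L * A t) - A1 t) * expR (L * t))); first exact: ltW.
    by move=> t _; der_auto; ring.
  move=> t /andP[Xt _]; rewrite mulr_ge0 ?expR_ge0// subr_ge0 airy_log_derive_le//.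
    exact: le_trans Xt.
  by rewrite mulrC -ler_pdivrMr.
pose C0 := `|A1 0|.
exists (expR (L * X) + expR (L * X) * expR L + C0 * expR L) => x x0.
have e0 := expR_ge0 (- (L * x)).
have p1 : 0 <= expR (L * X) * expR L by rewrite mulr_ge0 ?expR_ge0.
have p2 : 0 <= C0 * expR L by rewrite mulr_ge0 ?expR_ge0 ?normr_ge0.
split.
  rewrite gtr0_norm ?A_gt0// (le_trans (Ab x x0))// ler_wpM2r//.
  by rewrite -addrA lerDl addr_ge0.
rewrite ler0_norm ?airy_derive_le0//.
case: (leP x 1) => x1.
  have A01 : A1 0 <= A1 x.
    apply: (derive_ge0_le x0 (fun t _ => dA1 t)) => t /andP[t0 _].
    by rewrite !mulr_ge0 ?(ltW k_gt0) ?(ltW (A_gt0 t0)).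
  apply: (@le_trans _ _ C0); first by rewrite /C0 ler0_norm ?airy_derive_le0// lerN2.
  apply: (@le_trans _ _ (C0 * expR L * expR (- (L * x)))).
    rewrite -mulrA -expRD ler_peMr ?normr_ge0// -expR0 ler_expR.
    by rewrite -{1}(mulr1 L) -mulrN -mulrDr mulr_ge0 ?(ltW L0)// subr_ge0.
  by rewrite ler_wpM2r// lerDr addr_ge0 ?expR_ge0.
have x10 : 0 <= x - 1 by rewrite subr_ge0 ltW.
have xx : x - 1 <= x by lra.
(* Since [A1] is nondecreasing and nonpositive, its size at [x] is at most the mean slope over the
   preceding unit interval, hence at most [A (x - 1)]. *)
have [||E|[c /andP[c1 c2]]] := @mvt _ A A1 (x - 1) x xx.
- by move=> t _; exact: dA.
- exact: (is_derive_within (fun t _ => dA t)).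
- by lra.
rewrite opprB addrCA subrr addr0 mulr1 => E.
have cx : A1 c <= A1 x.
  apply: (derive_ge0_le (ltW c2) (fun t _ => dA1 t)) => t /andP[ct _].
  have t0 : 0 <= t by lra.
  by rewrite !mulr_ge0 ?(ltW k_gt0) ?(ltW (A_gt0 t0)).
apply: (@le_trans _ _ (A (x - 1))).
  by have := A_gt0 x0; lra.
rewrite (le_trans (Ab _ x10))// (_ : - (L * (x - 1)) = L + - (L * x)); last by ring.
by rewrite expRD mulrA ler_wpM2r// -addrA addrCA lerDl addr_ge0 ?expR_ge0.
Qed.

(** In [E = A ^+ 2 - A1 ^+ 2 / (k * x)] the cross terms of the derivative cancel and leave a
    nonnegative function, so [E] does not grow towards the left; both of its terms are nonnegative
    for negative [x]. The division by [x] forces a start at -1, and the gap up to 0 is covered by a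
    Gronwall estimate on [N]. *)
Lemma airy_left_bound : exists C, forall x, x <= 0 ->
  `|A x| <= C * (1 - x) /\ `|A1 x| <= C * (1 - x).
Proof.
pose l := 1 + k.
pose N x := (A x ^+ 2 + A1 x ^+ 2) * expR (l * x).
have Nle x : -1 <= x -> x <= 0 -> N x <= N 0.
  move=> x1 x0; apply: (@derive_ge0_le _ N (fun t =>
    (2 * (A t * A1 t) * (1 + k * t) + l * (A t ^+ 2 + A1 t ^+ 2)) * expR (l * t))) => //.
    by move=> t _; rewrite /N; der_auto; ring.
  move=> t /andP[t1 t0]; rewrite mulr_ge0 ?expR_ge0//.
  have t1' : -1 <= t by lra.
  have kt : `|1 + k * t| <= l.
    rewrite /l ler_norml; apply/andP; split; first by have := k_gt0; nra.
    by have := k_gt0; nra.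
  have : `|2 * (A t * A1 t) * (1 + k * t)| <= (A t ^+ 2 + A1 t ^+ 2) * l.
    rewrite normrM ler_pM// ler_norml; apply/andP; split.
      by have := sqr_ge0 (A t + A1 t); rewrite sqrrD; lra.
    by have := sqr_ge0 (A t - A1 t); rewrite sqrrB; lra.
  by rewrite ler_norml => /andP[H _]; move: H; rewrite [l * _]mulrC; lra.
pose K := N 0 * expR l.
have N0 : 0 <= N 0 by rewrite mulr_ge0 ?expR_ge0// addr_ge0 ?sqr_ge0.
have K0 : 0 <= K by rewrite mulr_ge0 ?expR_ge0.
have near0 x : -1 <= x -> x <= 0 -> A x ^+ 2 <= K /\ A1 x ^+ 2 <= K.
  move=> x1 x0; have H : A x ^+ 2 + A1 x ^+ 2 <= K.
    rewrite /K (_ : expR l = (expR (- l))^-1); last by rewrite expRN invrK.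
    rewrite ler_pdivlMr ?expR_gt0// (le_trans _ (Nle x x1 x0))// /N.
    rewrite ler_wpM2l ?addr_ge0 ?sqr_ge0// ler_expR.
    by rewrite /l; have := k_gt0; nra.
  by have := sqr_ge0 (A x); have := sqr_ge0 (A1 x); lra.
pose E x := A x ^+ 2 - A1 x ^+ 2 / (k * x).
have E1 : E (-1) <= K + K / k.
  rewrite /E mulrN1 invrN mulrN opprK; have [] := near0 (-1); first by [].
    by rewrite lerN10.
  by move=> a b; rewrite lerD// ler_wpM2r// invr_ge0 ltW.
have Ele x : x <= -1 -> E x <= E (-1).
  move=> x1; apply: (@derive_ge0_le _ E (fun t => A1 t ^+ 2 / (k * t ^+ 2))) => //.
    move=> t /andP[_ t1]; have tn : t != 0 by rewrite lt_eqF//; lra.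
    have kn : k != 0 by rewrite gt_eqF.
    have ktn : k * t != 0 by rewrite mulf_neq0.
    by rewrite /E; der_auto; field; rewrite kn tn.
  by move=> t _; rewrite divr_ge0 ?sqr_ge0// mulr_ge0 ?sqr_ge0// ltW.
pose K2 := K + K / k.
have K20 : 0 <= K2 by rewrite addr_ge0 ?divr_ge0 ?(ltW k_gt0).
have sq (y M : R) : 0 <= M -> y ^+ 2 <= M -> `|y| <= 1 + M.
  move=> M0; rewrite -real_normK ?num_real// => yM.
  by have := normr_ge0 y; have := sqr_ge0 (`|y| - 1); rewrite sqrrB expr1n; nra.
exists (1 + K + K2 + K2 * k) => x x0.
have kK2 : 0 <= K2 * k by rewrite mulr_ge0// ltW.
case: (leP (-1) x) => x1.
  have [a b] := near0 x x1 x0.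
  have H : 1 + K <= (1 + K + K2 + K2 * k) * (1 - x).
    have : 0 <= (1 + K + K2 + K2 * k) * - x by rewrite mulr_ge0; lra.
    by lra.
  by split; apply: le_trans H; apply: sq.
have Ex : E x <= K2 by rewrite (le_trans (Ele x (ltW x1))).
have xn : 0 < - x by lra.
have kxn : 0 < k * - x by rewrite mulr_gt0.
have Exx : E x = A x ^+ 2 + A1 x ^+ 2 / (k * - x) by rewrite /E mulrN invrN mulrN.
have q0 : 0 <= A1 x ^+ 2 / (k * - x) by rewrite divr_ge0 ?sqr_ge0// ltW.
split.
  have : `|A x| <= 1 + K2 by apply: sq => //; lra.
  move/le_trans; apply.
  have : 0 <= (1 + K + K2 + K2 * k) * - x by rewrite mulr_ge0; lra.
  by lra.
have : A1 x ^+ 2 <= K2 * (k * - x).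
  by rewrite -ler_pdivrMr//; have := sqr_ge0 (A x); lra.
move/(sq _ _ (mulr_ge0 K20 (ltW kxn)))/le_trans; apply.
have x2 : 0 <= 1 - x by lra.
have := mulr_ge0 (addr_ge0 K0 K20) x2.
by lra.
Qed.

End airy_decay.

(** * The adjoint kernel *)

Section adjoint_kernel.
Context {R : realType}.
Implicit Types (t L C kap : R) (f g : R -> R).

(** The asymmetry is that of an Airy function times a growing exponential: faster than every
    exponential on the right, one fixed rate [kap] on the left. *)
Definition decay kap f := forall L, 0 < L -> exists C, forall t,
  (0 <= t -> `|f t| <= C * expR (- (L * t))) /\ (t <= 0 -> `|f t| <= C * expR (kap * t)).

(* psi is the recessive solution of the adjoint of a q'' + q' = (t / eps) q. *)
Definition adjoint_kernel (a eps : R) (psi psi1 : R -> R) :=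
  [/\ forall t, is_derive t 1 psi (psi1 t),
      forall t, is_derive t 1 psi1 ((psi1 t + t / eps * psi t) / a),
      exists2 kap, 0 < kap & decay kap psi /\ decay kap psi1
    & forall t, 0 <= t -> 0 < psi t /\ psi1 t <= 0].

(** The factor [expR (t / (2 * a))] removes the first-order term. What remains for [A] is the
    potential [t / (a * eps) + 1 / (4 * a ^+ 2)], that is [k * (t + de)], whence the shift
    [de = eps / (4 * a)]. *)
Lemma adjoint_kernel_exists (a eps : R) : 0 < a -> 0 < eps ->
  exists psi psi1, adjoint_kernel a eps psi psi1.
Proof.
move=> a0 eps0; pose k := (a * eps)^-1.
have k0 : 0 < k by rewrite invr_gt0 mulr_gt0.
have [A [A1 [sA A01]]] := airy_recessive k0.
pose b := (2 * a)^-1; pose de := eps / (4 * a).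
have b0 : 0 < b by rewrite invr_gt0 mulr_gt0.
have de0 : 0 < de by rewrite divr_gt0// mulr_gt0.
have sh (H H1 : R -> R) (Hd : forall x : R, is_derive x 1 H (H1 x)) (t : R) :
    is_derive t 1 (fun t => H (t + de)) (H1 (t + de)).
  have d3 : is_derive t 1 (fun t : R => t + de) 1 by der_auto; ring.
  by apply: (der_eq (der_comp d3 (Hd _))); ring.
have dA := sh A A1 (fun x => (sA x).1).
have dA1 := sh A1 (fun x => k * x * A x) (fun x => (sA x).2).
clear sh.
pose psi t := expR (b * t) * A (t + de).
pose psi1 t := expR (b * t) * (A1 (t + de) + b * A (t + de)).
have an : a != 0 by rewrite gt_eqF.
have en : eps != 0 by rewrite gt_eqF.
have d1 (t : R) : is_derive t 1 psi (psi1 t) by rewrite /psi /psi1; der_auto; ring.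
have d2 (t : R) : is_derive t 1 psi1 ((psi1 t + t / eps * psi t) / a).
  by rewrite /psi /psi1; der_auto; rewrite /k /b /de; field; rewrite an en.
have aux (M u v E : R) : 0 <= E -> `|u| <= M -> `|v| <= M ->
    `|E * u| <= (1 + b) * M * E /\ `|E * (v + b * u)| <= (1 + b) * M * E.
  move=> E0 uM vM; have M0 := le_trans (normr_ge0 u) uM.
  have bM : 0 <= b * M by rewrite mulr_ge0// ltW.
  rewrite !normrM (ger0_norm E0) [_ * M * E]mulrC; split; rewrite ler_wpM2l//.
    by lra.
  by rewrite (le_trans (ler_normD _ _))// normrM gtr0_norm// mulrDl mul1r lerD// ler_pM2l.
have dec : forall L, 0 < L -> exists C, forall t,
    (0 <= t -> `|psi t| <= C * expR (- (L * t)) /\ `|psi1 t| <= C * expR (- (L * t))) /\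
    (t <= 0 -> `|psi t| <= C * expR (b / 2 * t) /\ `|psi1 t| <= C * expR (b / 2 * t)).
  move=> L L0; have Lb0 : 0 < L + b by rewrite addr_gt0.
  have [C HC] := airy_right_decay k0 sA A01 Lb0.
  have [D HD] := airy_left_bound k0 sA.
  have C0 : 0 <= C.
    have [+ _] := HC 0 (lexx _); rewrite mulr0 oppr0 expR0 mulr1.
    exact: le_trans.
  have D0 : 0 <= D.
    have [+ _] := HD 0 (lexx _); rewrite subr0 mulr1.
    exact: le_trans.
  pose K := (C + D) * (1 + 2 / b).
  have b20 : 0 <= 2 / b by rewrite divr_ge0// ltW.
  have K0 : 0 <= K by rewrite mulr_ge0 ?addr_ge0.
  have K1 : C <= K by rewrite /K; have := mulr_ge0 (addr_ge0 C0 D0) b20; lra.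
  exists ((1 + b) * K) => t; split=> t0.
    have [H1 H2] := HC (t + de) (addr_ge0 t0 (ltW de0)).
    have [H3 H4] := aux _ _ _ _ (expR_ge0 (b * t)) H1 H2.
    suff : (1 + b) * (C * expR (- ((L + b) * (t + de)))) * expR (b * t) <=
        (1 + b) * K * expR (- (L * t)).
      by move=> H; split; [apply: (le_trans H3) | apply: (le_trans H4)].
    rewrite -[leLHS]mulrA -[leRHS]mulrA ler_pM2l ?addr_gt0// -mulrA -expRD.
    apply: (ler_pM C0 (expR_ge0 _) K1); rewrite ler_expR.
    rewrite (_ : - _ + _ = - (L * t) - (L + b) * de); last by ring.
    by rewrite gerBl mulr_ge0 ?(ltW Lb0) ?(ltW de0).
  (* Half of the rate [b] is spent on the linear growth of the Airy bound on the left, which is why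
     the final left rate is [b / 2]. *)
  have tb : (1 - t) * expR (b * t) <= (1 + 2 / b) * expR (b / 2 * t).
    have e1 := expR_ge1Dx (- (b / 2 * t)).
    have e0 := expR_gt0 (b / 2 * t).
    have e2 : expR (- (b / 2 * t)) * expR (b / 2 * t) = 1 by rewrite expRN mulVf// gt_eqF.
    have e3 : expR (b / 2 * t) <= 1.
      by rewrite -expR0 ler_expR mulr_ge0_le0// divr_ge0// ltW.
    have -> : expR (b * t) = expR (b / 2 * t) * expR (b / 2 * t).
      by rewrite -expRD; congr expR; field.
    rewrite mulrA ler_pM2r// mulrBl mul1r lerD//.
    rewrite -mulNr [X in X * _](_ : - t = 2 / b * (- (b / 2 * t))); last first.
      by field; rewrite gt_eqF.
    rewrite -[leLHS]mulrA -[leRHS]mulr1; apply: ler_wpM2l => //; rewrite -[leRHS]e2 ler_pM2r//.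
    by apply: le_trans e1; rewrite lerDr.
  have AK : `|A (t + de)| <= (C + D) * (1 - t) /\ `|A1 (t + de)| <= (C + D) * (1 - t).
    have CD : 0 <= (C + D) * - t by rewrite mulr_ge0 ?addr_ge0 ?oppr_ge0.
    case: (leP 0 (t + de)) => td.
      have [H1 H2] := HC _ td.
      have : C * expR (- ((L + b) * (t + de))) <= C.
        by rewrite ler_piMr// -expR0 ler_expR oppr_le0 mulr_ge0// ltW.
      move=> H; split; [apply: (le_trans H1)|apply: (le_trans H2)]; apply: (le_trans H);
      by lra.
    have [H1 H2] := HD _ (ltW td).
    have : D * (1 - (t + de)) <= (C + D) * (1 - t).
      have : 0 <= C * (1 - t) by rewrite mulr_ge0//; lra.
      have : 0 <= D * de by rewrite mulr_ge0// ltW.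
      by lra.
    by move=> H; split; [apply: (le_trans H1)|apply: (le_trans H2)].
  have [H3 H4] := aux _ _ _ _ (expR_ge0 (b * t)) AK.1 AK.2.
  suff : (1 + b) * ((C + D) * (1 - t)) * expR (b * t) <= (1 + b) * K * expR (b / 2 * t).
    by move=> H; split; [apply: (le_trans H3) | apply: (le_trans H4)].
  rewrite /K -[leLHS]mulrA -[leRHS]mulrA ler_pM2l ?addr_gt0//.
  by rewrite -[leLHS]mulrA -[leRHS]mulrA; apply: ler_wpM2l tb; rewrite addr_ge0.
have pos t : 0 <= t -> 0 < psi t.
  move=> t0; rewrite mulr_gt0 ?expR_gt0//.
  by have /andP[] := A01 (t + de) (addr_ge0 t0 (ltW de0)).
clearbody psi psi1; exists psi, psi1; split=> //.
  exists (b / 2); first by rewrite divr_gt0.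
  split=> L L0; have [C HC] := dec L L0; exists C => t; have [H1 H2] := HC t.
    by split=> [/H1[]|/H2[]].
  by split=> [/H1[]|/H2[]].
move=> t t0; split; first exact: pos.
(* If [psi1] were positive at [t], the equation would make [psi1 y * expR (- (y / a))] nondecreasing
   from there on, so [psi1] could not drop below [psi1 t]. The point [s] is where this contradicts
   the bound [C * expR (- s)]. *)
rewrite leNgt; apply/negP => p0.
have [C HC] := dec 1 ltr01.
pose s := t + `|C| / psi1 t.
have ts : t <= s by rewrite lerDl divr_ge0 ?normr_ge0// ltW.
have s0 := le_trans t0 ts.
have mono : psi1 t * expR (- (t / a)) <= psi1 s * expR (- (s / a)).
  apply: (@derive_ge0_le _ (fun y => psi1 y * expR (- (y / a)))
    (fun y => y / eps * psi y / a * expR (- (y / a)))) => // y /andP[ty _].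
    by der_auto; ring.
  have y0 := le_trans t0 ty; have py := pos y y0.
  by rewrite !mulr_ge0 ?expR_ge0 ?invr_ge0 ?(ltW py) ?(ltW a0) ?(ltW eps0).
have le1 : psi1 t <= psi1 s.
  rewrite -(ler_pM2r (expR_gt0 (- (t / a)))) (le_trans mono)//.
  have : 0 <= psi1 s.
    rewrite -(pmulr_lge0 _ (expR_gt0 (- (s / a)))) (le_trans _ mono)//.
    by rewrite mulr_ge0 ?expR_ge0// ltW.
  move=> ps0; rewrite ler_wpM2l// ler_expR lerN2 ler_wpM2r// invr_ge0 ltW//.
have [_ H] := (HC s).1 s0; rewrite mul1r in H.
have : psi1 s <= `|C| * expR (- s).
  by rewrite (le_trans (ler_norm _))// (le_trans H)// ler_wpM2r ?expR_ge0// ler_norm.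
rewrite expRN ler_pdivlMr ?expR_gt0//.
have : psi1 t * (1 + s) <= psi1 s * expR s.
  exact: (ler_pM (ltW p0) (addr_ge0 ler01 s0) le1 (expR_ge1Dx s)).
have : psi1 t * s = psi1 t * t + `|C| by rewrite /s; field; rewrite gt_eqF.
have : 0 <= psi1 t * t by rewrite mulr_ge0// ltW.
by lra.
Qed.

End adjoint_kernel.

(** * Integrals over the line and the class of tame functions *)

Section line_integrals.
Context {R : realType}.
Notation mu := (@lebesgue_measure R).
Implicit Types (f g F : R -> R) (x t C kap L l : R).

Lemma cvg_real_unique (G : set_system R) (FG : ProperFilter G) f (a b : R) :
  f x @[x --> G] --> a -> f x @[x --> G] --> b -> a = b.
Proof. by move=> fa fb; exact: cvg_unique fa fb. Qed.

Lemma cvg_ge_near T (G : set_system T) (FG : ProperFilter G) (f : T -> R) (a b : R) :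
  f x @[x --> G] --> a -> (\forall x \near G, b <= f x) -> b <= a.
Proof.
move=> fa bf; rewrite -(cvg_lim _ fa)//; apply: limr_ge => //.
by apply/cvg_ex; exists a.
Qed.

Lemma cvg_le_near T (G : set_system T) (FG : ProperFilter G) (f : T -> R) (a b : R) :
  f x @[x --> G] --> a -> (\forall x \near G, f x <= b) -> a <= b.
Proof.
move=> fa bf; rewrite -(cvg_lim _ fa)//; apply: limr_le => //.
by apply/cvg_ex; exists a.
Qed.

Lemma integrable_oneDsqrV : mu.-integrable setT (EFin \o (fun t : R => (oneDsqr t)^-1)).
Proof.
have c : continuous (fun t : R => (oneDsqr t)^-1) by exact: continuous_oneDsqrV.
have p (t : R) : 0 <= (oneDsqr t)^-1 by rewrite invr_ge0 (le_trans ler01)// oneDsqr_ge1.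
apply/integrableP; split.
  by apply/measurable_EFinP; exact: continuous_measurable_fun.
under eq_integral do rewrite /= ger0_norm ?p//.
rewrite ge0_symfun_integralT//; last by move=> t; rewrite /oneDsqr /= sqrrN.
by rewrite -set_itvcy integral0y_oneDsqr -EFinM ltry.
Qed.

(** This one majorant yields integrability, boundedness and vanishing at both ends, and it survives
    sums and products with bounded continuous functions. *)
Definition tame f := continuous f /\ exists C, forall t, `|f t| <= C * (oneDsqr t)^-1.

Definition total f : R := (\int[mu]_t f t)%R.
Definition prim f x : R := (\int[mu]_(t in `]-oo, x]) f t)%R.

Lemma tame_integrable f : tame f -> mu.-integrable setT (EFin \o f).
Proof.
move=> [cf [C fC]].
have Ig : mu.-integrable setT (EFin \o (fun t => C * (oneDsqr t)^-1)).
  exact: (integrableZl _ C integrable_oneDsqrV).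
apply: (le_integrable _ _ _ Ig) => //.
  by apply/measurable_EFinP; exact: continuous_measurable_fun.
by move=> t _ /=; rewrite lee_fin (le_trans (fC t))// ler_norm.
Qed.

Lemma is_derive_prim f x : tame f -> is_derive x 1 (prim f) (f x).
Proof.
move=> tf; have cf := tf.1.
have xx : x < x + 1 by rewrite ltrDl.
have [|||d1 d2] := @continuous_FTC1 R f (BInfty _ true) x (x + 1) xx.
- by apply: integrableS (tame_integrable tf).
- by rewrite ltNyr.
- exact: cf.
by apply: DeriveDef => //; rewrite -derive1E.
Qed.

Lemma Rintegral_cvg_dominated (fn : nat -> R -> R) f g : tame g ->
  (forall n, measurable_fun setT (fn n)) -> (forall n t, `|fn n t| <= g t) ->
  (forall t, fn n t @[n --> \oo] --> f t) ->
  (\int[mu]_t fn n t)%R @[n --> \oo] --> (\int[mu]_t f t)%R.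
Proof.
move=> tg mfn fng fnf; have Ig := tame_integrable tg.
have mfn' n : measurable_fun setT (EFin \o fn n) by exact/measurable_EFinP.
have [//||||||I _ H] := @dominated_convergence _ _ _ mu setT _
  (fun n => EFin \o fn n) (EFin \o f) (EFin \o g).
- exact: mfn'.
- apply: (emeasurable_fun_cvg (fun n => EFin \o fn n)) => //.
  by move=> t _; apply: cvg_EFin; [exact: nearW|exact: fnf].
- by apply: aeW => t _; apply: cvg_EFin; [exact: nearW|exact: fnf].
- exact: Ig.
- by apply: aeW => t n _ /=; rewrite lee_fin.
rewrite /Rintegral; apply: fine_cvg; rewrite fineK; first exact: H.
exact: integrable_fin_num.
Qed.

Lemma tame_norm f : tame f -> tame (fun t => `|f t|).
Proof.
move=> [cf [C fC]]; split; last by exists C => t; rewrite normr_id.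
by move=> t; apply: (@cvg_norm _ _ _ _ _ f); exact: cf.
Qed.

Let cvg_Rint f (u : R^nat) (g : R -> R) : tame f ->
  (forall t, (f \_ `]-oo, u n]) t @[n --> \oo] --> g t) ->
  prim f (u n) @[n --> \oo] --> (\int[mu]_t g t)%R.
Proof.
move=> tf fg; rewrite /prim; under eq_fun do rewrite Rintegral_mkcond.
apply: (@Rintegral_cvg_dominated (fun n => f \_ `]-oo, u n]) g _ (tame_norm tf)) => //.
  move=> n; rewrite -measurable_restrictT//.
  by apply: measurable_funTS; exact: continuous_measurable_fun tf.1.
by move=> n t; rewrite patchE; case: ifP => // _; rewrite normr0.
Qed.

Lemma prim_cvgNy f : tame f -> prim f x @[x --> -oo] --> (0 : R).
Proof.
move=> tf; apply/cvg_ninftyP => u uNy.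
have -> : (0 : R) = (\int[mu]_t (cst 0 : R -> R) t)%R.
  by rewrite Rintegral_cst// mul0r.
apply: cvg_Rint => // t; apply: cvg_near_cst.
have /cvgrNyPlt /(_ t) := uNy.
apply: filterS => n tu; rewrite patchE; case: ifPn => //.
by rewrite inE/= in_itv/= leNgt tu.
Qed.

Lemma prim_cvgy f : tame f -> prim f x @[x --> +oo] --> total f.
Proof.
move=> tf; apply/cvg_pinftyP => u uy.
apply: cvg_Rint => // t; apply: cvg_near_cst.
have /cvgryPge /(_ t) := uy.
apply: filterS => n tu; rewrite patchE; case: ifPn => //.
by rewrite notin_setE/= in_itv/= tu.
Qed.

Lemma total_primitive f F (lN ly : R) : tame f -> (forall x, has_derive F x (f x)) ->
  F x @[x --> -oo] --> lN -> F x @[x --> +oo] --> ly -> total f = ly - lN.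
Proof.
move=> tf dF FN Fy; pose c := prim f 0 - F 0.
have E x : prim f x = F x + c.
  suff : prim f x - F x = prim f 0 - F 0 by rewrite /c; lra.
  apply: (@derive0_const _ (fun x => prim f x - F x)) => t.
  have d1 := @is_derive_prim f t tf; have d2 : is_derive t 1 F (f t) := dF t.
  by der_auto; rewrite subrr.
have := prim_cvgNy tf; under eq_fun do rewrite E.
have HN : F x + c @[x --> -oo] --> lN + c by apply: cvgD FN (cvg_cst _).
move=> /(cvg_real_unique _ HN) e1.
have := prim_cvgy tf; under eq_fun do rewrite E.
have Hy : F x + c @[x --> +oo] --> ly + c by apply: cvgD Fy (cvg_cst _).
move=> /(cvg_real_unique _ Hy) e2.
by rewrite -e2; move/eqP: e1; rewrite addr_eq0 => /eqP ->; rewrite opprK addrC.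
Qed.

End line_integrals.

Section tame_functions.
Context {R : realType}.
Notation mu := (@lebesgue_measure R).
Implicit Types (f g F : R -> R) (x t C kap L l : R).

Let oV t : 0 < (oneDsqr t)^-1.
Proof. by rewrite invr_gt0 (lt_le_trans ltr01)// oneDsqr_ge1. Qed.

Lemma tame_bounded f : tame f -> exists C, forall t, `|f t| <= C.
Proof.
move=> [_ [C fC]]; exists `|C| => t; apply: (le_trans (fC t)).
apply: (@le_trans _ _ (`|C| * (oneDsqr t)^-1)).
  by apply: ler_wpM2r (ler_norm _); exact: ltW.
by rewrite ler_piMr ?normr_ge0// oneDsqrV_le1.
Qed.

Lemma continuous_mul f g : continuous f -> continuous g -> continuous (fun t => f t * g t).
Proof. by move=> cf cg t; apply: cvgM; [exact: cf|exact: cg]. Qed.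

Lemma tameM f g C : tame f -> continuous g -> (forall t, `|g t| <= C) ->
  tame (fun t => f t * g t).
Proof.
move=> [cf [D fD]] cg gC; split; first exact: continuous_mul.
exists (D * C) => t; rewrite normrM mulrAC ler_pM//.
Qed.

Lemma tameD f g : tame f -> tame g -> tame (fun t => f t + g t).
Proof.
move=> [cf [C fC]] [cg [D gD]]; split.
  by move=> t; apply: cvgD; [exact: cf|exact: cg].
exists (C + D) => t; rewrite mulrDl (le_trans (ler_normD _ _))// lerD//.
Qed.

Lemma tameZ f c : tame f -> tame (fun t => c * f t).
Proof.
move=> [cf [C fC]]; split.
  by move=> t; apply: cvgM; [exact: cvg_cst|exact: cf].
by exists (`|c| * C) => t; rewrite normrM -mulrA ler_wpM2l.
Qed.

Lemma totalD f g : tame f -> tame g -> total (fun t => f t + g t) = total f + total g.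
Proof. by move=> /tame_integrable If /tame_integrable Ig; exact: RintegralD. Qed.

Lemma totalZ f c : tame f -> total (fun t => c * f t) = c * total f.
Proof. by move=> /tame_integrable If; exact: RintegralZl. Qed.

Let oneDsqrV_cvgy : (oneDsqr t)^-1 @[t --> +oo] --> (0 : R).
Proof.
apply/cvgrPdist_le => e e0; near=> t.
have t1 : 1 <= t by near: t; exact: nbhs_pinfty_ge.
rewrite sub0r normrN ger0_norm; last exact: ltW.
have te : e^-1 <= t by near: t; apply: nbhs_pinfty_ge; rewrite num_real.
have o0 : 0 < oneDsqr t by rewrite (lt_le_trans ltr01)// oneDsqr_ge1.
rewrite -[leRHS]invrK lef_pV2 ?posrE ?invr_gt0//.
by rewrite (le_trans te)// /oneDsqr expr2; nra.
Unshelve. all: end_near. Qed.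

Lemma tame_cvgy f : tame f -> f t @[t --> +oo] --> (0 : R).
Proof.
move=> [_ [C fC]]; apply: norm_cvg0.
apply: (@squeeze_cvgr _ _ _ _ (cst 0) (fun t => C * (oneDsqr t)^-1)).
- by apply: nearW => t; rewrite normr_ge0 fC.
- exact: cvg_cst.
- rewrite -(mulr0 C); exact: cvgMl_tmp oneDsqrV_cvgy.
Qed.

Lemma tame_cvgNy f : tame f -> f t @[t --> -oo] --> (0 : R).
Proof.
move=> tf; rewrite cvgNy_compNP; apply: tame_cvgy; split.
  by move=> t; apply: continuous_comp; [exact: opp_continuous|exact: tf.1].
by have [_ [C fC]] := tf; exists C => t /=; rewrite (le_trans (fC _))// /oneDsqr sqrrN.
Qed.

(** This is the form in which the kernel moments are integrated by parts: a tame primitive is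
    exhibited, and its boundary terms vanish. *)
Lemma total_derivative0 f F : tame f -> (forall x, has_derive F x (f x)) -> tame F ->
  total f = 0.
Proof.
move=> tf dF tF.
by rewrite (total_primitive tf dF (tame_cvgNy tF) (tame_cvgy tF)) subrr.
Qed.

Lemma prim_bounded f x : tame f -> `|prim f x| <= total (fun t => `|f t|).
Proof.
move=> tf; have If := tame_integrable tf; have Inf := tame_integrable (tame_norm tf).
have mI : measurable (`]-oo, x] : set R) by [].
have If' : mu.-integrable `]-oo, x] (EFin \o f) by apply: integrableS If.
have Inf' : mu.-integrable `]-oo, x] (EFin \o (fun t => `|f t|)) by apply: integrableS Inf.
apply: (le_trans (le_normr_Rintegral _ If')) => //.
rewrite /total /Rintegral fine_le ?integrable_fin_num//.
by apply: ge0_subset_integral => //; case/integrableP : Inf.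
Qed.

Lemma continuous_is_derive f df : (forall x : R, is_derive x 1 f (df x)) -> continuous f.
Proof. by move=> fd x; exact: is_derive_continuous (fd x). Qed.

Lemma continuous_prim f : tame f -> continuous (prim f).
Proof. by move=> tf; apply: continuous_is_derive => x; exact: is_derive_prim. Qed.

Lemma is_derive_total (f f1 : R -> R -> R) (a u v : R) (G : R -> R) :
  u < a < v -> (forall h, u < h < v -> tame (f h)) ->
  (forall h t, u < h < v -> has_derive (f ^~ t) h (f1 h t)) ->
  tame G -> (forall h t, u < h < v -> `|f1 h t| <= G t) ->
  is_derive a 1 (fun h => total (f h)) (total (f1 a)).
Proof.
move=> uav tf df tG fG.
have II h : `]u, v[%classic h -> u < h < v by rewrite /= in_itv.
have Ia : `]u, v[%classic a by rewrite /= in_itv.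
have E h t : u < h < v -> partial1of2 f h t = f1 h t.
  by move=> /(df _ t) [? <-]; rewrite partial1of2E.
have H1 h : `]u, v[%classic h -> mu.-integrable setT (EFin \o f h).
  by move=> /II/tf/tame_integrable.
have H2 h t : `]u, v[%classic h -> setT t -> derivable (f ^~ t) h 1.
  by move=> /II/(df _ t) [].
have G0 t : 0 <= G t by apply: le_trans (fG a t uav); exact: normr_ge0.
have H3 h t : `]u, v[%classic h -> setT t -> `|partial1of2 f h t| <= G t.
  by move=> /II hI _; rewrite E// fG.
have D := derivable_under_integral measurableT Ia H1 H2 G0 (tame_integrable tG) H3.
have V := differentiation_under_integral measurableT Ia H1 H2 G0 (tame_integrable tG) H3.
apply: DeriveDef; first exact: D.
rewrite -derive1E V; apply: eq_Rintegral => t _; exact: E.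
Qed.

Lemma decay_tame kap f : 0 < kap -> continuous f -> decay kap f -> tame f.
Proof.
move=> k0 cf /(_ 1 ltr01)[C HC]; split=> //.
have C0 : 0 <= C.
  by have [/(_ (lexx _)) + _] := HC 0; rewrite mulr0 oppr0 expR0 mulr1; exact: le_trans.
(* The square of [1 + L * s / 2 <= expR (L * s / 2)] supplies the quadratic term, with the constant
   4. *)
have sqexp (L s : R) : 0 < L -> 0 <= s -> expR (- (L * s)) <= (1 + 4 / L ^+ 2) / oneDsqr s.
  move=> L0 s0; rewrite expRN lter_pdivlMr ?(lt_le_trans ltr01) ?oneDsqr_ge1//.
  rewrite mulrC ler_pdivrMr ?expR_gt0//.
  have e1 : 1 + L * s / 2 <= expR (L * s / 2) by exact: expR_ge1Dx.
  have Ls : 0 <= L * s by rewrite mulr_ge0// ltW.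
  have e2 : 1 + (L * s) ^+ 2 / 4 <= expR (L * s).
    have -> : expR (L * s) = expR (L * s / 2) * expR (L * s / 2).
      by rewrite -expRD; congr expR; field.
    by rewrite expr2; nra.
  have p4 : 0 <= 4 / L ^+ 2 by rewrite divr_ge0// sqr_ge0.
  have : 4 / L ^+ 2 * ((L * s) ^+ 2 / 4) = s ^+ 2 by field; rewrite gt_eqF.
  have : 4 / L ^+ 2 * (1 + (L * s) ^+ 2 / 4) <= 4 / L ^+ 2 * expR (L * s).
    by rewrite ler_wpM2l.
  have := sqr_ge0 (L * s); rewrite /oneDsqr; lra.
exists (C * ((1 + 4 / 1 ^+ 2) + (1 + 4 / kap ^+ 2))) => t.
have p1 : 0 <= 4 / 1 ^+ 2 :> R by rewrite divr_ge0// sqr_ge0.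
have p2 : 0 <= 4 / kap ^+ 2 by rewrite divr_ge0// sqr_ge0.
have [H1 H2] := HC t; case: (leP 0 t) => t0.
  rewrite (le_trans (H1 t0))// -mulrA ler_wpM2l// (le_trans (sqexp _ _ ltr01 t0))//.
  by rewrite ler_wpM2r ?(ltW (oV _))// lerDl addr_ge0.
have Nt0 : 0 <= - t by rewrite oppr_ge0 ltW.
rewrite (le_trans (H2 (ltW t0)))// -mulrA ler_wpM2l//.
rewrite (_ : kap * t = - (kap * - t)); last by ring.
rewrite (le_trans (sqexp _ _ k0 Nt0))// /oneDsqr sqrrN.
by rewrite ler_wpM2r ?(ltW (oV _))// lerDr addr_ge0.
Qed.

Lemma decay_expR kap l f : decay kap f -> decay (kap + l) (fun t => f t * expR (l * t)).
Proof.
move=> df L L0; have L' : 0 < L + `|l| by rewrite ltr_pwDl.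
have [C HC] := df _ L'; exists C => t; have [H1 H2] := HC t.
have C0 : 0 <= C.
  by have [/(_ (lexx _)) + _] := HC 0; rewrite mulr0 oppr0 expR0 mulr1; exact: le_trans.
rewrite normrM (ger0_norm (expR_ge0 _)); split=> t0.
  rewrite (le_trans (ler_wpM2r (expR_ge0 _) (H1 t0)))// -mulrA -expRD ler_wpM2l// ler_expR.
  by have := ler_wpM2r t0 (ler_norm l); lra.
by rewrite (le_trans (ler_wpM2r (expR_ge0 _) (H2 t0)))// -mulrA -expRD mulrDl.
Qed.

(** On the right the factor [t] is paid by one extra unit of the arbitrary rate [L]; on the left
    half of [kap] is sacrificed. *)
Lemma decay_id_mul kap f : 0 < kap -> decay kap f -> decay (kap / 2) (fun t => t * f t).
Proof.
move=> k0 df L L0; have L' : 0 < L + 1 by rewrite addr_gt0.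
have [C HC] := df _ L'; exists (C + C * (2 / kap)) => t; have [H1 H2] := HC t.
have C0 : 0 <= C.
  by have [/(_ (lexx _)) + _] := HC 0; rewrite mulr0 oppr0 expR0 mulr1; exact: le_trans.
have Ck : 0 <= C * (2 / kap) by rewrite mulr_ge0// divr_ge0// ltW.
rewrite normrM; split=> t0.
  rewrite ger0_norm// (le_trans (ler_wpM2l t0 (H1 t0)))//.
  rewrite mulrCA; apply: (@le_trans _ _ (C * expR (- (L * t)))).
    apply: ler_wpM2l => //.
    rewrite (_ : - _ = - (L * t) + - t); last by ring.
    rewrite expRD mulrCA ler_piMr ?expR_ge0// expRN ler_pdivrMr ?expR_gt0// mul1r.
    by have := expR_ge1Dx t; lra.
  by rewrite ler_wpM2r ?expR_ge0// lerDl.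
rewrite ler0_norm//; have Nt : 0 <= - t by rewrite oppr_ge0.
rewrite (le_trans (ler_wpM2l Nt (H2 t0)))//.
rewrite mulrCA; apply: (@le_trans _ _ (C * (2 / kap) * expR (kap / 2 * t))).
  rewrite -[leRHS]mulrA; apply: ler_wpM2l => //.
  rewrite (_ : kap * t = kap / 2 * t + kap / 2 * t); last by field.
  rewrite expRD mulrA ler_wpM2r ?expR_ge0//.
  rewrite -ler_pdivlMr ?expR_gt0// -expRN.
  have := expR_ge1Dx (- (kap / 2 * t)).
  move=> /(ler_wpM2l (_ : 0 <= 2 / kap)) H.
  have /H : 0 <= 2 / kap by rewrite divr_ge0// ltW.
  apply: le_trans; rewrite mulrDr mulr1 (_ : _ * - _ = - t); last by field; rewrite gt_eqF.
  by rewrite lerDr divr_ge0// ltW.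
by rewrite ler_wpM2r ?expR_ge0// lerDr.
Qed.

End tame_functions.

(** * Moments of the kernel: total mass, square integral, Laplace transform *)

Section kernel_moments.
Context {R : realType}.
Notation mu := (@lebesgue_measure R).
Variables (a eps : R) (psi psi1 : R -> R).
Hypotheses (a_gt0 : 0 < a) (eps_gt0 : 0 < eps).
Hypothesis ker : adjoint_kernel a eps psi psi1.
Implicit Types (h t l : R).

Lemma kernel_derive t : is_derive t 1 psi (psi1 t). Proof. by case: ker. Qed.

Lemma kernel_derive1 t : is_derive t 1 psi1 ((psi1 t + t / eps * psi t) / a).
Proof. by case: ker. Qed.

Lemma kernel_continuous : continuous psi.
Proof. exact: continuous_is_derive kernel_derive. Qed.

Lemma kernel1_continuous : continuous psi1.
Proof. exact: continuous_is_derive kernel_derive1. Qed.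

Lemma kernel_tame : tame psi.
Proof.
by case: ker => _ _ [kap k0 [d _]] _; exact: decay_tame kernel_continuous d.
Qed.

Lemma kernel1_tame : tame psi1.
Proof.
by case: ker => _ _ [kap k0 [_ d]] _; exact: decay_tame kernel1_continuous d.
Qed.

Let der_shiftl (f f1 : R -> R) (fd : forall x, has_derive f x (f1 x)) (h t : R) :
  is_derive t 1 (fun t => f (t + h)) (f1 (t + h)).
Proof.
have d3 : is_derive t 1 (fun t : R => t + h) 1 by der_auto; ring.
by apply: (der_eq (der_comp d3 (fd _))); ring.
Qed.

Let der_shiftr (f f1 : R -> R) (fd : forall x, has_derive f x (f1 x)) (h t : R) :
  is_derive h 1 (fun h => f (t + h)) (f1 (t + h)).
Proof.
have d3 : is_derive h 1 (fun h : R => t + h) 1 by der_auto; ring.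
by apply: (der_eq (der_comp d3 (fd _))); ring.
Qed.

Let cont_shift (f : R -> R) (h : R) : continuous f -> continuous (fun t => f (t + h)).
Proof.
move=> cf t; apply: (continuous_comp (f := fun t => t + h)); last exact: cf.
by apply: cvgD; [exact: cvg_id|exact: cvg_cst].
Qed.

Let F h := total (fun t => psi t * psi (t + h)).
Let G h := total (fun t => psi t * prim psi (t + h)).

Let near_itv h : h - 1 < h < h + 1.
Proof. by rewrite ltrBlDr !ltrDl ltr01. Qed.

Let tame_prod (g : R -> R) C h : continuous g -> (forall t, `|g t| <= C) ->
  tame (fun t => psi t * g (t + h)).
Proof. by move=> cg gC; apply: tameM kernel_tame (cont_shift cg) (fun t => gC _). Qed.

Let der_conv (g g1 : R -> R) h : (forall x, has_derive g x (g1 x)) ->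
  (exists C, forall t, `|g t| <= C) -> (exists C, forall t, `|g1 t| <= C) ->
  is_derive h 1 (fun h => total (fun t => psi t * g (t + h)))
    (total (fun t => psi t * g1 (t + h))).
Proof.
move=> gd [C gC] [C1 g1C]; have cg := continuous_is_derive gd.
apply: (@is_derive_total _ (fun h t => psi t * g (t + h)) (fun h t => psi t * g1 (t + h))
  h _ _ (fun t => C1 * `|psi t|) (near_itv h)).
- by move=> h' _; apply: tame_prod gC.
- move=> h' t _; have := der_shiftr gd h' t => d; rewrite /has_derive; der_auto; ring.
- by apply: tameZ; exact: tame_norm kernel_tame.
- by move=> h' t _; rewrite normrM mulrC ler_wpM2r.
Qed.

Let dG h : is_derive h 1 G (F h).
Proof.
apply: der_conv.
- by move=> x; apply: is_derive_prim; exact: kernel_tame.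
- by exists (total (fun t => `|psi t|)) => t; exact: prim_bounded kernel_tame.
- exact: tame_bounded kernel_tame.
Qed.

(** [psi] and its translate by [h] solve equations whose potentials differ by [h / eps]. Their
    product plus [a] times their Wronskian, the function [e] below, therefore has derivative
    [2 * psi t * psi1 (t + h)] plus [h / eps] times the product, and its integral vanishes. *)
Let dF h : is_derive h 1 F (- (h / (2 * eps)) * F h).
Proof.
have [C HC] := tame_bounded kernel_tame; have [C1 HC1] := tame_bounded kernel1_tame.
have d : is_derive h 1 F (total (fun t => psi t * psi1 (t + h))).
  apply: der_conv kernel_derive _ _; [by exists C|by exists C1].
apply: (der_eq d).
have t1 := tame_prod h kernel1_continuous HC1.
have t0 := tame_prod h kernel_continuous HC.
pose e t := psi t * psi (t + h) + a * (psi t * psi1 (t + h) - psi1 t * psi (t + h)).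
have te : tame e.
  apply: tameD => //; apply: tameZ; apply: tameD => //.
  apply: (_ : tame (fun t => - (psi1 t * psi (t + h)))).
  have t2 : tame (fun t => psi1 t * psi (t + h)).
    by apply: tameM kernel1_tame (cont_shift kernel_continuous) (fun t => HC _).
  by have := tameZ (-1) t2; under eq_fun do rewrite mulN1r.
have de t : has_derive e t (2 * (psi t * psi1 (t + h)) + h / eps * (psi t * psi (t + h))).
  have d1 := kernel_derive; have d2 := kernel_derive1.
  have d3 := der_shiftl d1 h t; have d4 := der_shiftl d2 h t.
  by rewrite /e /has_derive; der_auto; field; rewrite !gt_eqF.
have := total_derivative0 (tameD (tameZ 2 t1) (tameZ (h / eps) t0)) de te.
rewrite totalD ?totalZ//; [|exact: tameZ|exact: tameZ].
rewrite -/(F h) => E; have e0 : eps != 0 by rewrite gt_eqF.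
have -> : - (h / (2 * eps)) * F h = - (h / eps * F h) / 2 by field.
by lra.
Qed.

Let F_gauss h : F h = F 0 * expR (- (h ^+ 2 / (4 * eps))).
Proof.
have E : F h * expR (h ^+ 2 / (4 * eps)) = F 0 * expR (0 ^+ 2 / (4 * eps)).
  apply: (@derive0_const _ (fun h => F h * expR (h ^+ 2 / (4 * eps)))) => x.
  by rewrite /has_derive; der_auto; field; rewrite gt_eqF.
by rewrite expRN -[LHS](mulfK (lt0r_neq0 (expR_gt0 (h ^+ 2 / (4 * eps))))) E
  expr0n/= mul0r expR0 mulr1.
Qed.

Let total_square : F 0 = total (fun t => psi t ^+ 2).
Proof. by rewrite /F; congr total; apply/funext => t; rewrite addr0 expr2. Qed.

Let F_tame : tame F.
Proof.
split; first exact: continuous_is_derive dF.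
exists (`|F 0| * (1 + 4 * eps)) => h; rewrite F_gauss normrM -[leRHS]mulrA.
apply: ler_wpM2l => //.
rewrite ger0_norm ?expR_ge0// expRN ler_pdivlMr ?(lt_le_trans ltr01) ?oneDsqr_ge1//.
rewrite mulrC ler_pdivrMr ?expR_gt0//.
have e1 := expR_ge1Dx (h ^+ 2 / (4 * eps)).
have p : 0 <= h ^+ 2 / (4 * eps) by rewrite divr_ge0 ?sqr_ge0// mulr_ge0// ltW.
have E : 4 * eps * (h ^+ 2 / (4 * eps)) = h ^+ 2 by field; rewrite gt_eqF.
have e4 : 0 <= 4 * eps by rewrite mulr_ge0// ltW.
have := ler_wpM2l e4 e1; rewrite /oneDsqr; lra.
Qed.

Let G_cvgNy : G h @[h --> -oo] --> (0 : R).
Proof.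
have -> : (0 : R) = (\int[mu]_t (cst 0 : R -> R) t)%R by rewrite Rintegral_cst// mul0r.
apply/cvg_ninftyP => u uNy; pose K := total (fun t => `|psi t|).
apply: (@Rintegral_cvg_dominated _ _ _ (fun t => K * `|psi t|)).
- by apply: tameZ; exact: tame_norm kernel_tame.
- move=> n; apply: continuous_measurable_fun.
  by apply: continuous_mul kernel_continuous _; apply: cont_shift; exact: continuous_prim kernel_tame.
- by move=> n t; rewrite normrM mulrC ler_wpM2r// prim_bounded//; exact: kernel_tame.
move=> t; rewrite /cst /= -(mulr0 (psi t)); apply: cvgMl_tmp.
have /cvg_ninftyP := prim_cvgNy kernel_tame; apply.
apply/cvgrNyPle => A; move/cvgrNyPle : uNy => /(_ (A - t)); apply: filterS => n.
by lra.
Qed.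

Let G_cvgy : G h @[h --> +oo] --> total psi * total psi.
Proof.
have -> : total psi * total psi = (\int[mu]_t (total psi * psi t))%R.
  by rewrite -[RHS]/(total (fun t => _)) totalZ//; exact: kernel_tame.
apply/cvg_pinftyP => u uy; pose K := total (fun t => `|psi t|).
apply: (@Rintegral_cvg_dominated _ _ _ (fun t => K * `|psi t|)).
- by apply: tameZ; exact: tame_norm kernel_tame.
- move=> n; apply: continuous_measurable_fun.
  by apply: continuous_mul kernel_continuous _; apply: cont_shift; exact: continuous_prim kernel_tame.
- by move=> n t; rewrite normrM mulrC ler_wpM2r// prim_bounded//; exact: kernel_tame.
move=> t; rewrite mulrC; apply: cvgMl_tmp.
have /cvg_pinftyP := prim_cvgy kernel_tame; apply.
apply/cvgryPge => A; move/cvgryPge : uy => /(_ (A - t)); apply: filterS => n.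
by lra.
Qed.

(* The correlation F of psi is Gaussian, and its primitive G increases from 0 to
   (total psi)^2. *)
Lemma kernel_moment_identity :
  total psi ^+ 2 = total (fun t => psi t ^+ 2) * Num.sqrt (4 * pi * eps).
Proof.
have := total_primitive F_tame dG G_cvgNy G_cvgy.
rewrite subr0 -expr2 => <-; rewrite -total_square.
(* [F] is a multiple of the normal density of variance [2 * eps], whose total mass is one, so its
   integral is [F 0] over the peak of that density. *)
pose s := Num.sqrt (2 * eps).
have s0 : s != 0 by rewrite gt_eqF// sqrtr_gt0 mulr_gt0.
have ss : s ^+ 2 = 2 * eps by rewrite sqr_sqrtr// mulr_ge0// ltW.
have sq : Num.sqrt (4 * pi * eps) = (normal_peak s)^-1.
  by rewrite /normal_peak invrK ss; congr Num.sqrt; rewrite -mulr_natr; ring.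
have p0 : normal_peak s != 0 by rewrite gt_eqF// normal_peak_gt0.
have -> : F = fun h => (F 0 * (normal_peak s)^-1) * normal_pdf 0 s h.
  apply/funext => h; rewrite F_gauss normal_pdfE// /normal_fun subr0 ss -mulr_natr.
  rewrite mulrA divfK// mulNr; congr (_ * expR (- (_ / _))); ring.
have -> : F 0 * (normal_peak s)^-1 * normal_pdf 0 s 0 = F 0.
  by rewrite normal_pdfE// /normal_fun subr0 expr0n/= oppr0 mul0r expR0 mulr1 divfK.
rewrite /total RintegralZl//; last exact: integrable_normal_pdf.
by rewrite /Rintegral integral_normal_pdf/= mulr1 sq.
Qed.

Let M l := total (fun t => psi t * expR (l * t)).

(** Multiplying the kernel equation by [expR (l * t)] and integrating by parts gives
    [a * l ^+ 2 + l] times [M l] on one side, and the integral of [t * psi t * expR (l * t)], the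
    derivative of [M], divided by [eps] on the other. Only a quarter of the decay rate is kept,
    which leaves room for the factor [t] and for a neighbourhood of [l]. *)
Lemma kernel_laplace_ode : exists2 kap, 0 < kap & forall l, - kap < l ->
  tame (fun t => psi t * expR (l * t)) /\
  is_derive l 1 M (eps * (a * l ^+ 2 + l) * M l).
Proof.
case: ker => _ _ [kap k0 [dec dec1]] _; exists (kap / 4); first by rewrite divr_gt0.
have c_exp l : continuous (fun t => expR (l * t)).
  by apply: (@continuous_is_derive _ _ (fun t => l * expR (l * t))) => t; der_auto; ring.
have cpsi := kernel_continuous; have cpsi1 := kernel1_continuous.
have cid : continuous (fun t : R => t) by move=> t; exact: cvg_id.
have tl l : - kap < l -> tame (fun t => psi t * expR (l * t)).
  move=> kl; apply: (decay_tame (kap := kap + l)); first by lra.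
    by apply: continuous_mul cpsi (c_exp l).
  exact: decay_expR.
have tl1 l : - kap < l -> tame (fun t => psi1 t * expR (l * t)).
  move=> kl; apply: (decay_tame (kap := kap + l)); first by lra.
    by apply: continuous_mul cpsi1 (c_exp l).
  exact: decay_expR.
have ttl l : - (kap / 2) < l -> tame (fun t => t * psi t * expR (l * t)).
  move=> kl; apply: (decay_tame (kap := kap / 2 + l)); first by lra.
    by apply: continuous_mul (c_exp l); apply: continuous_mul cid cpsi.
  by apply: decay_expR; exact: decay_id_mul.
move=> l kl; split; first by apply: tl; lra.
have d : is_derive l 1 M (total (fun t => t * psi t * expR (l * t))).
  (* For exponents between the two extremes, [expR (h * t)] is at most the exponential of the right
     extreme when [0 <= t] and of the left one when [t < 0]; the sum dominates both. *)
  have tG : tame (fun t => `|t * psi t * expR (- (kap / 4) * t)|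
      + `|t * psi t * expR ((l + 1) * t)|).
    by apply: tameD; apply: tame_norm; apply: ttl; lra.
  apply: (@is_derive_total _ (fun l t => psi t * expR (l * t))
    (fun l t => t * psi t * expR (l * t)) l (- (kap / 4)) (l + 1) _ _ _ _ tG).
  - by rewrite kl ltrDl ltr01.
  - by move=> h /andP[kh _]; apply: tl; lra.
  - by move=> h t _; rewrite /has_derive; der_auto; ring.
  - move=> h t /andP[h1 h2]; rewrite !normrM -!mulrDr ler_wpM2l ?mulr_ge0//.
    rewrite !ger0_norm ?expR_ge0//; case: (leP 0 t) => t0.
      by rewrite (@le_trans _ _ (expR ((l + 1) * t)))// ?ler_expR ?ler_wpM2r ?lerDr ?expR_ge0// ltW.
    rewrite (@le_trans _ _ (expR (- (kap / 4) * t)))// ?lerDl ?expR_ge0//.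
    by rewrite ler_expR ler_wnM2r// ltW.
apply: (der_eq d).
pose e t := expR (l * t) * (a * psi1 t - a * l * psi t - psi t).
have tpsi := tl l ltac:(lra); have tpsi1 := tl1 l ltac:(lra); have tt := ttl l ltac:(lra).
have te : tame e.
  have -> : e = fun t => a * (psi1 t * expR (l * t)) + - (a * l + 1) * (psi t * expR (l * t)).
    by apply/funext => t; rewrite /e; ring.
  by apply: tameD; apply: tameZ.
have de t : has_derive e t (eps^-1 * (t * psi t * expR (l * t)) +
    - (a * l ^+ 2 + l) * (psi t * expR (l * t))).
  have d1 := kernel_derive; have d2 := kernel_derive1.
  by rewrite /e /has_derive; der_auto; field; rewrite !gt_eqF.
have := total_derivative0 (tameD (tameZ _ tt) (tameZ _ tpsi)) de te.
rewrite totalD ?totalZ//; [|exact: tameZ|exact: tameZ].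
rewrite -/(M l) => E; have en : eps != 0 by rewrite gt_eqF.
rewrite -[LHS](mulKf (invr_neq0 en)) invrK -mulrA; congr (eps * _).
by lra.
Qed.

(** By its linear equation, [M] is a constant times the positive function [expR (g l)], so
    [M 0 = total psi] has the sign of [M l] for any [l >= 0]. For large [l] the weight favours the
    positive axis, where [psi] is positive. *)
Lemma kernel_total_gt0 : 0 < total psi.
Proof.
have [kap k0 HM] := kernel_laplace_ode.
case: ker => _ _ _ pos.
have Mder l : - kap < l -> is_derive l 1 M (eps * (a * l ^+ 2 + l) * M l) by move=> /HM[].
pose K := total (fun t => `|psi t|).
have K0 : 0 <= K by apply: Rintegral_ge0 => t _; exact: normr_ge0.
have p2 : 0 < psi 2 by have [] := pos 2 (ltac:(lra)).
(* The mass of [psi t * expR (l * t)] on [[1, 2]] is then at least [(1 + l) * psi 2 = psi 2 + K],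
   while the negative axis can remove at most [K]. *)
pose l := K / psi 2.
have l0 : 0 <= l by rewrite divr_ge0// ltW.
have kl : - kap < l by lra.
have Ml : 0 < M l.
  have tl := (HM l kl).1; have tn := tame_norm kernel_tame.
  (* Adding the absolute value of [psi] makes the integrand nonnegative everywhere, so that [D] is
     monotone; the cost in the limit is [K]. *)
  pose D x := prim (fun t => psi t * expR (l * t)) x + prim (fun t => `|psi t|) x.
  have dD (x : R) : is_derive x 1 D (psi x * expR (l * x) + `|psi x|).
    have d1 := is_derive_prim x tl; have d2 := is_derive_prim x tn.
    by rewrite /D; der_auto.
  have D'ge0 x : 0 <= psi x * expR (l * x) + `|psi x|.
    case: (leP 0 x) => x0.
      by have [px _] := pos x x0; rewrite addr_ge0 ?normr_ge0// mulr_ge0 ?expR_ge0// ltW.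
    have : `|psi x * expR (l * x)| <= `|psi x|.
      rewrite normrM ler_piMr ?normr_ge0// ger0_norm ?expR_ge0//.
      by rewrite -expR0 ler_expR mulr_ge0_le0// ltW.
    by rewrite ler_norml => /andP[+ _]; lra.
  have Dmono x y : x <= y -> D x <= D y.
    by move=> xy; apply: (derive_ge0_le xy (fun t _ => dD t)) => t _; exact: D'ge0.
  have DN : D x @[x --> -oo] --> (0 : R).
    by rewrite -(addr0 0); apply: cvgD; apply: prim_cvgNy.
  have Dy : D x @[x --> +oo] --> M l + K by apply: cvgD; apply: prim_cvgy.
  have D1 : 0 <= D 1.
    apply: (cvg_le_near _ DN); near=> x; apply: Dmono.
    by near: x; apply: nbhs_ninfty_le; rewrite num_real.
  have D2 : D 2 <= M l + K.
    apply: (cvg_ge_near _ Dy); near=> x; apply: Dmono.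
    by near: x; apply: nbhs_pinfty_ge; rewrite num_real.
  have D12 : expR l * psi 2 <= D 2 - D 1.
    suff : D 1 - expR l * psi 2 * 1 <= D 2 - expR l * psi 2 * 2 by lra.
    apply: (@derive_ge0_le _ (fun x => D x - expR l * psi 2 * x)
      (fun x => psi x * expR (l * x) + `|psi x| - expR l * psi 2)); first by lra.
      by move=> x _; rewrite /has_derive; der_auto; ring.
    move=> x /andP[x1 x2]; rewrite subr_ge0.
    have pp : psi 2 <= psi x.
      rewrite -lerN2.
      apply: (@derive_ge0_le _ (fun x => - psi x) (fun x => - psi1 x)) => // t /andP[t1 _].
        by have dp := kernel_derive; rewrite /has_derive; der_auto; ring.
      by have [|_] := pos t; [lra|rewrite oppr_ge0].
    apply: (@le_trans _ _ (psi x * expR (l * x))); last by rewrite lerDl normr_ge0.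
    by rewrite mulrC ler_pM ?expR_ge0 ?(ltW p2)// ler_expR ler_peMr.
  have : (1 + l) * psi 2 <= expR l * psi 2 by rewrite ler_pM2r// expR_ge1Dx.
  have : l * psi 2 = K by rewrite /l divfK// gt_eqF.
  by lra.
pose g x := eps * (a * (x ^+ 3 / 3) + x ^+ 2 / 2).
have E : M 0 * expR (- g 0) = M l * expR (- g l).
  suff : forall y, 0 <= y -> M y * expR (- g y) = M 0 * expR (- g 0) by move=> /(_ l l0) ->.
  move=> y y0.
  have [||->//|[c _]] := @mvt _ (fun x => M x * expR (- g x)) (fun=> 0) _ _ y0.
  - move=> x /andP[x0 _]; have kx : - kap < x by lra.
    have dM := Mder x kx.
    by rewrite /g /has_derive; der_auto; field.
  - apply: (@is_derive_within _ _ (fun=> 0)) => x /andP[x0 _]; have kx : - kap < x by lra.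
    have dM := Mder x kx.
    by rewrite /g /has_derive; der_auto; field.
  - by rewrite mul0r => /eqP; rewrite subr_eq0 => /eqP.
have -> : total psi = M 0.
  by congr total; apply/funext => t; rewrite mul0r expR0 mulr1.
by rewrite -(pmulr_lgt0 _ (expR_gt0 (- g 0))) E mulr_gt0 ?expR_gt0.
Unshelve. all: end_near. Qed.

End kernel_moments.

(** * Paths on a half-line and integrals from the starting time *)

Section running_integral.
Context {R : realType}.
Notation mu := (@lebesgue_measure R).
Implicit Types (f g : R -> R) (s t a b T : R).

(** Continuing a path by its value at [s] makes it continuous on the whole line, so that no later
    argument has to treat [s] as an endpoint of the domain. *)
Definition freeze s f : R -> R := fun t => f (Num.max s t).

Lemma freezeE s f t : s <= t -> freeze s f t = f t.
Proof. by move=> st; rewrite /freeze max_r. Qed.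

Lemma freeze_continuous s f : {within `[s, +oo[, continuous f} -> continuous (freeze s f).
Proof.
move=> cf t.
have [cin cR] := (continuous_within_itvcyP s f).1 cf.
have maxc : continuous (fun t : R => Num.max s t).
  by move=> x; apply: continuous_max; [exact: cvg_cst|exact: cvg_id].
case: (ltgtP s t) => st.
- apply: continuous_comp; first exact: maxc.
  by rewrite max_r ?ltW//; apply: cin; rewrite in_itv/= st.
- rewrite /continuous_at [X in _ --> X](_ : _ = f s) ?/freeze ?max_l ?ltW//.
  apply: cvg_near_cst; near=> x; rewrite max_l// ltW//.
  by near: x; exact: lt_nbhsl.
- rewrite -st; apply/left_right_continuousP; split.
    rewrite /freeze maxxx; apply: cvg_near_cst.
    near=> x; rewrite max_l// ltW//; near: x; exact: nbhs_left_lt.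
  rewrite /freeze maxxx; apply: cvg_trans cR; apply: near_eq_cvg.
  near=> x; rewrite max_r// ltW//; near: x; exact: nbhs_right_gt.
Unshelve. all: end_near. Qed.

Definition running f s t : R := (\int[mu]_(u in `[s, t]) f u)%R.

Lemma continuous_integrable_itv f a b : continuous f -> mu.-integrable `[a, b] (EFin \o f).
Proof.
move=> cf; apply: continuous_compact_integrable; first exact: segment_compact.
exact: continuous_subspaceT.
Qed.

Lemma running_derive f s t : continuous f -> s < t -> is_derive t 1 (running f s) (f t).
Proof.
move=> cf st; have tt : t < t + 1 by rewrite ltrDl.
have [| |d1 d2] := @continuous_FTC1_closed R f s t (t + 1) tt _ st.
- exact: continuous_integrable_itv.
- exact: cf.
by apply: DeriveDef => //; rewrite -derive1E.
Qed.

Lemma running0 f s : running f s s = 0.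
Proof. by rewrite /running set_itv1 Rintegral_set1. Qed.

Lemma running_within f s T : continuous f -> {within `[s, T], continuous (running f s)}.
Proof.
move=> cf; case: (leP s T) => sT.
  by have := parameterized_integral_continuous sT (continuous_integrable_itv s T cf).
by rewrite set_itv_ge ?bnd_simp -?ltNge//; exact: continuous_subspace0.
Qed.

Lemma eq_running f g s t : (forall u, s <= u -> f u = g u) -> running f s t = running g s t.
Proof. by move=> fg; apply: eq_Rintegral => u; rewrite inE/= in_itv/= => /andP[/fg]. Qed.

End running_integral.

(** * Deterministic analysis of a single path *)

Section pathwise.
Context {R : realType}.
Variables (a c eps s : R) (psi psi1 Bt q p : R -> R).
Hypotheses (a_gt0 : 0 < a) (c_gt0 : 0 < c) (eps_gt0 : 0 < eps).
Hypothesis ker : adjoint_kernel a eps psi psi1.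
Hypotheses (cB : continuous Bt) (cq : continuous q) (cp : continuous p).
Hypotheses (Bs : Bt s = 0).
Hypothesis q_eq : forall t, s <= t -> q t = running p s t.
Hypothesis p_eq : forall t, s <= t ->
  a * p t = running (fun u => - p u + eps^-1 * (u * q u + eps)) s t + c * Bt t.
Implicit Types (t T : R).

Let f u := - p u + eps^-1 * (u * q u + eps).

Let cf : continuous f.
Proof.
move=> u; apply: cvgD; first by apply: cvgN; exact: cp.
apply: cvgM; first exact: cvg_cst.
apply: cvgD; last exact: cvg_cst.
by apply: cvgM; [exact: cvg_id|exact: cq].
Qed.

Let dq t : s < t -> is_derive t 1 q (p t).
Proof.
move=> st; apply: near_eq_is_derive (running_derive cp st).
near=> x; rewrite q_eq// ltW//; near: x; exact: lt_nbhsr.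
Unshelve. all: end_near. Qed.

(** Removing the noise leaves a function that is differentiable after [s], while [Bt], and hence
    [p], is only assumed continuous. *)
Let pt t := p t - c / a * Bt t.

Let dpt t : s < t -> is_derive t 1 pt (f t / a).
Proof.
move=> st; apply: (near_eq_is_derive (f := fun x => a^-1 * running f s x)).
  near=> x; have sx : s <= x by rewrite ltW//; near: x; exact: lt_nbhsr.
  have an : a != 0 by rewrite gt_eqF.
  by apply: (mulfI an); rewrite /pt mulrBr p_eq//; field.
have d := running_derive cf st.
by der_auto; ring.
Unshelve. all: end_near. Qed.

(* The combination Y of p - (c/a) B and q is chosen so that the drift cancels. *)
Definition growth_functional t := a * psi t * (p t - c / a * Bt t) + (psi t - a * psi1 t) * q t.
Local Notation Y := growth_functional.

Lemma growth_functional_derive t : s < t -> is_derive t 1 Y (psi t - c * psi1 t * Bt t).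
Proof.
move=> st; have d1 := kernel_derive ker; have d2 := kernel_derive1 ker.
have d3 := dq st; have d4 := dpt st.
have -> : Y = fun t => a * psi t * pt t + (psi t - a * psi1 t) * q t by [].
der_auto; rewrite /pt /f; field.
by rewrite !gt_eqF.
Qed.

Lemma growth_functional_continuous : continuous Y.
Proof.
have cpsi := kernel_continuous ker; have cpsi1 := kernel1_continuous ker.
move=> t; apply: cvgD.
  apply: cvgM; first by apply: cvgM; [exact: cvg_cst|exact: cpsi].
  by apply: cvgB; [exact: cp|apply: cvgM; [exact: cvg_cst|exact: cB]].
apply: cvgM; last exact: cq.
by apply: cvgB; [exact: cpsi|apply: cvgM; [exact: cvg_cst|exact: cpsi1]].
Qed.

Lemma growth_functional0 : Y s = 0.
Proof.
have q0 : q s = 0 by rewrite q_eq// running0.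
have p0 : p s = 0.
  have an : a != 0 by rewrite gt_eqF.
  by apply: (mulfI an); rewrite p_eq// running0 Bs !mulr0 addr0.
by rewrite /Y Bs q0 p0; ring.
Qed.

(** Defined from [Y] rather than as the integral of [- psi1 * Bt]: it then depends on the solution
    and the noise at the single time [t], which makes it measurable as a random variable without
    further work. *)
Definition noise_functional t := (Y t - (prim psi t - prim psi s)) / c.
Local Notation J := noise_functional.

Lemma noise_functional_derive t : s < t -> is_derive t 1 J (- (psi1 t * Bt t)).
Proof.
move=> st; have d1 := growth_functional_derive st.
have d2 := is_derive_prim t (kernel_tame ker).
by rewrite /J; der_auto; field; rewrite gt_eqF.
Qed.

Lemma noise_functional_continuous : continuous J.
Proof.
move=> t; apply: cvgM; last exact: cvg_cst.
apply: cvgB; first exact: growth_functional_continuous.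
by apply: cvgB; [exact: continuous_prim (kernel_tame ker) _|exact: cvg_cst].
Qed.

Lemma noise_functional0 : J s = 0.
Proof. by rewrite /J growth_functional0 !subrr mul0r. Qed.

Lemma growth_functionalE t : Y t = prim psi t - prim psi s + c * J t.
Proof. by rewrite /J; field; rewrite gt_eqF. Qed.

(** The bound [K] on the integral of [b] is the only information about the noise at infinity; it
    takes the place of a pointwise growth bound. *)
Let b t := expR (- t) * `|Bt t|.

Lemma weighted_noise_continuous : continuous b.
Proof.
move=> t; apply: cvgM; last by apply: cvg_norm; exact: cB.
apply: continuous_comp; last exact: continuous_expR.
exact: cvgN.
Qed.

Let Ib := running b s.

Variable K : R.
Hypothesis Ib_le : forall t, s <= t -> Ib t <= K.

Let dI t : s < t -> is_derive t 1 Ib (b t).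
Proof. by move=> st; exact: running_derive weighted_noise_continuous st. Qed.

Let b_ge0 t : 0 <= b t. Proof. by rewrite mulr_ge0 ?expR_ge0. Qed.

Let Ib_mono x y : s <= x -> x <= y -> Ib x <= Ib y.
Proof.
move=> sx xy; have sub : `[x, y] `<=` (`[s, y] : set R).
  by move=> z /=; rewrite !in_itv/= => /andP[xz ->]; rewrite (le_trans sx).
apply: (mvt_le (df := b) xy) => //.
- by move=> z /andP[xz _]; apply: dI; exact: le_lt_trans xz.
- by apply: continuous_subspaceW sub _; apply: running_within; exact: weighted_noise_continuous.
Qed.

Let Ib_ge0 x : s <= x -> 0 <= Ib x.
Proof. by move=> sx; rewrite -(running0 b s); exact: Ib_mono. Qed.

Let psi1_bound : exists2 C, 0 <= C & forall t, s <= t -> `|psi1 t * Bt t| <= C * b t.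
Proof.
have [_ _ [kap k0 [_ d]] _] := ker; have [C HC] := d 1 ltr01.
have C0 : 0 <= C.
  by have [/(_ (lexx _)) + _] := HC 0; rewrite mulr0 oppr0 expR0 mulr1; exact: le_trans.
exists (C + C) => [|t st]; first by rewrite addr_ge0.
rewrite normrM /b mulrA ler_wpM2r//.
have [H1 H2] := HC t; case: (leP 0 t) => t0.
  by rewrite (le_trans (H1 t0))// mul1r ler_wpM2r ?expR_ge0// lerDl.
have e1 : 1 <= expR (- t) by rewrite -expR0 ler_expR oppr_ge0 ltW.
have e2 : expR (kap * t) <= 1 by rewrite -expR0 ler_expR mulr_ge0_le0// ltW.
rewrite (le_trans (H2 (ltW t0)))// (@le_trans _ _ C) ?ler_piMr//.
by rewrite (@le_trans _ _ (C * expR (- t))) ?ler_peMr// ler_wpM2r ?expR_ge0// lerDr.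
Qed.

Let bounded_mono_cvg (g : R -> R) M : (forall x y, s <= x -> x <= y -> g x <= g y) ->
  (forall x, s <= x -> g x <= M) -> exists l : R, g x @[x --> +oo] --> l.
Proof.
move=> gm gM; exists (sup (range (freeze s g))).
have H := @nondecreasing_cvgr _ (freeze s g).
have : freeze s g r @[r --> +oo] --> sup (range (freeze s g)).
  apply: H; first by move=> x y xy; apply: gm; rewrite ?ge_max !le_max ?lexx ?xy ?orbT.
  by exists M => _ [x _ <-]; apply: gM; rewrite le_max lexx.
apply: cvg_trans; apply: near_eq_cvg; near=> x.
by rewrite freezeE//; near: x; apply: nbhs_pinfty_ge; rewrite num_real.
Unshelve. all: end_near. Qed.

(** The derivative of [J] is at most [C * b] in absolute value, so [C * Ib + J] and [C * Ib - J] are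
    both nondecreasing. The second property bounds the first function from above, which therefore
    converges, and so does [Ib]. *)
Lemma noise_functional_cvg : exists l : R, J t @[t --> +oo] --> l.
Proof.
have [C C0 HC] := psi1_bound.
have mono (e : R) (e1 : e = 1 \/ e = -1) x y : s <= x -> x <= y ->
    C * Ib x + e * J x <= C * Ib y + e * J y.
  move=> sx xy; have sub : `[x, y] `<=` (`[s, y] : set R).
    by move=> z /=; rewrite !in_itv/= => /andP[xz ->]; rewrite (le_trans sx).
  apply: (mvt_le (f := fun t => C * Ib t + e * J t)
    (df := fun t => C * b t + e * - (psi1 t * Bt t)) xy) => //.
  - move=> z /andP[xz _]; have sz := le_lt_trans sx xz.
    have d1 := dI sz; have d2 := noise_functional_derive sz.
    by rewrite /has_derive; der_auto; ring.
  - have cI : {within `[x, y], continuous Ib}.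
      by apply: continuous_subspaceW sub _; apply: running_within; exact: weighted_noise_continuous.
    have cJ : {within `[x, y], continuous J}.
      by apply: continuous_subspaceT; exact: noise_functional_continuous.
    move=> z; apply: cvgD; apply: cvgM; [exact: cvg_cst|exact: cI|exact: cvg_cst|exact: cJ].
  - move=> z /andP[xz _]; have := HC z (le_trans sx (ltW xz)).
    by rewrite ler_norml => /andP[h1 h2]; case: e1 => ->; lra.
have [l1 H1] := bounded_mono_cvg Ib_mono Ib_le.
have [|l2 H2] := @bounded_mono_cvg (fun t => C * Ib t + 1 * J t) (C * K + C * K) (mono 1 (or_introl erefl)).
  move=> x sx.
  have := mono (-1) (or_intror erefl) s x (lexx s) sx.
  rewrite noise_functional0 {1}/Ib running0 !mulr0 addr0 => h.
  by have := ler_wpM2l C0 (Ib_le sx); lra.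
exists (l2 - C * l1).
have H3 : (C * Ib t + 1 * J t) - C * Ib t @[t --> +oo] --> l2 - C * l1.
  by apply: cvgB H2 _; exact: cvgMl_tmp.
by apply: cvg_trans H3; apply: near_eq_cvg; apply: nearW => t /=; ring.
Qed.

(* r = q exp(t/a)/psi satisfies r' = exp(t/a) (Y + c psi B)/(a psi^2), and with
   D = exp((1/a + 1) t)/psi the function r + (c/a) D Ib - kap D is eventually
   nondecreasing for every kap. *)
Lemma escape_to_pinfty (sg y : R) : sg = 1 \/ sg = -1 -> 0 < y ->
  sg * Y t @[t --> +oo] --> y -> sg * q t @[t --> +oo] --> +oo.
Proof.
move=> sg1 y0 HY.
have [_ _ [kp k0 [dec dec1]] pos] := ker.
have [C1 HC1] := dec 2 (ltac:(lra)); have [C2 HC2] := dec1 2 (ltac:(lra)).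
(* The summand [c / a * K] pays for the noise term [c / a * D t * Ib t], and the 1 leaves a full
   [D t] as a lower bound for the growth of [r]. *)
pose kap := c / a * K + 1; pose ia := a^-1.
have ia0 : 0 < ia by rewrite invr_gt0.
have ca0 : 0 < c / a by rewrite divr_gt0.
have K0 : 0 <= K by exact: le_trans (Ib_ge0 (lexx s)) (Ib_le (lexx s)).
have kap0 : 0 < kap by rewrite ltr_wpDl// mulr_ge0// ltW.
pose Q := kap * ((ia + 1) * C1 + C2).
have HY2 : \forall t \near +oo, y / 2 < sg * Y t.
  by apply: (cvgr_gt y HY); rewrite ltr_pdivrMr// ltr_pMr//; lra.
have [T0 [T0r HT0]] := HY2.
(* After [T] the functional is above [y / 2], the equations may be differentiated, the signs of
   [psi] and [psi1] are known, and [Q * expR (- t)] is below [y / (2 * a)]. *)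
pose T := Num.max (Num.max (T0 + 1) (Num.max (s + 1) 0)) (Q * (2 * a) / y).
have TT0 : T0 < T by rewrite /T !lt_max ltrDl ltr01.
have Ts : s < T by rewrite /T !lt_max ltrDl ltr01 !orbT.
have Tge0 : 0 <= T by rewrite /T !le_max lexx !orbT.
have TQ : Q * (2 * a) / y <= T by rewrite /T le_max lexx orbT.
(* Divided by the common factor [D t / psi t], this compares [kap] times the derivative of [D] with
   the contribution of [Y] to the derivative of [r]. It holds because [psi] and [psi1] are bounded
   by multiples of [expR (- (2 * t))]. *)
have small t : T <= t -> kap * ((ia + 1) * psi t - psi1 t) <= expR (- t) * (sg * Y t) * ia.
  move=> Tt; have t0 := le_trans Tge0 Tt.
  have h1 := (HC1 t).1 t0; have h2 := (HC2 t).1 t0.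
  have e2 : expR (- (2 * t)) = expR (- t) * expR (- t) by rewrite -expRD; congr expR; ring.
  have E0 := expR_gt0 (- t).
  have h3 : kap * ((ia + 1) * psi t - psi1 t) <= Q * expR (- (2 * t)).
    rewrite /Q -[leRHS]mulrA ler_pM2l// [leRHS]mulrDl lerD//.
      rewrite -[leRHS]mulrA ler_pM2l ?addr_gt0//; apply: le_trans h1; exact: ler_norm.
    by apply: le_trans h2; rewrite -normrN ler_norm.
  apply: (le_trans h3); rewrite e2 mulrCA -[leRHS]mulrA ler_pM2l//.
  apply: (@le_trans _ _ (y / 2 * ia)); last first.
    by rewrite ler_pM2r// ltW// HT0//; exact: lt_le_trans Tt.
  rewrite expRN ler_pdivrMr ?expR_gt0//.
  have h4 : Q * (2 * a) <= T * y by rewrite -ler_pdivrMr.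
  have h5 : T * y <= expR t * y.
    by rewrite ler_pM2r// (le_trans Tt)//; have := expR_ge1Dx t; lra.
  have -> : y / 2 * ia * expR t = expR t * y / (2 * a) by rewrite /ia; field; rewrite gt_eqF.
  by rewrite ler_pdivlMr ?mulr_gt0//; lra.
pose r t := sg * q t * expR (t * ia) / psi t.
pose D t := expR ((ia + 1) * t) / psi t.
pose H t := r t + c / a * (D t * Ib t) - kap * D t.
have Hmono t : T <= t -> H T <= H t.
  move=> Tt.
  pose D1 x := D x * ((ia + 1) - psi1 x / psi x).
  apply: (@derive_ge0_le _ H (fun x => expR (x * ia) * (sg * Y x + sg * (c * psi x * Bt x)) / (a * psi x ^+ 2)
     + c / a * (D1 x * Ib x + D x * b x) - kap * D1 x)) => // x /andP[Tx _];
    have sx := lt_le_trans Ts Tx; have [px p1x] := pos x (le_trans Tge0 Tx);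
    have pn : psi x != 0 by rewrite gt_eqF.
    have d1 := kernel_derive ker x; have d3 := dq sx; have d4 := dI sx.
    rewrite /has_derive /H /r /D; der_auto; rewrite /D1 /D /Y /ia; field.
    by rewrite pn gt_eqF.
  have Dx : 0 < D x by rewrite divr_gt0 ?expR_gt0.
  have D1x : 0 <= D1 x.
    rewrite mulr_ge0 ?(ltW Dx)// addr_ge0// ?addr_ge0 ?(ltW ia0)//.
    by rewrite oppr_ge0 mulr_le0_ge0// invr_ge0 ltW.
  have eD : expR (x * ia) = D x * psi x * expR (- x).
    rewrite /D divfK// -expRD; congr expR; ring.
  have n1 : - (c / a * (D x * b x)) <= expR (x * ia) * (sg * (c * psi x * Bt x)) / (a * psi x ^+ 2).
    have -> : expR (x * ia) * (sg * (c * psi x * Bt x)) / (a * psi x ^+ 2) =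
       c / a * (D x * (expR (- x) * (sg * Bt x))).
      by rewrite eD; field; rewrite pn gt_eqF.
    rewrite -mulrN ler_pM2l// -mulrN ler_pM2l// /b -mulrN ler_pM2l ?expR_gt0//.
    by case: sg1 => ->; rewrite ?mul1r ?mulN1r ?lerN2 ?ler_norm// lerNl -normrN ler_norm.
  have n2 : kap * D1 x <= expR (x * ia) * (sg * Y x) / (a * psi x ^+ 2).
    have -> : expR (x * ia) * (sg * Y x) / (a * psi x ^+ 2) =
       D x / psi x * (expR (- x) * (sg * Y x) * ia).
      by rewrite eD /ia; field; rewrite pn gt_eqF.
    have -> : kap * D1 x = D x / psi x * (kap * ((ia + 1) * psi x - psi1 x)).
      by rewrite /D1; field.
    apply: ler_wpM2l; last exact: small.
    by rewrite mulr_ge0 ?invr_ge0 ?(ltW px) ?(ltW Dx).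
  have n3 : 0 <= c / a * (D1 x * Ib x) by rewrite mulr_ge0 ?(ltW ca0)// mulr_ge0// Ib_ge0// ltW.
  by move: n1 n2 n3; rewrite !mulrDr !mulrDl; lra.
have [pT _] := pos T Tge0.
have psi_le t : T <= t -> psi t <= psi T.
  move=> Tt; rewrite -lerN2.
  apply: (@derive_ge0_le _ (fun x => - psi x) (fun x => - psi1 x)) => // x /andP[Tx _].
    by have d1 := kernel_derive ker x; rewrite /has_derive; der_auto; ring.
  by have [_] := pos x (le_trans Tge0 Tx); rewrite oppr_ge0.
have lb t : T <= t -> expR t - `|H T| * psi T <= sg * q t.
  move=> Tt; have [pt0 _] := pos t (le_trans Tge0 Tt).
  have Dt : 0 < D t by rewrite divr_gt0 ?expR_gt0.
  have rge : H T + D t <= r t.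
    have := Hmono t Tt; rewrite {2}/H.
    have : c / a * (D t * Ib t) <= c / a * (D t * K).
      by rewrite ler_pM2l// ler_pM2l// Ib_le// ltW// (lt_le_trans Ts).
    by rewrite /kap; lra.
  (* The weight that turns [r t] back into [sg * q t] and [D t] into [expR t]; it stays below
     [psi T]. *)
  pose w := psi t * expR (- (t * ia)).
  have w0 : 0 < w by rewrite mulr_gt0 ?expR_gt0.
  have wT : w <= psi T.
    rewrite /w -[leRHS]mulr1 ler_pM ?expR_ge0 ?(ltW pt0) ?psi_le//.
    by rewrite -expR0 ler_expR oppr_le0 mulr_ge0 ?(ltW ia0)// (le_trans Tge0).
  have rw : r t * w = sg * q t.
    have : expR (t * ia) * expR (- (t * ia)) = 1 by rewrite expRN mulfV// gt_eqF ?expR_gt0.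
    move=> ee; rewrite /r /w mulrA divfK ?gt_eqF// -mulrA ee mulr1//.
  have Dw : D t * w = expR t.
    rewrite /D /w mulrA divfK ?gt_eqF// -expRD; congr expR; ring.
  have := ler_wpM2r (ltW w0) rge; rewrite mulrDl rw Dw.
  have h1 : - (`|H T| * psi T) <= H T * w.
    rewrite -mulNr; apply: (@le_trans _ _ (- `|H T| * w)).
      by rewrite !mulNr lerN2 ler_wpM2l.
    by rewrite ler_pM2r// lerNl -normrN ler_norm.
  by lra.
apply/cvgryPge => A; near=> t.
have Tt : T <= t by near: t; apply: nbhs_pinfty_ge; rewrite num_real.
apply: le_trans (lb t Tt).
have At : A + `|H T| * psi T <= t by near: t; apply: nbhs_pinfty_ge; rewrite num_real.
by have := expR_ge1Dx t; lra.
Unshelve. all: end_near. Qed.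

End pathwise.

(** * Integration against densities and affine changes of variable *)

Section density.
Context d (T : measurableType d) (R : realType).
Variables (mu nu : {measure set T -> \bar R}) (f : T -> R).
Hypotheses (mf : measurable_fun setT f) (f_ge0 : forall x, 0 <= f x).
Hypothesis nuE : forall A, measurable A -> nu A = (\int[mu]_(x in A) (f x)%:E)%E.

Import HBNNSimple.

Let density_indic A : measurable A ->
  (\int[nu]_x (\1_A x)%:E = \int[mu]_x ((\1_A x)%:E * (f x)%:E))%E.
Proof.
move=> mA; rewrite integral_indic// setIT nuE// [LHS]integral_mkcond.
apply: eq_integral => x _; rewrite patchE indicE.
by case: ifPn => xA; rewrite ?mul1e ?mul0e.
Qed.

Let density_nnsfun (h : {nnsfun T >-> R}) :
  (\int[nu]_x (h x)%:E = \int[mu]_x ((h x)%:E * (f x)%:E))%E.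
Proof.
under [LHS]eq_integral do rewrite fimfunE -fsumEFin//.
rewrite [LHS]ge0_integral_fsum//; last 2 first.
  - by move=> r; exact/measurable_EFinP/measurableT_comp.
  - by move=> n x _; rewrite EFinM nnfun_muleindic_ge0.
under [RHS]eq_integral.
  move=> x xD; rewrite muleC fimfunE -fsumEFin// ge0_mule_fsumr; last first.
    by move=> r; rewrite EFinM nnfun_muleindic_ge0.
  over.
rewrite [RHS]ge0_integral_fsum//; last 2 first.
  - move=> r; apply: emeasurable_funM; first exact/measurable_EFinP.
    exact/measurable_EFinP/measurableT_comp.
  - by move=> n x _; apply: mule_ge0; rewrite ?EFinM ?nnfun_muleindic_ge0 ?lee_fin.
apply: eq_fsbigr => r _.
have [r0|r0] := leP 0 r; last first.
  rewrite !integral0_eq// => x _; rewrite preimage_nnfun0// indicE in_set0 mulr0 ?mule0//.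
under [RHS]eq_integral do rewrite EFinM muleCA.
rewrite [RHS]ge0_integralZl//; last 2 first.
  - by apply: emeasurable_funM; [exact/measurable_EFinP|exact/measurable_EFinP].
  - by move=> t _; rewrite mule_ge0// lee_fin.
under [LHS]eq_integral do rewrite EFinM.
rewrite ge0_integralZl//; last exact/measurable_EFinP.
by rewrite density_indic//; congr (_ * _)%E; apply: eq_integral => x _; rewrite muleC.
Qed.

Lemma integral_density (g : T -> \bar R) : measurable_fun setT g -> (forall x, 0 <= g x)%E ->
  (\int[nu]_x g x = \int[mu]_x (g x * (f x)%:E))%E.
Proof.
move=> mg g0; pose g_ := nnsfun_approx measurableT mg.
transitivity (lim (\int[nu]_x (g_ n x)%:E @[n --> \oo])%E).
  rewrite -monotone_convergence//=.
  - apply: eq_integral => ? /[!inE] xD; apply/esym/cvg_lim => //=.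
    exact: cvg_nnsfun_approx.
  - by move=> n; exact/measurable_EFinP/measurable_funTS.
  - by move=> n ? _; rewrite lee_fin.
  - by move=> ? _ ? ? mn; rewrite lee_fin; exact/lefP/nd_nnsfun_approx.
transitivity (lim (\int[mu]_x ((g_ n x)%:E * (f x)%:E) @[n --> \oo])%E).
  by apply: congr_lim; apply/funext => n /=; exact: density_nnsfun.
rewrite -monotone_convergence//=.
- apply: eq_integral => x /[!inE] xD; apply/cvg_lim => //=.
  apply: cvgeZr => //.
  exact: cvg_nnsfun_approx.
- by move=> n; apply: emeasurable_funM; exact/measurable_EFinP/measurable_funTS.
- by move=> n x _; rewrite mule_ge0// lee_fin.
- by move=> x _ m n mn; rewrite lee_wpmul2r ?lee_fin//; exact/lefP/nd_nnsfun_approx.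
Qed.

End density.

Section affine_change_of_variable.
Context {R : realType}.
Notation mu := (@lebesgue_measure R).
Implicit Types (a b x y : R).

Lemma measurable_affine a b : measurable_fun setT (fun x : measurableTypeR R => a * x + b : measurableTypeR R).
Proof. by apply: measurable_funD => //; apply: measurable_funM. Qed.

Lemma lebesgue_measure_affine a b (A : set R) : a != 0 -> measurable A ->
  (mu A = `|a|%:E * mu [set x | A (a * x + b)%R])%E.
Proof.
move=> a0 mA; pose phi := fun x : measurableTypeR R => a * x + b : measurableTypeR R.
have mphi : measurable_fun setT phi := measurable_affine a b.
rewrite (@lebesgue_measure_unique R (mscale (NngNum (normr_ge0 a)) (pushforward mu phi)))//.
move=> _ [[l u]] _ <- /=; rewrite /mscale/= /pushforward.
have na : 0 < `|a| by rewrite normr_gt0.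
have [lu|ul] := ltP l u; last first.
  rewrite set_itv_ge ?bnd_simp -?leNgt//.
  by rewrite preimage_set0 !measure0 mule0.
have [ap|an] := ltP 0 a.
  have -> : phi @^-1` `]l, u] = `](l - b) / a, (u - b) / a]%classic.
    apply/seteqP; split => x; rewrite /phi /= !in_itv/= ltr_pdivrMr// ler_pdivlMr//;
    by rewrite ltrBlDr lerBrDr [x * a]mulrC.
  rewrite !lebesgue_measure_itv/= !lte_fin lu ltr_pM2r ?invr_gt0// ltrD2r lu gtr0_norm//.
  by rewrite -!EFinB -EFinM; congr EFin; field.
have an' : a < 0 by rewrite lt_neqAle a0.
have -> : phi @^-1` `]l, u] = `[(u - b) / a, (l - b) / a[%classic.
  apply/seteqP; split => x; rewrite /phi /= !in_itv/= ler_ndivrMr// ltr_ndivlMr// andbC;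
  by rewrite ltrBlDr lerBrDr [x * a]mulrC.
rewrite !lebesgue_measure_itv/= !lte_fin lu ltr_nM2r ?invr_lt0// ltrD2r lu ltr0_norm//.
by rewrite -!EFinB -EFinM; congr EFin; field; rewrite lt_eqF.
Qed.

Lemma integral_affine a b (f : R -> \bar R) : a != 0 -> measurable_fun setT f ->
  (forall x, 0 <= f x)%E ->
  (\int[mu]_x f x = `|a|%:E * \int[mu]_x f (a * x + b)%R)%E.
Proof.
move=> a0 mf f0; pose phi := fun x : measurableTypeR R => a * x + b : measurableTypeR R.
have mphi : measurable_fun setT phi := measurable_affine a b.
rewrite -[RHS]/(_ * \int[mu]_x (f \o phi) x)%E.
have := @ge0_integral_pushforward _ _ _ _ R phi mphi mu setT f measurableT mf (fun y _ => f0 y).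
rewrite preimage_setT => <-.
rewrite (@eq_measure_integral _ _ _ _ (mscale (NngNum (normr_ge0 a)) (pushforward mu phi)) _ f).
  by rewrite ge0_integral_mscale.
by move=> A mA _; exact: lebesgue_measure_affine.
Qed.

End affine_change_of_variable.

(** * Linear combinations of independent Gaussian variables *)

Section gaussian_convolution.
Context {R : realType}.
Notation mu := (@lebesgue_measure R).
Implicit Types (v c x y z s : R) (A : set R).

Let preimage_measurable (f : R -> R) A : measurable_fun setT f -> measurable A ->
  measurable ([set x | A (f x)] : set R).
Proof. by move=> mf mA; rewrite -[X in measurable X]setTI; exact: mf. Qed.

Let measurable_pdf_restrict m s A : measurable A ->
  measurable_fun setT ((fun x => (normal_pdf m s x)%:E) \_ A).
Proof.
move=> mA; rewrite -measurable_restrictT//; apply: measurable_funTS.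
apply/measurable_EFinP. refine (measurable_normal_pdf m s).
Qed.

Let pdf_restrict_ge0 m s A x : (0 <= ((fun x => (normal_pdf m s x)%:E) \_ A) x)%E.
Proof. by rewrite patchE; case: ifP => // _; rewrite lee_fin normal_pdf_ge0. Qed.

Lemma lebesgue_integralZl (k : R) (h : R -> \bar R) : 0 <= k -> measurable_fun setT h ->
  (forall x, 0 <= h x)%E -> (\int[mu]_x (k%:E * h x) = k%:E * \int[mu]_x h x)%E.
Proof. by move=> k0 mh h0; rewrite ge0_integralZl. Qed.

Let tonelli_kernel (h : R -> \bar R) (K : R * R -> R) : measurable_fun setT h ->
  (forall x, 0 <= h x)%E ->
  measurable_fun setT (K : measurableTypeR R * measurableTypeR R -> R) ->
  (forall p, 0 <= K p) ->
  (\int[mu]_y \int[mu]_z (h z * (K (y, z))%:E) = \int[mu]_z (h z * \int[mu]_y (K (y, z))%:E))%E.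
Proof.
move=> mh h0 mK K0.
rewrite (@fubini_tonelli _ _ _ _ _ mu mu (fun p => h p.2 * (K p)%:E)%E) /=; first last.
- by move=> p; rewrite mule_ge0// lee_fin.
- apply: emeasurable_funM; last exact/measurable_EFinP.
  by apply: (measurableT_comp mh); exact: measurable_snd.
apply: eq_integral => z _; rewrite ge0_integralZl//.
- by apply/measurable_EFinP; apply: (measurableT_comp mK); exact: measurable_pair2.
- by move=> y _; rewrite lee_fin.
Qed.

Let measurable_pdf_line s k : measurable_fun setT
  ((fun p => normal_pdf 0 s (p.1 - k * p.2)) : measurableTypeR R * measurableTypeR R -> R).
Proof.
apply: measurableT_comp; first exact: measurable_normal_pdf.
apply: measurable_funB; first exact: measurable_fst.
by apply: measurable_funM => //; exact: measurable_snd.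
Qed.

Lemma normal_prob_scale c s A : c != 0 -> s != 0 -> measurable A ->
  normal_prob 0 (`|c| * s) A = normal_prob 0 s [set y | A (c * y)].
Proof.
move=> c0 s0 mA; rewrite /normal_prob [LHS]integral_mkcond.
rewrite (@integral_affine _ c 0)//; last exact: measurable_pdf_restrict.
rewrite [RHS]integral_mkcond -ge0_integralZl//; last first.
  have mg : measurable_fun setT (fun x : R => c * x + 0).
    by apply: measurable_funD => //; apply: measurable_funM.
  pose h := ((fun x => (normal_pdf 0 (`|c| * s) x)%:E) \_ A).
  have mh : measurable_fun setT h by exact: measurable_pdf_restrict.
  have mhg : measurable_fun setT (fun x : R => h (c * x + 0)) by exact: measurableT_comp mh mg.
  refine mhg.
apply: eq_integral => y _; rewrite !patchE addr0.
have -> : (y \in [set y0 | A (c * y0)]) = (c * y \in A).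
  by apply/idP/idP; rewrite !inE.
case: ifP => _; last by rewrite mule0.
have nc0 : `|c| != 0 by rewrite normr_eq0.
rewrite -EFinM; congr EFin.
rewrite !normal_pdfE ?mulf_neq0// /normal_fun !subr0 /normal_peak.
have -> : (`|c| * s) ^+ 2 * pi *+ 2 = c ^+ 2 * (s ^+ 2 * pi *+ 2).
  by rewrite exprMn real_normK ?num_real//; ring.
have sqM (K : R) : Num.sqrt (c ^+ 2 * K) = `|c| * Num.sqrt K.
  by rewrite sqrtrM ?sqr_ge0// sqrtr_sqr.
rewrite sqM invfM mulrA mulrA divff// mul1r; congr (_ * expR _).
have -> : (`|c| * s) ^+ 2 = c ^+ 2 * s ^+ 2 by rewrite exprMn real_normK ?num_real.
by field; rewrite c0 s0.
Qed.

Let pdf_pos m s x : s != 0 ->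
  normal_pdf m s x = (Num.sqrt (s ^+ 2 * pi *+ 2))^-1 * expR (- (x - m) ^+ 2 / (s ^+ 2 *+ 2)).
Proof. by move=> s0; rewrite normal_pdfE. Qed.

Lemma normal_prob_translate b s A : s != 0 -> measurable A ->
  normal_prob 0 s [set x | A (x + b)] = (\int[mu]_(z in A) (normal_pdf b s z)%:E)%E.
Proof.
move=> s0 mA; rewrite /normal_prob [LHS]integral_mkcond [RHS]integral_mkcond.
rewrite [RHS](@integral_affine _ 1 b)//; last exact: measurable_pdf_restrict.
rewrite normr1 mul1e; apply: eq_integral => x _; rewrite !patchE mul1r.
have -> : (x \in [set x | A (x + b)]) = (x + b \in A) by apply/idP/idP; rewrite !inE.
by case: ifP => // _; congr EFin; rewrite !pdf_pos// subr0 addrK.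
Qed.

Let pdf_center m s x : s != 0 -> normal_pdf m s x = normal_pdf 0 s (x - m).
Proof. by move=> s0; rewrite !pdf_pos// subr0. Qed.

(* Completing the square. *)
Lemma normal_pdf_product v s c z y : 0 < v -> s != 0 ->
  let w := v + c ^+ 2 * s ^+ 2 in
  normal_pdf (c * y) (Num.sqrt v) z * normal_pdf 0 s y =
  normal_pdf 0 (Num.sqrt w) z *
  normal_pdf (c * s ^+ 2 * z / w) (Num.sqrt (v * s ^+ 2 / w)) y.
Proof.
move=> v0 s0 w.
have s20 : 0 < s ^+ 2 by rewrite exprn_even_gt0.
have w0 : 0 < w by rewrite ltr_wpDr// mulr_ge0 ?sqr_ge0.
have t0 : 0 < v * s ^+ 2 / w by rewrite divr_gt0// mulr_gt0.
have sq x : 0 < x -> Num.sqrt x ^+ 2 = x by move=> x0; rewrite sqr_sqrtr// ltW.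
have sn x : 0 < x -> Num.sqrt x != 0 by move=> x0; rewrite gt_eqF// sqrtr_gt0.
rewrite !pdf_pos ?sn// !sq//.
have peak (x x' : R) : 0 < x -> 0 < x' ->
    (Num.sqrt (x * pi *+ 2))^-1 * (Num.sqrt (x' * pi *+ 2))^-1 =
    (Num.sqrt (x * x' * (pi *+ 2) ^+ 2))^-1.
  move=> x0 x'0; rewrite -invfM -sqrtrM; last first.
    by rewrite mulrn_wge0// mulr_ge0 ?pi_ge0// ltW.
  by congr (Num.sqrt _)^-1; ring.
rewrite mulrACA peak// -expRD [RHS]mulrACA peak// -expRD.
congr ((Num.sqrt _)^-1 * expR _).
  by field; rewrite gt_eqF.
rewrite /w; field.
have w1 : v + (c * s) ^+ 2 != 0 by rewrite exprMn gt_eqF.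
by rewrite w1 s0 (gt_eqF v0).
Qed.

(* normal_prob 0 0 is the uniform law on [0, 1], so the case v = 0 is set apart. *)
Definition gauss v : probability (measurableTypeR R) R :=
  if v == 0 then (dirac (0 : measurableTypeR R) : probability _ R)
  else (normal_prob 0 (Num.sqrt v) : probability _ R).

(** [normal_pdf_product] factors the joint density into the marginal of [z] and a normal density in
    [y] whose mean depends on [z]. By Tonelli the latter integrates to one for every [z]. The Dirac
    case [v = 0] reduces to scaling, or to a Dirac mass again when [c = 0]. *)
Lemma gauss_convolution v c s A : 0 <= v -> s != 0 -> measurable A ->
  (\int[normal_prob 0 s]_y gauss v [set x | A (x + c * y)%R] = gauss (v + c ^+ 2 * s ^+ 2) A)%E.
Proof.
move=> v0 s0 mA.
have mAc : measurable [set y | A (c * y)].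
  by apply: preimage_measurable mA; apply: measurable_funM.
have [->|vn0] := eqVneq v 0.
  rewrite add0r /gauss eqxx mulf_eq0 !sqrf_eq0 (negbTE s0) orbF.
  transitivity (normal_prob 0 s [set y | A (c * y)]).
    rewrite [RHS](_ : _ = \int[normal_prob 0 s]_y (\1_[set y | A (c * y)%R] y)%:E)%E; last first.
      by rewrite integral_indic// setIT.
    apply: eq_integral => y _; rewrite /= diracE indicE; congr ((nat_of_bool _)%:R%:E).
    by apply/idP/idP; rewrite !inE /= add0r.
  case: ifPn => [/eqP ->|c0].
    have [A0|nA0] := pselect (A 0).
      rewrite /= diracE mem_set// (_ : [set y | _] = setT) ?probability_setT//.
      by apply/seteqP; split=> y //= _; rewrite mul0r.
    rewrite /= diracE memNset// (_ : [set y | _] = set0) ?measure0//.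
    by apply/seteqP; split=> y //=; rewrite mul0r.
  have sq0 : Num.sqrt (c ^+ 2 * s ^+ 2) != 0.
    by rewrite gt_eqF// sqrtr_gt0 mulr_gt0 ?exprn_even_gt0.
  have nn : 0 <= c ^+ 2 * s ^+ 2 by rewrite mulr_ge0 ?sqr_ge0.
  have E : Num.sqrt (c ^+ 2 * s ^+ 2) ^+ 2 = (`|c| * s) ^+ 2.
    by rewrite (sqr_sqrtr nn) [RHS]exprMn real_normK ?num_real.
  rewrite -(normal_prob_scale c0)// /= /normal_prob; apply: eq_integral => x _.
  by rewrite !pdf_pos// ?mulf_neq0 ?normr_eq0// E.
have vp : 0 < v by rewrite lt_neqAle eq_sym vn0.
pose w := v + c ^+ 2 * s ^+ 2.
have w0 : 0 < w by rewrite ltr_wpDr// mulr_ge0 ?sqr_ge0.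
have svn : Num.sqrt v != 0 by rewrite gt_eqF// sqrtr_gt0.
have swn : Num.sqrt w != 0 by rewrite gt_eqF// sqrtr_gt0.
rewrite /gauss (negbTE vn0) -/w gt_eqF//=.
pose g z y := (((fun z => (normal_pdf 0 (Num.sqrt w) z)%:E) \_ A) z *
  (normal_pdf (c * s ^+ 2 * z / w) (Num.sqrt (v * s ^+ 2 / w)) y)%:E)%E.
have Eg y : (normal_prob 0 (Num.sqrt v) [set x | A (x + c * y)%R] * (normal_pdf 0 s y)%:E
    = \int[mu]_z g z y)%E.
  rewrite normal_prob_translate// muleC integral_mkcond.
  rewrite -(lebesgue_integralZl (normal_pdf_ge0 _ _ _) (measurable_pdf_restrict _ _ mA)
    (pdf_restrict_ge0 _ _ A)).
  apply: eq_integral => z _; rewrite /g !patchE; case: ifP => _; last by rewrite mule0 mul0e.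
  by rewrite -!EFinM mulrC normal_pdf_product.
have mE : measurable [set p : measurableTypeR R * measurableTypeR R | A (p.2 + c * p.1)].
  rewrite -[X in measurable X]setTI.
  have mf : measurable_fun setT (fun p : measurableTypeR R * measurableTypeR R => p.2 + c * p.1).
    apply: measurable_funD; first exact: measurable_snd.
    by apply: measurable_funM => //; exact: measurable_fst.
  exact: mf.
pose L : {sigma_finite_measure set (measurableTypeR R) -> \bar R} := normal_prob 0 (Num.sqrt v).
have secE y : [set x | A (x + c * y)] =
    xsection [set p : measurableTypeR R * measurableTypeR R | A (p.2 + c * p.1)] y.
  by apply/seteqP; split=> x; rewrite /xsection /= inE.
pose tau := Num.sqrt (v * s ^+ 2 / w).
have tau0 : tau != 0.
  by rewrite gt_eqF// sqrtr_gt0 divr_gt0// mulr_gt0// exprn_even_gt0.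
rewrite (@integral_density _ _ _ mu _ (normal_pdf 0 s))//; first last.
- under eq_fun do rewrite secE.
  exact: (measurable_fun_xsection L mE).
- by move=> x; exact: normal_pdf_ge0.
- exact: measurable_normal_pdf.
under eq_integral do rewrite Eg.
pose ka := c * s ^+ 2 / w.
have Egt z y : g z y = (((fun z => (normal_pdf 0 (Num.sqrt w) z)%:E) \_ A) z *
    (normal_pdf 0 tau (y - ka * z))%:E)%E.
  have e : c * s ^+ 2 * z / w = ka * z by rewrite /ka mulrAC.
  by rewrite /g e -/tau (pdf_center _ _ tau0).
under eq_integral do under eq_integral do rewrite Egt.
rewrite (@tonelli_kernel _ (fun p => normal_pdf 0 tau (p.1 - ka * p.2))
  (measurable_pdf_restrict _ _ mA) (pdf_restrict_ge0 _ _ A)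
  (measurable_pdf_line tau ka) (fun p => normal_pdf_ge0 _ _ _)).
rewrite /= /normal_prob [RHS]integral_mkcond; apply: eq_integral => z _.
rewrite (_ : (\int[mu]_y (normal_pdf 0 tau (y - ka * z))%:E = 1)%E) ?mule1//.
rewrite -(integral_normal_pdf (ka * z) tau); apply: eq_integral => y _.
by rewrite -(pdf_center _ _ tau0).
Qed.

End gaussian_convolution.

Section gaussian_sums.
Context d (T : measurableType d) {R : realType}.
Implicit Types (v c s r : R) (A : set R) (U V : T -> R).

(** [Q] has total mass [r] instead of one so that it can be a probability restricted to an event
    about other variables. After division by [r], uniqueness of the product measure identifies the
    joint law of [V] and [U]; mass zero is treated apart. *)
Lemma linear_law_step (Q : {measure set T -> \bar R}) U V v s c r :
  measurable_fun setT U -> measurable_fun setT V -> 0 <= v -> s != 0 -> 0 <= r ->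
  (forall A B, measurable A -> measurable B ->
    Q (U @^-1` A `&` V @^-1` B) = (r%:E * (gauss v A * normal_prob 0 s B))%E) ->
  forall A, measurable A ->
    Q [set w | A (U w + c * V w)] = (r%:E * gauss (v + c ^+ 2 * s ^+ 2) A)%E.
Proof.
move=> mU mV v0 s0 r0 H A mA.
have mUV : measurable_fun setT (fun w => U w + c * V w).
  by apply: measurable_funD => //; apply: measurable_funM.
have [rE|rn0] := eqVneq r 0.
  have Q0 : Q setT = 0%E.
    have := H setT setT measurableT measurableT.
    by rewrite !preimage_setT setIT rE mul0e.
  rewrite rE mul0e; apply/eqP; rewrite eq_le measure_ge0 andbT -Q0.
  apply: le_measure; rewrite ?inE//.
  by rewrite -[X in measurable X]setTI; exact: mUV.
pose phi w : measurableTypeR R * measurableTypeR R := (V w, U w).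
have mphi : measurable_fun setT phi by apply: measurable_fun_pair.
have ri0 : 0 <= r^-1 by rewrite invr_ge0.
pose E : set (measurableTypeR R * measurableTypeR R) := [set p | A (p.2 + c * p.1)].
have mE : measurable E.
  rewrite -[X in measurable X]setTI.
  have mf : measurable_fun setT (fun p : measurableTypeR R * measurableTypeR R => p.2 + c * p.1).
    apply: measurable_funD; first exact: measurable_snd.
    by apply: measurable_funM => //; exact: measurable_fst.
  exact: mf.
pose N : probability (measurableTypeR R) R := normal_prob 0 s.
have W : (N \x gauss v)%E E = ((r^-1)%:E * Q (phi @^-1` E))%E.
  apply: (@product_measure_unique _ _ _ _ R N (gauss v)
    (mscale (NngNum ri0) (pushforward Q phi)) _ _ mE) => X Y mX mY.
  transitivity ((r^-1)%:E * Q (U @^-1` Y `&` V @^-1` X))%E.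
    by congr (_ * Q _)%E; apply/seteqP; split=> w [].
  by rewrite H// muleA -EFinM mulVf// mul1e muleC.
have -> : [set w | A (U w + c * V w)] = phi @^-1` E by [].
rewrite -[LHS]mul1e -(divff rn0) EFinM -muleA -W; congr (_ * _)%E.
rewrite -(@gauss_convolution _ v c s A v0 s0 mA).
apply: eq_integral => y _ /=; congr (gauss v _).
by apply/seteqP; split=> x; rewrite /xsection /= inE.
Qed.

Let cyl n (X : nat -> T -> R) (C : nat -> set R) : set T :=
  [set w | forall i, (i < n)%N -> C i (X i w)].

Let measurable_cyl n X C : (forall i, measurable_fun setT (X i)) ->
  (forall i, measurable (C i)) -> measurable (cyl n X C).
Proof.
move=> mX mC; have -> : cyl n X C = \bigcap_(i < n) (X i @^-1` C i) by [].
apply: bigcap_measurableType => i _.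
by rewrite -[Y in measurable Y]setTI; exact: mX.
Qed.

Lemma prod_probability_fin n (s : nat -> R) (C : nat -> set R) :
  (forall i, measurable (C i)) ->
  exists2 r, 0 <= r & (\prod_(i < n) normal_prob 0 (s i) (C i))%E = r%:E.
Proof.
move=> mC; elim/big_ind : _ => [|x y [r r0 ->] [r' r'0 ->]|i _].
- by exists 1.
- by exists (r * r'); rewrite ?mulr_ge0.
- exists (fine (normal_prob 0 (s i) (C i))); first exact: fine_ge0.
  rewrite fineK//.
  exact: (@fin_num_measure _ _ _ (normal_prob 0 (s i) : probability (measurableTypeR R) R) _ (mC i)).
Qed.

(** Induction with [U] as accumulator: [c 0 * X 0] is moved into [U] and its variance into [v]. The
    product rule for the new [U] is [linear_law_step] applied to [Q] restricted to a cylinder over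
    the remaining variables. *)
Lemma gauss_linear_combination n (Q : {measure set T -> \bar R}) (X : nat -> T -> R)
    (c s : nat -> R) U v :
  measurable_fun setT U -> (forall i, measurable_fun setT (X i)) -> 0 <= v ->
  (forall i, (i < n)%N -> s i != 0) ->
  (forall A (C : nat -> set R), measurable A -> (forall i, measurable (C i)) ->
    Q (U @^-1` A `&` cyl n X C) = (gauss v A * \prod_(i < n) normal_prob 0 (s i) (C i))%E) ->
  forall A, measurable A ->
    Q [set w | A (U w + \sum_(i < n) c i * X i w)] =
    gauss (v + \sum_(i < n) c i ^+ 2 * s i ^+ 2) A.
Proof.
elim: n X c s U v => [|n IH] X c s U v mU mX v0 sn H A mA.
  have := H A (fun=> setT) mA (fun=> measurableT).
  rewrite !big_ord0 mule1 addr0 => <-; congr (Q _); apply/seteqP; split=> w /=.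
    by rewrite big_ord0 addr0.
  by rewrite big_ord0 addr0 => -[].
rewrite big_ord_recl addrA.
have -> : [set w | A (U w + \sum_(i < n.+1) c i * X i w)] =
    [set w | A ((U w + c 0%N * X 0%N w) + \sum_(i < n) c i.+1 * X i.+1 w)].
  by apply/seteqP; split=> w /=; rewrite big_ord_recl addrA.
have mU' : measurable_fun setT (fun w => U w + c 0%N * X 0%N w).
  by apply: measurable_funD => //; apply: measurable_funM.
apply: (IH (fun i => X i.+1) (fun i => c i.+1) (fun i => s i.+1)) => //.
- by rewrite addr_ge0// mulr_ge0 ?sqr_ge0.
- by move=> i ni; exact: sn.
move=> B C mB mC.
have [r r0 rE] := prod_probability_fin n (fun i => s i.+1) mC.
rewrite rE muleC.
have mR : measurable (cyl n (fun i => X i.+1) C) by exact: measurable_cyl.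
have := @linear_law_step (mrestr Q mR) U (X 0%N) v (s 0%N) (c 0%N) r mU (mX 0%N) v0 (sn 0%N isT) r0.
apply=> // A1 A2 mA1 mA2.
rewrite -[LHS]/(Q (U @^-1` A1 `&` X 0%N @^-1` A2 `&` cyl n (fun i => X i.+1) C)).
have := H A1 (fun i => if i is j.+1 then C j else A2) mA1.
rewrite big_ord_recl /= rE => H'.
rewrite [RHS]muleC -muleA -H'; last by case.
rewrite -setIA; congr (Q (_ `&` _)); apply/seteqP; split=> w.
  by move=> [w0 wC] [|i]//= ni; exact: wC.
by move=> wC; split=> [|i ni]; [exact: (wC 0%N)|exact: (wC i.+1)].
Qed.

End gaussian_sums.

Section brownian_sums.
Context (R : realType) d (T : measurableType d) (P : probability T R) (B : R -> T -> R).
Hypothesis BM : standard_brownian_motion P B.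

Lemma brownian_linear_combination n (u c : nat -> R) : 0 <= u 0%N ->
  (forall i, u i < u i.+1) -> forall A, measurable A ->
  P [set w | A (\sum_(i < n) c i * (B (u i.+1) w - B (u i) w))] =
  gauss (\sum_(i < n) c i ^+ 2 * (u i.+1 - u i)) A.
Proof.
move=> u0 u_lt A mA; have [mB _ indep incr _] := BM.
have u_homo : {homo u : i j / (i <= j)%N >-> i <= j}.
  by apply: homo_leq => [//|x y z|i]; [exact: le_trans|exact: ltW].
have u_ge0 i : 0 <= u i by rewrite (le_trans u0)// u_homo.
pose X i w := B (u i.+1) w - B (u i) w.
have mX i : measurable_fun setT (X i) by apply: measurable_funB; exact: mB.
(* The accumulator starts as the constant 0, with the Dirac law [gauss 0]. *)
have := @gauss_linear_combination _ T R n P X c (fun i => Num.sqrt (u i.+1 - u i)) (cst 0) 0.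
have -> : 0 + \sum_(i < n) c i ^+ 2 * Num.sqrt (u i.+1 - u i) ^+ 2 =
    \sum_(i < n) c i ^+ 2 * (u i.+1 - u i).
  by rewrite add0r; apply: eq_bigr => i _; rewrite sqr_sqrtr// subr_ge0 ltW.
have -> : [set w | A (\sum_(i < n) c i * X i w)] =
    [set w | A (cst 0 w + \sum_(i < n) c i * X i w)].
  by apply/seteqP; split=> w /=; rewrite add0r.
apply=> //.
  by move=> i _; rewrite gt_eqF// sqrtr_gt0 subr_gt0.
move=> A' C mA' mC; rewrite /gauss eqxx /= diracE.
have PC : P [set w | forall i, (i < n)%N -> C i (X i w)] =
    (\prod_(i < n) normal_prob 0 (Num.sqrt (u i.+1 - u i)) (C i))%E.
  have := indep n u u0 u_homo (fun i : 'I_n => C i) (fun i => mC i).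
  rewrite (_ : \bigcap_i _ = [set w | forall i, (i < n)%N -> C i (X i w)]); last first.
    apply/seteqP; split=> w /= h i.
      by move=> ni; exact: (h (Ordinal ni) I).
    by move=> _; exact: h.
  by move=> ->; apply: eq_bigr => i _; rewrite incr.
have [A0|nA0] := pselect (A' 0).
  rewrite mem_set// mul1e -PC; congr (P _); apply/seteqP; split=> w; first by case.
  by move=> h; split.
rewrite memNset// mul0e (_ : _ `&` _ = set0) ?measure0//.
by apply/seteqP; split=> w //= [].
Qed.

End brownian_sums.

(** * Riemann-Stieltjes sums *)

Section riemann_sums.
Context {R : realType}.
Implicit Types (f g F : R -> R) (a b x y t : R).

Lemma continuous_uniform_itv f a b (de : R) : continuous f -> 0 < de ->
  exists2 eta, 0 < eta & forall x y, a <= x <= b -> `|x - y| < eta -> `|f x - f y| < de.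
Proof.
move=> cf de0.
have /compact_near_coveringP cpt : compact (`[a, b]%classic : set R) by exact: segment_compact.
pose P (e x : R) := forall y, `|x - y| < e -> `|f x - f y| < de.
have : \forall e \near (0 : R)^'+, `[a, b]%classic `<=` P e.
  apply: cpt => x _.
  have /cvgrPdist_lt /(_ (de / 2)) := cf x; rewrite divr_gt0// => /(_ isT) [r /= r0 Hr].
  have r20 : 0 < r / 2 by rewrite divr_gt0.
  exists (ball x (r / 2), [set e | e < r / 2]) => /=.
    split; first exact: nbhsx_ballx.
    exact: nbhs_right_lt.
  move=> [z e] /= [xz er] y zy.
  have h1 : `|f x - f z| < de / 2.
    by apply: Hr => /=; move: xz; rewrite /ball/= => xz; lra.
  have h2 : `|f x - f y| < de / 2.
    apply: Hr => /=; move: xz; rewrite /ball/= => xz.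
    by have := ler_distD z x y; lra.
  by have := ler_distD (f x) (f z) (f y); rewrite (distrC (f z) (f x)); lra.
move=> H; near (0 : R)^'+ => e.
exists e; first by near: e; exact: nbhs_right_gt.
move=> x y xab; have := near H e _; apply => //=.
Unshelve. all: end_near. Qed.

Definition mesh a b (n i : nat) : R := a + (b - a) / n.+1%:R * i%:R.

Lemma mesh0 a b n : mesh a b n 0 = a.
Proof. by rewrite /mesh mulr0 addr0. Qed.

Lemma meshn a b n : mesh a b n n.+1 = b.
Proof. by rewrite /mesh divfK ?pnatr_eq0//; ring. Qed.

Lemma mesh_step a b n i : mesh a b n i.+1 - mesh a b n i = (b - a) / n.+1%:R.
Proof. by rewrite /mesh -[i.+1%:R]natr1; ring. Qed.

Lemma mesh_le a b n i j : a <= b -> (i <= j)%N -> mesh a b n i <= mesh a b n j.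
Proof.
move=> ab ij; rewrite lerD2l ler_wpM2l ?ler_nat//.
by rewrite divr_ge0 ?subr_ge0.
Qed.

Lemma mesh_cvg0 a b : (b - a) / n.+1%:R @[n --> \oo] --> (0 : R).
Proof.
rewrite -(mulr0 (b - a)); apply: cvgMl_tmp; exact: cvg_harmonic.
Qed.

(** On one cell [F - f (xi n i) * g] has derivative [(f t - f (xi n i)) * g1 t], which is uniformly
    small, so the mean value inequality bounds the error of that cell. The integral enters only
    through a primitive [F]; this serves [J], its variance and the weighted noise alike. *)
Lemma riemann_stieltjes_cvg a b f g g1 F K (xi : nat -> nat -> R) : a <= b -> continuous f ->
  (forall t, has_derive g t (g1 t)) -> (forall t, a <= t <= b -> `|g1 t| <= K) ->
  {within `[a, b], continuous F} ->
  (forall t, a < t < b -> has_derive F t (f t * g1 t)) ->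
  (forall n i, (i <= n)%N -> mesh a b n i <= xi n i <= mesh a b n i.+1) ->
  \sum_(i < n.+1) f (xi n i) * (g (mesh a b n i.+1) - g (mesh a b n i)) @[n --> \oo]
    --> F b - F a.
Proof.
move=> ab cf dg g1K cF dF xiP.
have K0 : 0 <= K by apply: le_trans (g1K a _) => //; rewrite lexx.
apply/cvgrPdist_le => e e0.
pose M := K * (b - a) + 1.
have M0 : 0 < M by rewrite ltr_wpDl// mulr_ge0 ?subr_ge0.
pose de := e / M; have de0 : 0 < de by rewrite divr_gt0.
have [eta eta0 Heta] := continuous_uniform_itv a b cf de0.
have : \forall n \near \oo, `|0 - (b - a) / n.+1%:R| < eta.
  by have /cvgrPdist_lt := mesh_cvg0 a b; apply.
apply: filterS => n; rewrite sub0r normrN => hn.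
have h0 : 0 <= (b - a) / n.+1%:R by rewrite divr_ge0 ?subr_ge0.
rewrite ger0_norm// in hn.
have -> : F b - F a = \sum_(i < n.+1) (F (mesh a b n i.+1) - F (mesh a b n i)).
  rewrite -(big_mkord xpredT (fun i => F (mesh a b n i.+1) - F (mesh a b n i))).
  by rewrite (telescope_sumr (fun i => F (mesh a b n i)))// meshn mesh0.
rewrite -sumrB.
apply: (le_trans (ler_norm_sum _ _ _)).
apply: (@le_trans _ _ (\sum_(i < n.+1) de * K * ((b - a) / n.+1%:R))); last first.
  rewrite sumr_const card_ord -[leLHS]mulr_natr -!mulrA mulVf ?pnatr_eq0// mulr1.
  rewrite [M^-1 * _]mulrC mulrA ler_pdivrMr// ler_pM2l//.
  by rewrite /M lerDl.
apply: ler_sum => i _.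
have ni : (i <= n)%N by rewrite -ltnS.
set p0 := mesh a b n i; set p1 := mesh a b n i.+1.
have p01 : p0 <= p1 by apply: mesh_le.
have ap0 : a <= p0 by rewrite -{1}(mesh0 a b n) mesh_le.
have p1b : p1 <= b by rewrite -(meshn a b n) mesh_le.
have /andP[x0 x1] := xiP n i ni; set x := xi n i in x0 x1 *.
rewrite -/p0 -/p1 in x0 x1.
have sub : `[p0, p1] `<=` (`[a, b] : set R).
  by move=> z /=; rewrite !in_itv/= => /andP[z0 z1]; rewrite (le_trans ap0)// (le_trans z1).
have -> : F p1 - F p0 - f x * (g p1 - g p0) = (F p1 - f x * g p1) - (F p0 - f x * g p0).
  by ring.
rewrite -(mesh_step a b n i) -/p0 -/p1.
apply: (@mvt_dist _ (fun t => F t - f x * g t) (fun t => (f t - f x) * g1 t) _ _ _ p01).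
- move=> t /andP[t0 t1].
  have d1 : is_derive t 1 F (f t * g1 t).
    by apply: dF; rewrite (le_lt_trans ap0)// (lt_le_trans t1).
  have d2 : is_derive t 1 g (g1 t) := dg t.
  by rewrite /has_derive; der_auto; ring.
- have cF' := continuous_subspaceW sub cF.
  have cg : continuous g := continuous_is_derive dg.
  move=> t; apply: cvgB; first exact: cF'.
  apply: cvgM; first exact: cvg_cst.
  by apply: (@continuous_subspaceT _ _ _ g).
- move=> t /andP[t0 t1]; rewrite normrM ler_pM//.
    apply/ltW/Heta; first by rewrite (le_trans ap0 (ltW t0)) (le_trans (ltW t1) p1b).
    have st : p1 - p0 < eta by rewrite /p1 /p0 mesh_step.
    clearbody p0 p1 x; rewrite ltr_norml.
    by apply/andP; split; lra.
  by apply: g1K; rewrite (le_trans ap0 (ltW t0)) (le_trans (ltW t1) p1b).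
Qed.

End riemann_sums.

(** * The normal distribution function *)

Section normal_cdf.
Context {R : realType}.
Notation mu := (@lebesgue_measure R).
Implicit Types (x y v s : R).

Let phi : R -> R := normal_pdf 0 1.

Let phiE x : phi x = (normal_peak 1) * expR (- (x ^+ 2 / 2)).
Proof. by rewrite /phi normal_pdfE ?oner_neq0// /normal_fun subr0 expr1n mulNr. Qed.

Let phi_tame : tame phi.
Proof.
split; first by apply: continuous_normal_pdf; exact: oner_neq0.
exists (normal_peak 1 * 2) => x; rewrite ger0_norm ?normal_pdf_ge0// phiE -[leRHS]mulrA.
apply: ler_wpM2l; first exact: normal_peak_ge0.
have o0 : 0 < oneDsqr x by rewrite (lt_le_trans ltr01)// oneDsqr_ge1.
rewrite expRN ler_pdivlMr// mulrC ler_pdivrMr ?expR_gt0//.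
have := expR_ge1Dx (x ^+ 2 / 2); have := sqr_ge0 x; rewrite /oneDsqr; lra.
Qed.

Definition normal_cdf x : R := prim phi x.

Lemma normal_cdf_derive x : is_derive x 1 normal_cdf (phi x).
Proof. exact: is_derive_prim. Qed.

Lemma normal_cdf_continuous : continuous normal_cdf.
Proof. exact: continuous_is_derive normal_cdf_derive. Qed.

Lemma normal_cdf_cvgy : normal_cdf x @[x --> +oo] --> (1 : R).
Proof.
have := prim_cvgy phi_tame.
by rewrite /total /Rintegral integral_normal_pdf.
Qed.

Lemma normal_cdfN x : normal_cdf (- x) = 1 - normal_cdf x.
Proof.
have H y : normal_cdf (- y) + normal_cdf y = normal_cdf (- 0) + normal_cdf 0.
  apply: (@derive0_const _ (fun y => normal_cdf (- y) + normal_cdf y)) => z.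
  have d0 : is_derive z 1 (fun t : R => - t) (-1) by der_auto; ring.
  have d1 := der_comp d0 (normal_cdf_derive (- z)); have d2 := normal_cdf_derive z.
  rewrite /has_derive; der_auto.
  by rewrite !phiE sqrrN; ring.
have l1 : normal_cdf (- y) + normal_cdf y @[y --> +oo] --> (0 + 1 : R).
  apply: cvgD normal_cdf_cvgy.
  by have := prim_cvgNy phi_tame; rewrite cvgNy_compNP.
have e : normal_cdf (- 0) + normal_cdf 0 = 1.
  apply: (@cvg_real_unique R +oo _ (fun=> normal_cdf (- 0) + normal_cdf 0)).
    exact: cvg_cst.
  by move: l1; under eq_fun do rewrite H; rewrite add0r.
by have := H x; rewrite e; lra.
Qed.

Lemma normal_cdf0 : normal_cdf 0 = 2^-1.
Proof. by have := normal_cdfN 0; rewrite oppr0; lra. Qed.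

Lemma normal_prob_cdf x : normal_prob 0 1 `]-oo, x] = (normal_cdf x)%:E.
Proof.
rewrite /normal_cdf /prim /Rintegral fineK//.
apply: (@integrable_fin_num _ _ _ mu) => //.
by apply: integrableS (tame_integrable phi_tame).
Qed.

Lemma gauss_gt v y : 0 < v -> gauss v `]y, +oo[%classic = (normal_cdf (- (y / Num.sqrt v)))%:E.
Proof.
move=> v0; have s0 : 0 < Num.sqrt v by rewrite sqrtr_gt0.
rewrite /gauss gt_eqF//=.
have -> : Num.sqrt v = `|Num.sqrt v| * 1 by rewrite mulr1 gtr0_norm.
rewrite normal_prob_scale ?oner_neq0 ?gt_eqF//.
have -> : [set z | `]y, +oo[%classic (Num.sqrt v * z)] = ~` `]-oo, y / Num.sqrt v]%classic.
  apply/seteqP; split=> z; rewrite /= !in_itv/= andbT.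
    by move=> h; apply/negP; rewrite -ltNge ltr_pdivrMr// mulrC.
  by move=> /negP; rewrite -ltNge ltr_pdivrMr// mulrC.
rewrite mulr1 gtr0_norm//.
rewrite (@probability_setC _ _ _ (normal_prob 0 1 : probability (measurableTypeR R) R))//.
by rewrite [X in (_ - X)%E]normal_prob_cdf normal_cdfN.
Qed.

End normal_cdf.

(** * One-sided passage to the limit in tail probabilities *)

Section tail_limit.
Context d (T : measurableType d) (R : realType) (P : probability T R).
Implicit Types (y de v : R).

(** Reverse Fatou for events: the unions over [n <= j] decrease to the limsup, and each has
    probability at least that of every later [A m]. *)
Lemma lim_sup_set_lower_bound (A : nat -> set T) (c : \bar R) (k : nat -> R) (l : R) :
  (forall n, measurable (A n)) -> k n @[n --> \oo] --> l ->
  (\forall n \near \oo, ((k n)%:E <= P (A n))%E) -> (l%:E <= P (lim_sup_set A))%E.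
Proof.
move=> mA kl kA.
have mU n : measurable (\bigcup_(j in [set j | (n <= j)%N]) A j) by exact: bigcup_measurable.
have H := @lim_sup_set_cvg _ _ _ P A mA _.
have {}H : P (\bigcup_(j in [set j | (n <= j)%N]) A j) @[n --> \oo] --> P (lim_sup_set A).
  by apply: H; apply: le_lt_trans (probability_le1 _ (mU 0%N)) _; rewrite ltry.
have fP n : P (\bigcup_(j in [set j | (n <= j)%N]) A j) \is a fin_num by exact: fin_num_measure.
have mL : measurable (lim_sup_set A) by apply: bigcap_measurableType => n _; exact: mU.
rewrite -(@fineK _ (P (lim_sup_set A))) ?fin_num_measure// lee_fin.
have {}H : fine (P (\bigcup_(j in [set j | (n <= j)%N]) A j)) @[n --> \oo] -->
    fine (P (lim_sup_set A)).
  by apply: fine_cvg; rewrite fineK ?fin_num_measure.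
apply: (cvg_ge_near _ H); apply: nearW => n.
apply: (cvg_le_near _ kl).
near=> m; have nm : (n <= m)%N by near: m; exact: nbhs_infty_ge.
rewrite -lee_fin fineK//; apply: (@le_trans _ _ (P (A m))); first by near: m.
by apply: le_measure; rewrite ?inE//; exact: bigcup_sup.
Unshelve. all: end_near. Qed.

(** If [X n w] exceeds [y + de] infinitely often, its limit is at least [y + de], hence above [y],
    and [E] holds. The margin [de] then tends to 0 by continuity of [normal_cdf]. Lower bounds
    suffice as input, so the lemma can be used twice: from finite sums to [J t0], and from [J] at
    integer times to the escape event. *)
Lemma tail_limit (X : nat -> T -> R) (E : set T) (v : nat -> R) (l y : R) :
  (forall n, measurable_fun setT (X n)) -> measurable E -> 0 < l ->
  v n @[n --> \oo] --> l ->
  (forall z, \forall n \near \oo,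
    ((normal_cdf (- (z / Num.sqrt (v n))))%:E <= P [set w | (z < X n w)%R])%E) ->
  {ae P, forall w, exists x : R, X n w @[n --> \oo] --> x /\ (y < x -> E w)} ->
  ((normal_cdf (- (y / Num.sqrt l)))%:E <= P E)%E.
Proof.
move=> mX mE l0 vl tail aeX.
have sl : Num.sqrt (v n) @[n --> \oo] --> Num.sqrt l.
  by apply: (continuous_cvg _ (@sqrt_continuous R l)).
have slt0 : Num.sqrt l != 0 by rewrite gt_eqF// sqrtr_gt0.
have lim z : normal_cdf (- (z / Num.sqrt (v n))) @[n --> \oo] -->
    normal_cdf (- (z / Num.sqrt l)).
  apply: (continuous_cvg _ (@normal_cdf_continuous R _)).
  by apply: cvgN; apply: cvgMl_tmp; exact: cvgV.
have mA z n : measurable [set w | z < X n w].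
  have -> : [set w | z < X n w] = X n @^-1` `]z, +oo[%classic.
    by apply/seteqP; split=> w; rewrite /= in_itv/= andbT.
  by rewrite -[S in measurable S]setTI; exact: mX.
have step de : 0 < de -> ((normal_cdf (- ((y + de) / Num.sqrt l)))%:E <= P E)%E.
  move=> de0; pose A n := [set w | y + de < X n w].
  have H := @lim_sup_set_lower_bound A 0%E _ _ (mA (y + de)) (lim (y + de)) (tail (y + de)).
  apply: (le_trans H).
  have [N [mN PN sN]] := aeX.
  have mL : measurable (lim_sup_set A).
    by apply: bigcap_measurableType => n _; apply: bigcup_measurable => k _; exact: mA.
  apply: (@le_trans _ _ (P (E `|` N))); last first.
    have H2 : (P (E `|` N) <= P E + P N)%E := measureU2 P mE mN.
    have PN' : P N = 0%E := PN.
    by rewrite PN' adde0 in H2.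
  apply: le_measure; rewrite ?inE//; first exact: measurableU.
  move=> w Lw; have [Nw|nNw] := pselect (N w); [by right|left].
  have [x [Xx xE]] : exists x : R, X n w @[n --> \oo] --> x /\ (y < x -> E w).
    by apply: contrapT => h; apply: nNw; apply: sN.
  apply: xE; apply: (@lt_le_trans _ _ (y + de)); first by rewrite ltrDl.
  rewrite leNgt; apply/negP => xy.
  have [m _ Hm] := cvgr_lt _ Xx _ xy.
  have [k /= mk] := Lw m I.
  by rewrite /A /= ltNge ltW// Hm.
rewrite -(@fineK _ (P E)) ?fin_num_measure// lee_fin.
have c : normal_cdf (- ((y + de) / Num.sqrt l)) @[de --> (0 : R)^'+] -->
    normal_cdf (- ((y + 0) / Num.sqrt l)).
  apply: (continuous_cvg _ (@normal_cdf_continuous R _)).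
  apply: cvgN; apply: cvgMr_tmp; apply: cvgD; first exact: cvg_cst.
  exact: cvg_at_right_filter.
rewrite addr0 in c; apply: (cvg_le_near _ c); near=> de.
rewrite -lee_fin (@fineK _ (P E)) ?fin_num_measure//; apply: step.
by near: de; exact: nbhs_right_gt.
Unshelve. all: end_near. Qed.

End tail_limit.

(** * Almost sure integrability of the discounted noise *)

Section normal_first_moment.
Context {R : realType}.
Notation mu := (@lebesgue_measure R).

(** Pointwise comparison with a wider Gaussian: the absolute value of [x] times the density of
    deviation [s] is at most [4 * s] times the density of deviation [2 * s], whose mass is one. The
    exact constant is immaterial. *)
Lemma normal_abs_moment (s : R) : 0 < s ->
  (\int[normal_prob 0 s]_x (`|x|)%:E <= (4 * s)%:E)%E.
Proof.
move=> s0; have sn : s != 0 by rewrite gt_eqF.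
have s2n : 2 * s != 0 by rewrite mulf_neq0.
rewrite (@integral_density _ _ _ mu _ (normal_pdf 0 s))//; first last.
- by apply/measurable_EFinP; exact: normr_measurable.
- by move=> x; exact: normal_pdf_ge0.
- exact: measurable_normal_pdf.
apply: (@le_trans _ _ (\int[mu]_x ((4 * s)%:E * (normal_pdf 0 (2 * s) x)%:E))%E); last first.
  rewrite lebesgue_integralZl ?integral_normal_pdf ?mule1//.
  - by rewrite mulr_ge0// ltW.
  - by apply/measurable_EFinP; exact: measurable_normal_pdf.
  - by move=> x; rewrite lee_fin normal_pdf_ge0.
apply: ge0_le_integral => //.
- by move=> x _; rewrite mule_ge0// lee_fin ?normal_pdf_ge0.
- apply: emeasurable_funM; apply/measurable_EFinP; first exact: normr_measurable.
  exact: measurable_normal_pdf.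
- apply: emeasurable_funM; apply/measurable_EFinP => //.
  exact: measurable_normal_pdf.
move=> x _; rewrite -!EFinM lee_fin !normal_pdfE// /normal_fun subr0.
have -> : normal_peak (2 * s) = normal_peak s / 2.
  rewrite /normal_peak.
  have -> : (2 * s) ^+ 2 * pi *+ 2 = 2 ^+ 2 * (s ^+ 2 * pi *+ 2) by ring.
  by rewrite sqrtrM ?sqr_ge0// sqrtr_sqr gtr0_norm// invfM mulrC.
pose y := `|x| / s.
have xE : `|x| = y * s by rewrite /y divfK.
have x2 : x ^+ 2 = y ^+ 2 * s ^+ 2 by rewrite -exprMn -xE real_normK// num_real.
have e1 : - x ^+ 2 / (s ^+ 2 *+ 2) = - (y ^+ 2 * 3 / 8) - y ^+ 2 / 8.
  by rewrite x2; field.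
have e2 : - x ^+ 2 / ((2 * s) ^+ 2 *+ 2) = - (y ^+ 2 / 8).
  by rewrite x2; field.
rewrite e1 e2 expRD xE.
have E0 := expR_gt0 (- (y ^+ 2 / 8)); have p0 := normal_peak_gt0 sn.
have main : y * expR (- (y ^+ 2 * 3 / 8)) <= 2.
  rewrite expRN ler_pdivrMr ?expR_gt0//.
  have := expR_ge1Dx (y ^+ 2 * 3 / 8); have := sqr_ge0 y; have := sqr_ge0 (y - 1).
  by rewrite sqrrB mulr1 expr1n; lra.
rewrite (_ : y * s * _ = (normal_peak s * s * expR (- (y ^+ 2 / 8))) * (y * expR (- (y ^+ 2 * 3 / 8)))); last by ring.
rewrite (_ : 4 * s * _ = (normal_peak s * s * expR (- (y ^+ 2 / 8))) * 2); last by field.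
by rewrite ler_pM2l// !mulr_gt0.
Qed.

End normal_first_moment.

Lemma measurable_limn_einf d (T : measurableType d) (R : realType) (f : (T -> \bar R)^nat) :
  (forall n, measurable_fun setT (f n)) ->
  measurable_fun setT (fun x => limn_einf (f ^~ x)).
Proof.
move=> mf.
have -> : (fun x => limn_einf (f ^~ x)) = (fun x => - limn_esup ((fun n t => - f n t) ^~ x))%E.
  by apply/funext => x; rewrite -[in RHS]/(-%E \o (f ^~ x)) limn_esupN oppeK.
apply: measurableT_comp => //.
by apply: measurable_fun_limn_esup => n; exact: measurableT_comp.
Qed.

Section weighted_noise_bounded.
Context (R : realType) d (T : measurableType d) (P : probability T R) (B : R -> T -> R).
Hypothesis BM : standard_brownian_motion P B.
Hypothesis B0 : forall w, B 0 w = 0.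
Variable s : R.

Lemma brownian_abs_moment (u : R) : 0 < u ->
  (\int[P]_w (`|B u w|)%:E <= (4 * Num.sqrt u)%:E)%E.
Proof.
move=> u0; have [mB _ _ incr _] := BM.
have mBu : measurable_fun setT (B u : T -> measurableTypeR R) := mB u (ltW u0).
have mabs : measurable_fun setT (fun x : measurableTypeR R => (`|x|)%:E).
  by apply/measurable_EFinP; exact: normr_measurable.
have := @ge0_integral_pushforward _ _ _ _ R _ mBu P setT _ measurableT mabs (fun y _ => normr_ge0 y).
rewrite preimage_setT => E; rewrite -[leLHS](eq_trans E (erefl _)).
have s0 : 0 < Num.sqrt u by rewrite sqrtr_gt0.
apply: le_trans (normal_abs_moment s0).
rewrite le_eqVlt; apply/orP; left; apply/eqP.
apply: eq_measure_integral => A mA _.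
have := incr 0 u (lexx 0) u0 A mA; rewrite subr0; apply: etrans.
by rewrite /pushforward; congr (P _); apply/seteqP; split=> w /=; rewrite B0 subr0.
Qed.

Let path w t := freeze 0 (B ^~ w) (t - s).

(** Right endpoints keep every sampling time strictly after [s], as [brownian_abs_moment]
    requires. *)
Let xi (b : R) n i := mesh s b n i.+1.

Let rsum (b : R) n w : R :=
  \sum_(i < n.+1) expR (- xi b n i) * `|B (xi b n i - s) w| * ((b - s) / n.+1%:R).

Let xi_gt b n i : s < b -> s < xi b n i.
Proof.
move=> sb; rewrite /xi /mesh ltrDl mulr_gt0// divr_gt0// subr_gt0//.
Qed.

Let measurable_abs b n i : s < b -> measurable_fun setT (fun w => `|B (xi b n i - s) w|).
Proof.
move=> sb; have [mB _ _ _ _] := BM.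
apply: measurableT_comp; first exact: normr_measurable.
by apply: mB; rewrite subr_ge0 ltW// xi_gt.
Qed.

Let measurable_rsum b n : s < b -> measurable_fun setT (rsum b n).
Proof.
move=> sb; apply: measurable_sum => i.
apply: measurable_funM => //; apply: measurable_funM => //; exact: measurable_abs.
Qed.

Let rsum_ge0 b n w : s < b -> 0 <= rsum b n w.
Proof.
move=> sb; apply: sumr_ge0 => i _.
by rewrite mulr_ge0 ?divr_ge0 ?subr_ge0 ?(ltW sb)// mulr_ge0 ?expR_ge0.
Qed.

(** The bound must not depend on [b] or [n]. With [u = x - s], the first moment gives
    [4 * Num.sqrt u], the product [Num.sqrt u * expR (- (u / 2))] is at most 2, and the remaining
    [h * expR (- (u / 2))] is at most twice [e i - e i.+1], which telescopes; hence 16. *)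
Let rsum_expectation b n : s < b -> (\int[P]_w (rsum b n w)%:E <= (16 * expR (- s))%:E)%E.
Proof.
move=> sb; pose h := (b - s) / n.+1%:R.
have h0 : 0 < h by rewrite divr_gt0// subr_gt0.
under eq_integral do rewrite /rsum -sumEFin.
rewrite ge0_integral_sum//; last 2 first.
- move=> i; apply/measurable_EFinP; apply: measurable_funM => //; apply: measurable_funM => //.
  exact: measurable_abs.
- move=> i w _; rewrite lee_fin.
  by rewrite mulr_ge0 ?(ltW h0)// mulr_ge0 ?expR_ge0.
pose e i := expR (- ((mesh s b n i - s) / 2)).
apply: (@le_trans _ _ (\sum_(i < n.+1) (16 * expR (- s) * (e i - e i.+1))%:E)%E).
  apply: lee_sum => i _; set x := xi b n i.
  have sx : s < x by exact: xi_gt.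
  have k0 : 0 <= expR (- x) * h by rewrite mulr_ge0 ?expR_ge0// ltW.
  under eq_integral do rewrite mulrAC EFinM.
  rewrite ge0_integralZl//; last first.
    by apply/measurable_EFinP; exact: measurable_abs.
  have u0 : 0 < x - s by rewrite subr_gt0.
  apply: (@le_trans _ _ ((expR (- x) * h)%:E * (4 * Num.sqrt (x - s))%:E)%E).
    by apply: lee_wpmul2l; rewrite ?lee_fin//; exact: brownian_abs_moment.
  rewrite -EFinM lee_fin; set u := x - s in u0 *.
  have -> : - x = - s + - u by rewrite /u; ring.
  rewrite expRD; have Es := expR_gt0 (- s).
  have e1 : e i.+1 = expR (- (u / 2)) by [].
  have e0 : e i = expR (- (u / 2)) * expR (h / 2).
    rewrite /e -expRD; congr expR; have := mesh_step s b n i.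
    by rewrite -/h /u /x /xi => <-; field.
  have eu : expR (- u) = expR (- (u / 2)) * expR (- (u / 2)).
    by rewrite -expRD; congr expR; field.
  set E := expR (- (u / 2)) in e0 e1 eu *.
  have E0 : 0 < E by exact: expR_gt0.
  have h2 : h / 2 <= expR (h / 2) - 1 by have := expR_ge1Dx (h / 2); lra.
  have sq : Num.sqrt u * E <= 2.
    have su : Num.sqrt u <= 1 + u.
      have s2 := sqr_sqrtr (ltW u0); have := sqr_ge0 (Num.sqrt u - 1).
      by rewrite sqrrB mulr1 expr1n s2; have := sqrtr_ge0 u; lra.
    rewrite /E expRN ler_pdivrMr ?expR_gt0//.
    by have := expR_ge1Dx (u / 2); lra.
  rewrite e0 e1 eu (_ : E * expR (h / 2) - E = E * (expR (h / 2) - 1)); last by ring.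
  have -> : expR (- s) * (E * E) * h * (4 * Num.sqrt u) =
    expR (- s) * (E * (4 * (Num.sqrt u * E) * h)) by ring.
  have -> : 16 * expR (- s) * (E * (expR (h / 2) - 1)) =
    expR (- s) * (E * (16 * (expR (h / 2) - 1))) by ring.
  rewrite ler_pM2l// ler_pM2l//.
  have : Num.sqrt u * E * h <= 2 * h by rewrite ler_pM2r.
  by lra.
rewrite sumEFin lee_fin -mulr_sumr -[leRHS]mulr1.
apply: ler_wpM2l; first by rewrite mulr_ge0 ?expR_ge0.
rewrite -(big_mkord xpredT (fun i => e i - e i.+1)).
rewrite (_ : \sum_(0 <= i < n.+1) (e i - e i.+1) = e 0%N - e n.+1); last first.
  have := telescope_sumr (fun i => - e i) (leq0n n.+1).
  rewrite opprK addrC => <-; apply: eq_bigr => i _; ring.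
rewrite /e mesh0 subrr mul0r oppr0 expR0 gerBl; exact: expR_ge0.
Qed.

Let einf_le (u : nat -> \bar R) (C : \bar R) : (forall n, u n <= C)%E -> (limn_einf u <= C)%E.
Proof.
move=> uC; rewrite limn_einf_lim; apply: lime_le; first exact: is_cvg_einfs.
by apply: nearW => n; apply: le_trans (uC n); apply: ereal_inf_lbound; exists n => /=.
Qed.

(** Fatou is used twice, for Riemann sums on [[s, b m]] and then for growing [m], so the total has
    finite expectation and is almost surely finite. Lower limits are measurable functions of every
    [w]; on continuous paths they are genuine limits and equal the running integrals and their
    supremum. *)
Lemma weighted_noise_bounded : {ae P, forall w, exists K : R, forall t, s <= t ->
  running (fun t => expR (- t) * `|path w t|) s t <= K}.
Proof.
have [_ _ _ _ cB] := BM.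
pose b m := s + m.+1%:R; have sb m : s < b m by rewrite ltrDl.
pose h m w := limn_einf (fun n => (rsum (b m) n w)%:E).
have mh m : measurable_fun setT (h m).
  by apply: measurable_limn_einf => n; apply/measurable_EFinP; exact: measurable_rsum.
have h0 m w : (0 <= h m w)%E.
  rewrite /h limn_einf_lim; apply: lime_ge; first exact: is_cvg_einfs.
  apply: nearW => n; apply: le_ereal_inf_tmp => _ [k _ <-]; rewrite lee_fin; exact: rsum_ge0.
have hC m : (\int[P]_w h m w <= (16 * expR (- s))%:E)%E.
  apply: le_trans (fatou P measurableT _ _) _.
  - by move=> n; apply/measurable_EFinP; exact: measurable_rsum.
  - by move=> n w _; rewrite lee_fin; exact: rsum_ge0.
  by apply: einf_le => n; exact: rsum_expectation.
pose g w := limn_einf (h ^~ w).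
have mg : measurable_fun setT g by exact: measurable_limn_einf.
have g0 w : (0 <= g w)%E.
  rewrite /g limn_einf_lim; apply: lime_ge; first exact: is_cvg_einfs.
  by apply: nearW => n; apply: le_ereal_inf_tmp => _ [k _ <-].
have Ig : P.-integrable setT g.
  apply/integrableP; split => //.
  under eq_integral do rewrite gee0_abs//.
  apply: le_lt_trans (fatou P measurableT mh (fun n w _ => h0 n w)) _.
  by apply: le_lt_trans (einf_le hC) _; rewrite ltry.
have ag := integrable_ae measurableT Ig.
apply: filterS2 ag cB => w gfin cw.
have cp : continuous (path w).
  move=> t; apply: (continuous_comp (f := fun t => t - s)); last exact: freeze_continuous cw _.
  by apply: cvgB; [exact: cvg_id|exact: cvg_cst].
pose f t := expR (- t) * `|path w t|.
have cf : continuous f.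
  move=> t; apply: cvgM; last by apply: cvg_norm; exact: cp.
  by apply: continuous_comp; [exact: cvgN|exact: continuous_expR].
have f0 t : 0 <= f t by rewrite mulr_ge0 ?expR_ge0.
have mono x y : s <= x -> x <= y -> running f s x <= running f s y.
  move=> sx xy; have sub : `[x, y] `<=` (`[s, y] : set R).
    by move=> z /=; rewrite !in_itv/= => /andP[xz ->]; rewrite (le_trans sx).
  apply: (mvt_le (df := f) xy) => //.
  - by move=> z /andP[xz _]; apply: running_derive => //; exact: le_lt_trans xz.
  - by apply: continuous_subspaceW sub _; exact: running_within.
have hE m : h m w = (running f s (b m))%:E.
  have cv : rsum (b m) n w @[n --> \oo] --> running f s (b m) - running f s s.
    have := @riemann_stieltjes_cvg R s (b m) f (fun t => t) (fun=> 1) (running f s) 1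
      (xi (b m)) (ltW (sb m)) cf (fun t => der_id t).
    have H1 : forall t, s <= t <= b m -> `|1 : R| <= 1 by move=> t _; rewrite normr1.
    have H2 : {within `[s, b m], continuous (running f s)} by exact: running_within.
    have H3 : forall t, s < t < b m -> has_derive (running f s) t (f t * 1).
      by move=> t /andP[st _]; rewrite mulr1; exact: running_derive.
    have H4 : forall n i, (i <= n)%N -> mesh s (b m) n i <= xi (b m) n i <= mesh s (b m) n i.+1.
      by move=> n i _; rewrite lexx andbT mesh_le// ltW.
    move=> /(_ H1 H2 H3 H4); apply: cvg_trans; apply: near_eq_cvg; apply: nearW => n.
    apply: eq_bigr => i _; rewrite mesh_step /f /path freezeE//.
    by rewrite subr_ge0 ltW// xi_gt.
  rewrite running0 subr0 in cv.
  have cvE : (rsum (b m) n w)%:E @[n --> \oo] --> (running f s (b m))%:E.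
    by apply: cvg_EFin; [exact: nearW|exact: cv].
  by rewrite /h (cvg_limn_einf_sup cvE).1.
have ndh : {homo h^~ w : m n / (m <= n)%N >-> (m <= n)%E}.
  move=> m n mn; rewrite !hE lee_fin mono//; first by rewrite ltW.
  by rewrite /b lerD2l ler_nat.
have gE := (cvg_limn_einf_sup (ereal_nondecreasing_cvgn ndh)).1.
exists (fine (g w)) => t st.
have [m tm] : exists m : nat, t <= b m.
  exists (Num.truncn (t - s)); rewrite /b.
  have := truncn_itv (_ : 0 <= t - s); rewrite subr_ge0 => /(_ st)/andP[_ h1].
  by move: h1; lra.
apply: (le_trans (mono _ _ st tm)).
rewrite -lee_fin (@fineK _ (g w)); last exact: gfin I.
by rewrite -hE /g gE; apply: ereal_sup_ubound; exists m.
Qed.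

End weighted_noise_bounded.

(** * Escape probabilities for fixed [eps] and [s] *)

Section escape_probability.
Context (R : realType) d (T : measurableType d) (P : probability T R).
Variables (a c eps s : R) (psi psi1 : R -> R) (W q p : R -> T -> R).
Hypotheses (a_gt0 : 0 < a) (c_gt0 : 0 < c) (eps_gt0 : 0 < eps) (s_lt0 : s < 0).
Hypothesis ker : adjoint_kernel a eps psi psi1.
Let B u w := W (s + u) w - W s w.
Hypothesis BM : standard_brownian_motion P B.
Hypothesis mqp : forall t, s <= t -> measurable_fun setT (q t) /\ measurable_fun setT (p t).
Hypothesis cqp : forall w, {within `[s, +oo[, continuous (q ^~ w)} /\
  {within `[s, +oo[, continuous (p ^~ w)}.
Hypothesis qp0 : {ae P, forall w, q s w = 0 /\ p s w = 0}.
Hypothesis qp_eq : {ae P, forall w, forall t, s <= t ->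
  q t w - q s w = \int[lebesgue_measure]_(u in `[s, t]) p u w /\
  a * (p t w - p s w) =
    \int[lebesgue_measure]_(u in `[s, t]) (- p u w + eps^-1 * (u * q u w + eps))
    + c * (W t w - W s w)}.

Let B0 w : B 0 w = 0. Proof. by rewrite /B addr0 subrr. Qed.

Let Bp w t := freeze 0 (B ^~ w) (t - s).
Let qp w := freeze s (q ^~ w).
Let pp w := freeze s (p ^~ w).

Let cq w : continuous (qp w). Proof. exact: freeze_continuous (cqp w).1. Qed.
Let cp w : continuous (pp w). Proof. exact: freeze_continuous (cqp w).2. Qed.

Let BpE w t : s <= t -> Bp w t = B (t - s) w.
Proof. by move=> st; rewrite /Bp freezeE// subr_ge0. Qed.

Let Bps w : Bp w s = 0.
Proof. by rewrite BpE// subrr B0. Qed.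

Let good w := [/\ continuous (Bp w), forall t, s <= t -> qp w t = running (pp w) s t &
  forall t, s <= t -> a * pp w t =
    running (fun u => - pp w u + eps^-1 * (u * qp w u + eps)) s t + c * Bp w t].

Let ae_good : {ae P, forall w, good w}.
Proof.
have [_ _ _ _ cB] := BM.
apply: filterS3 qp0 qp_eq cB => w [q0 p0] eqs cw; split.
- move=> t; apply: (continuous_comp (f := fun t => t - s)); last exact: freeze_continuous cw _.
  by apply: cvgB; [exact: cvg_id|exact: cvg_cst].
- move=> t st; rewrite (@eq_running _ (pp w) (p ^~ w)); last by move=> u su; exact: freezeE.
  by have [+ _] := eqs t st; rewrite q0 subr0 /qp freezeE.
move=> t st.
rewrite (@eq_running _ _ (fun u => - p u w + eps^-1 * (u * q u w + eps))); last first.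
  by move=> u su; rewrite /pp /qp !freezeE.
have [_] := eqs t st; rewrite p0 subr0 /pp freezeE// => ->.
by rewrite BpE// /B (addrC s) subrK.
Qed.

Let J t w := noise_functional a c s psi psi1 (Bp w) (qp w) (pp w) t.

Let measurable_J t : s <= t -> measurable_fun setT (J t).
Proof.
move=> st; have [mq mp] := mqp st.
have -> : J t = fun w => (a * psi t * (p t w - c / a * B (t - s) w)
    + (psi t - a * psi1 t) * q t w - (prim psi t - prim psi s)) / c.
  by apply/funext => w; rewrite /J /noise_functional /growth_functional BpE// /qp /pp !freezeE.
have [mB _ _ _ _] := BM.
have mBt : measurable_fun setT (B (t - s)) by apply: mB; rewrite subr_ge0.
apply: measurable_funM => //; apply: measurable_funB => //; apply: measurable_funD.
  apply: measurable_funM => //; apply: measurable_funB => //.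
  exact: measurable_funM.
exact: measurable_funM.
Qed.

Let psi2_tame : tame (fun t => psi t ^+ 2).
Proof.
have [C HC] := tame_bounded (kernel_tame ker).
have := tameM (kernel_tame ker) (kernel_continuous ker) HC.
by congr tame; apply/funext => t; rewrite expr2.
Qed.

(** The expanded primitive of [(psi t - psi t0) ^+ 2], the squared integrand of the Wiener integral
    that [J t0] represents. *)
Let F t0 t := prim (fun t => psi t ^+ 2) t - 2 * psi t0 * prim psi t + psi t0 ^+ 2 * t.

Let dF t0 (t : R) : is_derive t 1 (F t0) ((psi t - psi t0) ^+ 2).
Proof.
have d1 := is_derive_prim t psi2_tame; have d2 := is_derive_prim t (kernel_tame ker).
by rewrite /F; der_auto; ring.
Qed.

(* The variance of J t0. *)
Let V t0 := F t0 t0 - F t0 s.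

(** Subtracting [psi t0] makes the weight vanish at the final time, so that summation by parts turns
    the Riemann sums of [J t0] into combinations of independent increments without boundary term. *)
Let sumsg sg t0 n w : R := \sum_(i < n.+1) (sg * (psi (mesh s t0 n i) - psi t0)) *
  (B (mesh s t0 n i.+1 - s) w - B (mesh s t0 n i - s) w).

Let measurable_sumsg sg t0 n : s < t0 -> measurable_fun setT (sumsg sg t0 n).
Proof.
move=> st; have [mB _ _ _ _] := BM.
have m i : measurable_fun setT (B (mesh s t0 n i - s)).
  by apply: mB; rewrite subr_ge0 -{1}(mesh0 s t0 n) mesh_le// ltW.
by apply: measurable_sum => i; apply: measurable_funM => //; apply: measurable_funB.
Qed.

Let sumsg_cvg sg t0 w : s < t0 -> good w -> sumsg sg t0 n w @[n --> \oo] --> sg * J t0 w.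
Proof.
move=> st [cB hq hp].
have Js : J s w = 0.
  exact: (noise_functional0 psi psi1 a_gt0 (Bps w) hq hp).
have := @riemann_stieltjes_cvg R s t0 (Bp w) (fun t => - psi t) (fun t => - psi1 t)
  (J ^~ w) _ (fun n i => mesh s t0 n i.+1) (ltW st) cB.
have [K HK] := tame_bounded (kernel1_tame ker).
move=> /(_ K) H.
have {}H : \sum_(i < n.+1) Bp w (mesh s t0 n i.+1) * (- psi (mesh s t0 n i.+1) - - psi (mesh s t0 n i))
    @[n --> \oo] --> J t0 w - J s w.
  apply: H.
  - by move=> t; have d1 := kernel_derive ker t; rewrite /has_derive; der_auto.
  - by move=> t _; rewrite normrN.
  - apply: continuous_subspaceT; apply: noise_functional_continuous => //; first exact: ker.
  - move=> t /andP[t1 _].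
    have := noise_functional_derive a_gt0 c_gt0 eps_gt0 ker (@cq w) (@cp w) hq hp t1.
    by rewrite mulrN [Bp w t * _]mulrC.
  - by move=> n i _; rewrite lexx andbT mesh_le// ltW.
rewrite Js subr0 in H.
have E n : sumsg sg t0 n w = sg * \sum_(i < n.+1) Bp w (mesh s t0 n i.+1) *
    (- psi (mesh s t0 n i.+1) - - psi (mesh s t0 n i)).
  rewrite mulr_sumr; apply/eqP; rewrite -subr_eq0 -sumrB.
  pose t i := mesh s t0 n i.
  (* The two sums differ by the telescoping sum of [G], which is zero at the first point because [B]
     starts at 0 and at the last because the weight vanishes there. *)
  pose G i := sg * (psi (t i) - psi t0) * B (t i - s) w.
  have -> : \sum_(i < n.+1) (sg * (psi (t i) - psi t0) * (B (t i.+1 - s) w - B (t i - s) w)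
      - sg * (Bp w (t i.+1) * (- psi (t i.+1) - - psi (t i))))
      = \sum_(i < n.+1) (G i.+1 - G i).
    apply: eq_bigr => i _; rewrite BpE; first by rewrite /G; ring.
    by rewrite -(mesh0 s t0 n) mesh_le// ltW.
  rewrite -(big_mkord xpredT (fun i => G i.+1 - G i)) telescope_sumr//.
  by rewrite /G /t meshn mesh0 !subrr B0 !mulr0 mul0r subrr.
by under eq_fun do rewrite E; exact: cvgMl_tmp.
Qed.

Let v sg t0 n := \sum_(i < n.+1) (sg * (psi (mesh s t0 n i) - psi t0)) ^+ 2 *
  ((mesh s t0 n i.+1 - s) - (mesh s t0 n i - s)).

Let v_cvg sg t0 : sg ^+ 2 = 1 -> s < t0 -> v sg t0 n @[n --> \oo] --> V t0.
Proof.
move=> sg1 st.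
have H := @riemann_stieltjes_cvg R s t0 (fun t => (psi t - psi t0) ^+ 2) (fun t => t) (fun=> 1)
  (F t0) 1 (fun n i => mesh s t0 n i) (ltW st).
have -> : v sg t0 = fun n => \sum_(i < n.+1) (psi (mesh s t0 n i) - psi t0) ^+ 2 *
    (mesh s t0 n i.+1 - mesh s t0 n i).
  apply/funext => n; apply: eq_bigr => i _; rewrite exprMn sg1 mul1r; congr (_ * _); ring.
apply: H.
- apply: (@continuous_is_derive _ _ (fun t => 2 * (psi t - psi t0) * psi1 t)) => t.
  by have d1 := kernel_derive ker t; der_auto; ring.
- by move=> t; exact: der_id.
- by move=> t _; rewrite normr1.
- by apply: continuous_subspaceT; exact: continuous_is_derive (dF t0).
- by move=> t _; rewrite mulr1; exact: dF.
- by move=> n i _; rewrite lexx mesh_le// ltW.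
Qed.

Let noise_tail sg t0 z : sg ^+ 2 = 1 -> s < t0 -> 0 < V t0 ->
  ((normal_cdf (- (z / Num.sqrt (V t0))))%:E <= P [set w | (z < sg * J t0 w)%R])%E.
Proof.
move=> sg1 st V0.
have mJ := measurable_J (ltW st).
have mE : measurable [set w | z < sg * J t0 w].
  have -> : [set w | z < sg * J t0 w] = (fun w => sg * J t0 w) @^-1` `]z, +oo[%classic.
    by apply/seteqP; split=> w; rewrite /= in_itv/= andbT.
  rewrite -[S in measurable S]setTI; have mf : measurable_fun setT (fun w => sg * J t0 w).
    exact: measurable_funM.
  exact: mf.
apply: (@tail_limit _ _ _ P (sumsg sg t0) _ (v sg t0) (V t0) z _ mE V0 (v_cvg sg1 st)).
- by move=> n; exact: measurable_sumsg.
- move=> y; have Hv : \forall n \near \oo, 0 < v sg t0 n by exact: (cvgr_gt _ (v_cvg sg1 st)).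
  apply: filterS Hv => n vn0.
  have u0 : 0 <= mesh s t0 n 0 - s by rewrite mesh0 subrr.
  have ui i : mesh s t0 n i - s < mesh s t0 n i.+1 - s.
    by rewrite ltrD2r -subr_gt0 mesh_step divr_gt0// subr_gt0.
  have := brownian_linear_combination BM n.+1 (fun i => sg * (psi (mesh s t0 n i) - psi t0))
    u0 ui (measurable_itv `]y, +oo[).
  rewrite -/(v sg t0 n) => E.
  rewrite -(gauss_gt y vn0) -E le_eqVlt; apply/orP; left; apply/eqP; congr (P _).
  by apply/seteqP; split=> w; rewrite /= in_itv/= andbT.
- apply: filterS ae_good => w gw; exists (sg * J t0 w); split=> //.
  exact: sumsg_cvg.
Qed.

Let v_inf := total (fun t => psi t ^+ 2) - prim (fun t => psi t ^+ 2) s.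
Let m_inf := total psi - prim psi s.

(** The terms containing [psi t0] disappear in the limit. One of them carries the factor [t0], so
    the decay of [t * psi t] is needed and not only that of [psi]. *)
Let V_cvg : V n%:R @[n --> \oo] --> v_inf.
Proof.
suff H : V t @[t --> +oo] --> v_inf.
  have /cvg_pinftyP /(_ (fun n => n%:R)) := H; apply; exact: cvgr_idn.
have -> : V = fun t => (prim (fun t => psi t ^+ 2) t - prim (fun t => psi t ^+ 2) s)
   - 2 * (psi t * (prim psi t - prim psi s)) + psi t * (t * psi t - s * psi t).
  by apply/funext => t; rewrite /V /F; ring.
have p0 := tame_cvgy (kernel_tame ker).
have tp0 : t * psi t @[t --> +oo] --> (0 : R).
  have [_ _ [kap k0 [dec _]] _] := ker.
  apply: (@tame_cvgy _ (fun t => t * psi t)); apply: decay_tame (decay_id_mul k0 dec).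
    by rewrite divr_gt0.
  by apply: continuous_mul; [move=> t; exact: cvg_id|exact: kernel_continuous ker].
have h1 : prim (fun t => psi t ^+ 2) t - prim (fun t => psi t ^+ 2) s @[t --> +oo] --> v_inf.
  by apply: cvgB; [exact: prim_cvgy|exact: cvg_cst].
have h2 : psi t * (prim psi t - prim psi s) @[t --> +oo] --> 0 * m_inf.
  by apply: cvgM p0 _; apply: cvgB; [exact: prim_cvgy (kernel_tame ker)|exact: cvg_cst].
have h3 : psi t * (t * psi t - s * psi t) @[t --> +oo] --> 0 * (0 - s * 0).
  by apply: (cvgM p0); apply: (cvgB tp0); exact: (cvgMl_tmp p0).
have -> : v_inf = v_inf - 2 * (0 * m_inf) + 0 * (0 - s * 0) by ring.
by apply: cvgD h3; apply: cvgB h1 _; exact: cvgMl_tmp.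
Qed.

(** As [s < 0], the tail from [s] contains [[0, 1]], where [psi] is positive. *)
Let v_inf_gt0 : 0 < v_inf.
Proof.
have mono x y : x <= y -> prim (fun t => psi t ^+ 2) x <= prim (fun t => psi t ^+ 2) y.
  move=> xy; apply: (derive_ge0_le xy (fun t _ => is_derive_prim t psi2_tame)).
  by move=> t _; exact: sqr_ge0.
have [_ _ _ pos] := ker.
have h1 : prim (fun t => psi t ^+ 2) 0 < prim (fun t => psi t ^+ 2) 1.
  apply: (derive_gt0_lt ltr01 (fun t _ => is_derive_prim t psi2_tame)) => t /andP[t0 _].
  by have [pt _] := pos t t0; rewrite exprn_gt0.
have h2 : prim (fun t => psi t ^+ 2) 1 <= total (fun t => psi t ^+ 2).
  apply: (cvg_ge_near _ (prim_cvgy psi2_tame)); near=> t; apply: mono.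
  by near: t; apply: nbhs_pinfty_ge; rewrite num_real.
by rewrite subr_gt0 (le_lt_trans (mono _ _ (ltW s_lt0)))// (lt_le_trans h1).
Unshelve. all: end_near. Qed.

Let escape sg : set T := [set w | sg * q t w @[t --> +oo] --> +oo].

(** The points [m + j / (k + 1)] are dense in the half-line from [m] and lie after [s]. Since every
    path of [q] is continuous, bounds at these times extend to all later times, and divergence
    becomes a countable combination of measurable conditions. *)
Let measurable_escape sg : measurable (escape sg).
Proof.
pose tt (m j k : nat) : R := m%:R + j%:R / k.+1%:R.
have tt_ge m j k : m%:R <= tt m j k by rewrite lerDl divr_ge0.
have stt m j k : s <= tt m j k by rewrite ltW// (lt_le_trans s_lt0)// (le_trans _ (tt_ge m j k)).
have -> : escape sg = \bigcap_(n : nat) \bigcup_(m : nat) \bigcap_(j : nat) \bigcap_(k : nat)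
    [set w | n%:R <= sg * q (tt m j k) w].
  apply/seteqP; split=> w.
    move=> /cvgryPge H n _; have [M [_ HM]] := H n%:R.
    exists (Num.truncn `|M|).+1 => // j _ k _ /=; apply: HM.
    apply: le_lt_trans (ler_norm M) _; apply: lt_le_trans (tt_ge _ _ _).
    by have /andP[] := truncn_itv (normr_ge0 M).
  move=> H; apply/cvgryPge => A.
  have [m _ Hm] := H (Num.truncn `|A|).+1 I.
  near=> t; have mt : m%:R <= t by near: t; apply: nbhs_pinfty_ge; rewrite num_real.
  have st : s < t by rewrite (lt_le_trans s_lt0)// (le_trans _ mt).
  apply: (@le_trans _ _ ((Num.truncn `|A|).+1%:R)).
    apply: le_trans (ler_norm A) _.
    by have /andP[_ /ltW] := truncn_itv (normr_ge0 A).
  have cg : continuous (fun t => sg * qp w t).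
    by move=> x; apply: cvgM; [exact: cvg_cst|exact: cq].
  pose u k := tt m (Num.truncn ((t - m%:R) * k.+1%:R)) k.
  have ut : u k @[k --> \oo] --> t.
    apply/cvgrPdist_le => e e0; near=> k.
    have tm : 0 <= (t - m%:R) * k.+1%:R by rewrite mulr_ge0// subr_ge0.
    have /andP[l1 l2] := truncn_itv tm.
    have k0 : 0 < k.+1%:R :> R by [].
    rewrite /u /tt; set j := Num.truncn _ in l1 l2 *.
    have h1 : j%:R / k.+1%:R <= t - m%:R by rewrite ler_pdivrMr.
    have h2 : t - m%:R < j%:R / k.+1%:R + k.+1%:R^-1.
      have -> : j%:R / k.+1%:R + k.+1%:R^-1 = (j%:R + 1) / k.+1%:R :> R by rewrite mulrDl mul1r.
      by rewrite ltr_pdivlMr// natr1.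
    have h3 : k.+1%:R^-1 <= e.
      rewrite -[leRHS]invrK lef_pV2 ?posrE ?invr_gt0//.
      apply: (@le_trans _ _ k%:R); last by rewrite ler_nat.
      by near: k; exact: nbhs_infty_ger.
    clearbody j; move: h1 h2 h3; set z := j%:R / k.+1%:R; set iv := k.+1%:R^-1.
    clearbody z iv => h1 h2 h3; rewrite ler_norml; apply/andP; split; lra.
  have gu : sg * qp w (u k) @[k --> \oo] --> sg * qp w t.
    exact: (continuous_cvg _ (cg t)).
  have -> : sg * q t w = sg * qp w t by rewrite /qp freezeE// ltW.
  apply: (cvg_ge_near _ gu); apply: nearW => k.
  by rewrite /qp freezeE; [exact: (Hm _ I k I)|exact: stt].
apply: bigcap_measurableType => n _; apply: bigcup_measurable => m _.
apply: bigcap_measurableType => j _; apply: bigcap_measurableType => k _.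
have -> : [set w | n%:R <= sg * q (tt m j k) w] =
    (fun w => sg * q (tt m j k) w) @^-1` `[n%:R, +oo[%classic.
  by apply/seteqP; split=> w; rewrite /= in_itv/= andbT.
rewrite -[S in measurable S]setTI.
have mf : measurable_fun setT (fun w => sg * q (tt m j k) w).
  by apply: measurable_funM => //; exact: (mqp (stt m j k)).1.
exact: mf.
Unshelve. all: end_near. Qed.

(** Second use of [tail_limit], now along integer times and with the escape event as target: when
    the limit of [sg * J] passes the threshold, [sg * Y] has a positive limit and [escape_to_pinfty]
    applies. *)
Let escape_ge sg : sg = 1 \/ sg = -1 ->
  ((normal_cdf (sg * (m_inf / (c * Num.sqrt v_inf))))%:E <= P (escape sg))%E.
Proof.
move=> sg1; have sg2 : sg ^+ 2 = 1 by case: sg1 => ->; rewrite ?sqrrN expr1n.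
have ns (n : nat) : s < n%:R by exact: lt_le_trans s_lt0 _.
(* The threshold is [- (sg * m_inf / c)], the value of [sg * J] at which [sg * (m_inf + c * J)]
   changes sign. *)
have -> : sg * (m_inf / (c * Num.sqrt v_inf)) = - (- (sg * m_inf / c) / Num.sqrt v_inf).
  field; rewrite (gt_eqF c_gt0) gt_eqF// sqrtr_gt0; exact: v_inf_gt0.
apply: (@tail_limit _ _ _ P (fun n w => sg * J n%:R w) _ (fun n => V n%:R) v_inf
  _ _ (measurable_escape sg) v_inf_gt0 V_cvg).
- by move=> n; apply: measurable_funM => //; apply: measurable_J; exact: ltW.
- move=> z; have Hv : \forall n \near \oo, 0 < V n%:R by exact: (cvgr_gt _ V_cvg).
  by apply: filterS Hv => n vn; exact: noise_tail.
apply: filterS2 ae_good (weighted_noise_bounded BM B0 s) => w [cB hq hp] [K HK].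
have [l Jl] := noise_functional_cvg a_gt0 c_gt0 eps_gt0 ker cB (@cq w) (@cp w) (Bps w) hq hp HK.
exists (sg * l); split.
  apply: cvgMl_tmp.
  have /cvg_pinftyP /(_ (fun n => n%:R)) := Jl; apply; exact: cvgr_idn.
rewrite ltrNl => yl.
have y0 : 0 < sg * (m_inf + c * l).
  have : - (sg * l) * c < sg * m_inf / c * c by rewrite ltr_pM2r.
  by rewrite divfK ?gt_eqF//; lra.
have Yl : sg * growth_functional a c psi psi1 (Bp w) (qp w) (pp w) t @[t --> +oo] -->
    sg * (m_inf + c * l).
  apply: cvgMl_tmp; rewrite (funext (growth_functionalE a s psi psi1 _ _ _ c_gt0)).
  apply: cvgD; last exact: cvgMl_tmp.
  by apply: cvgB; [exact: prim_cvgy (kernel_tame ker)|exact: cvg_cst].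
have := escape_to_pinfty a_gt0 c_gt0 ker cB (@cp w) hq HK sg1 y0 Yl.
apply: cvg_trans; apply: near_eq_cvg; near=> t.
rewrite /qp freezeE//; near: t; apply: nbhs_pinfty_ge; rewrite num_real.
Unshelve. all: end_near. Qed.

(** Both values are lower bounds by [escape_ge]. They add up to one by [normal_cdfN], and the events
    are disjoint, so neither bound can be strict. *)
Lemma escape_probabilities :
  let x := (total psi - prim psi s) /
    (c * Num.sqrt (total (fun t => psi t ^+ 2) - prim (fun t => psi t ^+ 2) s)) in
  P [set w | q t w @[t --> +oo] --> +oo] = (normal_cdf x)%:E /\
  P [set w | q t w @[t --> +oo] --> -oo] = (normal_cdf (- x))%:E.
Proof.
move=> x.
have E1 : escape 1 = [set w | q t w @[t --> +oo] --> +oo].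
  apply/funext => w; rewrite /escape /= /mkset (_ : (fun t => 1 * q t w) = q ^~ w)//.
  by apply/funext => t; rewrite mul1r.
have E2 : escape (-1) = [set w | q t w @[t --> +oo] --> -oo].
  apply/seteqP; split=> w; rewrite /escape /=.
    move=> /cvgryPge H; apply/cvgrNyPle => A; have := H (- A).
    by apply: filterS => t; rewrite mulN1r lerN2.
  move=> /cvgrNyPle H; apply/cvgryPge => A; have := H (- A).
  by apply: filterS => t; rewrite mulN1r => h; rewrite lerNr.
have h1 := escape_ge (or_introl erefl); have h2 := escape_ge (or_intror erefl).
rewrite mul1r -/x E1 in h1; rewrite mulN1r -/x E2 in h2.
have m1 := measurable_escape 1; have m2 := measurable_escape (-1).
rewrite E1 in m1; rewrite E2 in m2.
set A1 := [set w | _] in h1 m1 *; set A2 := [set w | q t w @[t --> +oo] --> -oo] in h2 m2 *.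
have dis : A1 `&` A2 = set0.
  apply/seteqP; split=> w //= [] /cvgryPge /(_ 1) H1 /cvgrNyPle /(_ 0) H2.
  have : \forall t \near (+oo : set_system R), False.
    by apply: filterS2 H1 H2 => t h h'; have := le_trans h h'; rewrite ler10.
  by move=> /filter_const.
have le1 : (P A1 + P A2 <= 1)%E.
  rewrite -measureU//; apply: probability_le1; exact: measurableU.
have f1 := fin_num_measure P _ m1; have f2 := fin_num_measure P _ m2.
move: h1 h2 le1; rewrite -(fineK f1) -(fineK f2) -EFinD !lee_fin => h1 h2 le1.
have := normal_cdfN x; move=> hN.
by split; congr EFin; apply/eqP; rewrite eq_le; apply/andP; split; lra.
Qed.

End escape_probability.

(** * The limits in [s] and in [eps] *)

Section limits.
Context {R : realType}.
Implicit Types (x y e : R).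

Lemma limf_einf_cvg (f : R -> \bar R) (g : R -> R) (G : set_system R) (FG : ProperFilter G) (l : R) :
  (\forall x \near G, f x = (g x)%:E) -> g x @[x --> G] --> l -> limf_einf f G = l%:E.
Proof.
move=> fg gl; rewrite limf_einfE; apply/eqP; rewrite eq_le; apply/andP; split.
  apply: ge_ereal_sup => _ [V GV <-]; apply/lee_addgt0Pr => e e0.
  have Hl : \forall x \near G, g x <= l + e.
    by apply: (cvgr_le _ gl); rewrite ltrDl.
  have [x [[Vx fx] gx]] := filter_ex (filterI (filterI GV fg) Hl).
  apply: (@le_trans _ _ (f x)); first by apply: ereal_inf_lbound; exists x.
  by rewrite fx -EFinD lee_fin.
apply/lee_addgt0Pr => e e0.
have Hl : \forall x \near G, l - e <= g x.
  by apply: (cvgr_ge _ gl); rewrite gtrBl.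
rewrite -leeBlDr//; apply: (@le_trans _ _ (ereal_inf (f @` [set x | (l - e)%:E <= f x]%E))).
  by apply: le_ereal_inf_tmp => _ [x /= h <-]; rewrite -EFinB.
apply: ereal_sup_ubound; exists [set x | (l - e)%:E <= f x]%E => //.
by apply: filterS2 fg Hl => x fx gx /=; rewrite fx lee_fin.
Qed.

Lemma powR_cvg0 (ga : R) : 0 < ga -> e `^ ga @[e --> 0^'+] --> (0 : R).
Proof.
move=> ga0; apply/cvgrPdist_le => r r0; near=> e.
have e0 : 0 < e by near: e; exact: nbhs_right_gt.
rewrite sub0r normrN ger0_norm ?powR_ge0//.
have er : e <= r `^ ga^-1.
  by near: e; apply: nbhs_right_le; rewrite powR_gt0.
have -> : r = (r `^ ga^-1) `^ ga by rewrite -powRrM mulVf ?gt_eqF// powRr1// ltW.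
by apply: ge0_ler_powR; rewrite ?nnegrE ?powR_ge0 ?(ltW ga0) ?(ltW e0).
Unshelve. all: end_near. Qed.

Lemma powR_cvgy (ga : R) : ga < 0 -> e `^ ga @[e --> (0 : R)^'+] --> +oo.
Proof.
move=> ga0; apply/cvgryPge => A.
have Nga : 0 < - ga by rewrite oppr_gt0.
have A1 : 0 < `|A| + 1 by rewrite ltr_wpDl.
have Hh : \forall e \near (0 : R)^'+, e `^ (- ga) <= (`|A| + 1)^-1.
  by apply: (cvgr_le _ (powR_cvg0 Nga)); rewrite invr_gt0.
near=> e; have e0 : 0 < e by near: e; exact: nbhs_right_gt.
have h : e `^ (- ga) <= (`|A| + 1)^-1 by near: e.
have -> : ga = - - ga by rewrite opprK.
rewrite powRN -[leLHS]invrK; apply: (@le_trans _ _ (`|A| + 1)).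
  by rewrite invrK (le_trans (ler_norm _))// lerDl.
by rewrite -[leLHS]invrK lef_pV2 ?posrE ?invr_gt0 ?powR_gt0.
Unshelve. all: end_near. Qed.

End limits.

Section asymptotic_escape.
Context {R : realType}.
Variables (alpha beta eps : R) (d : measure_display) (T : R -> measurableType d)
  (P : forall s, probability (T s) R) (W q p : forall s, R -> T s -> R).
Hypothesis eps_gt0 : 0 < eps.
Hypothesis hsol : forall s : R, s < 0 ->
  sde_solution (P s) alpha beta eps s (@W s) (@q s) (@p s).

Let X : R := Num.sqrt (Num.sqrt (4 * pi)) * eps `^ (4^-1 - alpha).

(** The kernel depends on [a] and [eps] alone, so one [psi] serves all [s], even though each [s] has
    its own probability space. The probabilities are explicit and continuous in the two primitives
    at [s], which vanish at [-oo], so the lower limit is a limit. *)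
Lemma limf_einf_escape :
  limf_einf (fun s : R => P s [set w | @q s t w @[t --> +oo] --> +oo]) -oo = (normal_cdf X)%:E /\
  limf_einf (fun s : R => P s [set w | @q s t w @[t --> +oo] --> -oo]) -oo = (normal_cdf (- X))%:E.
Proof.
pose a := eps `^ beta; pose c := eps `^ alpha.
have a0 : 0 < a by rewrite powR_gt0.
have c0 : 0 < c by rewrite powR_gt0.
have [psi [psi1 ker]] := adjoint_kernel_exists a0 eps_gt0.
pose m s := total psi - prim psi s.
pose v s := total (fun t => psi t ^+ 2) - prim (fun t => psi t ^+ 2) s.
pose x s := m s / (c * Num.sqrt (v s)).
have Px s : s < 0 -> P s [set w | @q s t w @[t --> +oo] --> +oo] = (normal_cdf (x s))%:E /\
    P s [set w | @q s t w @[t --> +oo] --> -oo] = (normal_cdf (- x s))%:E.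
  move=> s0; have [h1 h2 h3 h4 h5] := hsol s0.
  exact: (escape_probabilities a0 c0 eps_gt0 s0 ker h1 h2 h3 h4 h5).
have psi2_tame : tame (fun t => psi t ^+ 2).
  have [C HC] := tame_bounded (kernel_tame ker).
  have := tameM (kernel_tame ker) (kernel_continuous ker) HC.
  by congr tame; apply/funext => t; rewrite expr2.
set S := total (fun t => psi t ^+ 2) in v x Px *.
have mo : 0 < total psi by exact: kernel_total_gt0 ker.
have id : total psi ^+ 2 = S * Num.sqrt (4 * pi * eps) by exact: kernel_moment_identity ker.
have pi40 : 0 < 4 * pi :> R by rewrite mulr_gt0// pi_gt0.
have pe0 : 0 < 4 * pi * eps by rewrite mulr_gt0.
have S0 : 0 < S.
  rewrite -(pmulr_lgt0 _ (_ : 0 < Num.sqrt (4 * pi * eps))) ?sqrtr_gt0// -id.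
  by rewrite exprn_gt0.
(* Positivity of [total psi] selects the positive root in the moment identity; [Num.sqrt S] cancels
   and the fourth root of [4 * pi * eps] over [c] remains. *)
have XE : total psi / (c * Num.sqrt S) = X.
  have -> : total psi = Num.sqrt S * Num.sqrt (Num.sqrt (4 * pi * eps)).
    by rewrite -sqrtrM ?(ltW S0)// -id sqrtr_sqr gtr0_norm.
  rewrite sqrtrM ?(ltW pi40)// sqrtrM ?sqrtr_ge0//.
  have -> : Num.sqrt (Num.sqrt eps) = eps `^ 4^-1.
    rewrite -!powR12_sqrt ?powR_ge0 ?(ltW eps_gt0)// -powRrM; congr (_ `^ _).
    by field.
  rewrite /X powRD; last by rewrite (gt_eqF eps_gt0) implybT.
  rewrite powRN -/c; field.
  by rewrite (gt_eqF c0) gt_eqF// sqrtr_gt0.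
have xcv : x s @[s --> -oo] --> X.
  rewrite -XE; apply: cvgM.
    rewrite -[X in _ --> X]subr0; apply: cvgB; first exact: cvg_cst.
    exact: prim_cvgNy (kernel_tame ker).
  apply: cvgV; first by rewrite mulf_neq0 ?(gt_eqF c0)// gt_eqF// sqrtr_gt0.
  apply: cvgMl_tmp; apply: (continuous_cvg _ (@sqrt_continuous R S)).
  rewrite -[X in _ --> X]subr0; apply: cvgB; first exact: cvg_cst.
  exact: prim_cvgNy.
have sneg : \forall s \near (-oo : set_system R), s < 0.
  by apply: nbhs_ninfty_lt; rewrite num_real.
split.
  apply: (@limf_einf_cvg _ _ (normal_cdf \o x)).
    by apply: filterS sneg => s s0; exact: (Px s s0).1.
  exact: (continuous_cvg _ (@normal_cdf_continuous R X) xcv).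
apply: (@limf_einf_cvg _ _ (fun s => normal_cdf (- x s))).
  by apply: filterS sneg => s s0; exact: (Px s s0).2.
apply: (continuous_cvg _ (@normal_cdf_continuous R (- X))).
exact: cvgN.
Qed.

End asymptotic_escape.

Unset Implicit Arguments.

Theorem theorem2p1 (R : realType) (alpha beta : R) (halpha : - 2^-1 < alpha)
  (d : measure_display) (T : R -> R -> measurableType d)
  (P : forall eps s : R, probability (T eps s) R)
  (W q p : forall eps s : R, R -> T eps s -> R)
  (hsol : forall eps s : R, 0 < eps -> s < 0 ->
     sde_solution (P eps s) alpha beta eps s (W eps s) (q eps s) (p eps s)) :
  (4^-1 < alpha ->
     limf_einf (fun s : R =>
       P eps s [set w | q eps s t w @[t --> +oo] --> +oo]) -oo
     @[eps --> 0^'+] --> 1%E)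
  /\
  (alpha < 4^-1 ->
     (limf_einf (fun s : R =>
        P eps s [set w | q eps s t w @[t --> +oo] --> +oo]) -oo
      @[eps --> 0^'+] --> (2^-1)%:E) /\
     (limf_einf (fun s : R =>
        P eps s [set w | q eps s t w @[t --> +oo] --> -oo]) -oo
      @[eps --> 0^'+] --> (2^-1)%:E)).
Proof.
(* For each [eps] the two lower limits are [normal_cdf] at plus and minus [K] times the power [ga]
   of [eps]. The sign of [ga] sends this argument to [+oo], or to 0 where [normal_cdf] is one
   half. *)
pose K : R := Num.sqrt (Num.sqrt (4 * pi)); pose ga := 4^-1 - alpha.
have K0 : 0 < K by rewrite !sqrtr_gt0 mulr_gt0// pi_gt0.
have eps_pos : \forall eps \near (0 : R)^'+, 0 < eps by exact: nbhs_right_gt.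
have lims eps : 0 < eps -> _ := fun e0 =>
  @limf_einf_escape R alpha beta eps d (T eps) (P eps) (W eps) (q eps) (p eps) e0
    (fun s => hsol eps s e0).
split=> h.
  have ga0 : ga < 0 by rewrite subr_lt0.
  have L : normal_cdf (K * eps `^ ga) @[eps --> (0 : R)^'+] --> (1 : R).
    apply: (@cvg_comp _ _ _ (fun eps => K * eps `^ ga) _ _ +oo); last exact: normal_cdf_cvgy.
    apply/cvgryPge => A; move/cvgryPge : (powR_cvgy ga0) => /(_ (A / K)).
    by apply: filterS => e; rewrite ler_pdivrMr// mulrC.
  have L' : (normal_cdf (K * eps `^ ga))%:E @[eps --> (0 : R)^'+] --> 1%E.
    by apply: cvg_EFin; [exact: nearW|exact: L].
  apply: cvg_trans L'; apply: near_eq_cvg.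
  by apply: filterS eps_pos => eps /lims [-> _].
have ga0 : 0 < ga by rewrite subr_gt0.
have L0 : K * eps `^ ga @[eps --> (0 : R)^'+] --> (0 : R).
  have : K * eps `^ ga @[eps --> (0 : R)^'+] --> K * 0.
    by apply: cvgMl_tmp; exact: powR_cvg0.
  by rewrite mulr0.
have half (g : R -> R) : g eps @[eps --> (0 : R)^'+] --> (0 : R) ->
    (normal_cdf (g eps))%:E @[eps --> (0 : R)^'+] --> (2^-1)%:E.
  move=> g0; apply: cvg_EFin; first exact: nearW.
  by rewrite -(@normal_cdf0 R); exact: (continuous_cvg _ (@normal_cdf_continuous R 0) g0).
split.
  apply: cvg_trans (half _ L0); apply: near_eq_cvg.
  by apply: filterS eps_pos => eps /lims [-> _].
have L1 : - (K * eps `^ ga) @[eps --> (0 : R)^'+] --> (0 : R).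
  have : - (K * eps `^ ga) @[eps --> (0 : R)^'+] --> - (0 : R) by exact: cvgN.
  by rewrite oppr0.
apply: cvg_trans (half _ L1); apply: near_eq_cvg.
by apply: filterS eps_pos => eps /lims [_ ->].
Qed.
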